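(* Let $1\le p<\infty$ and let $\Omega\subset\mathbb{R}^2$ be measurable with $0<|\Omega|<\infty$. The functional $J_{\mathrm{BJ}}(f):=\|W_{\mathrm{BJ}}f\|_{L^p(\Omega)}$ is sequentially weakly continuous on $L^2(\mathbb{R})$; that is, if $f_n\rightharpoonup f$ weakly in $L^2(\mathbb{R})$, then $J_{\mathrm{BJ}}(f_n)\to J_{\mathrm{BJ}}(f)$.
   Context: For $f\in L^2(\mathbb{R})$ and $\tau\in(0,1)$ the $\tau$-Wigner distribution is $$W_\tau f(z)=\int_{\mathbb{R}} e^{-2\pi i\,\xi y} f(x+\tau y)\overline{f(x-(1-\tau)y)}\,dy,\qquad z=(x,\xi)\in\mathbb{R}^2,$$ and the Born--Jordan distribution is $W_{\mathrm{BJ}}f(z)=\int_0^1 W_\tau f(z)\,d\tau$. *)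

(* Defs.v *)
From HB Require Import structures.
From mathcomp Require Import all_boot all_order all_algebra.
From mathcomp Require Import all_classical all_reals all_analysis.
From mathcomp Require Import complex.
Set Implicit Arguments.
Unset Strict Implicit.
Unset Printing Implicit Defensive.
Import Order.TTheory GRing.Theory Num.Theory.
Import numFieldNormedType.Exports.
Local Open Scope classical_set_scope.
Local Open Scope ring_scope.
Local Open Scope complex_scope.

Section defs.
Context {R : realType}.
Implicit Types (f g : R -> R[i]) (t : R).

Definition cabs (z : R[i]) : R := ComplexField.Normc.normc z.

Definition cis t : R[i] := cos t +i* sin t.

Local Notation Re := (@complex.Re R).
Local Notation Im := (@complex.Im R).

Definition cintegral (D : set R) f : R[i] :=
  Rintegral lebesgue_measure D (fun y => Re (f y))
  +i* Rintegral lebesgue_measure D (fun y => Im (f y)).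

(* Elements of L^2(R) are given by representatives.  Every class has a Borel
   one, so it is enough to use the Borel sigma-algebra, which is the canonical
   one on R; all the integrals below depend on the class only. *)
Definition L2 f : Prop :=
  [/\ measurable_fun setT (fun y => Re (f y)),
      measurable_fun setT (fun y => Im (f y)) &
      ('N[lebesgue_measure]_(2%:E)[ (fun y => (cabs (f y))%:E) ] < +oo)%E].

Definition L2dot f g : R[i] := cintegral setT (fun y => f y * conjc (g y)).

Definition weak_cvg (fn : nat -> R -> R[i]) f : Prop :=
  forall g, L2 g ->
    ((fun n => L2dot (fn n) g : R[i]^o) @ \oo --> (L2dot f g : R[i]^o)).

(* [cintegral] is total.  For [f] in L^2 both integrals below converge
   absolutely at every [z], since |tau_wigner t f z| is at most
   ||f||_2^2 / sqrt (t (1 - t)) by the Cauchy-Schwarz inequality. *)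
Definition tau_wigner t f (z : R * R) : R[i] :=
  cintegral setT (fun y =>
    cis (- (2 * pi * z.2 * y))
    * f (z.1 + t * y) * conjc (f (z.1 - (1 - t) * y))).

Definition born_jordan f (z : R * R) : R[i] :=
  cintegral `]0, 1[ (fun t => tau_wigner t f z).

End defs.

(* The product measure lives on the Borel sets of R^2; its completed extension
   lives on the Lebesgue measurable ones. *)
Definition borel_measure2 (R : realType) :
    {measure set (measurableTypeR R * measurableTypeR R) -> \bar R} :=
  (@lebesgue_measure R \x @lebesgue_measure R)%E.

Definition plane (R : realType) :=
  caratheodory_type ((@borel_measure2 R)^*)%mu.

Definition lebesgue_measure2 (R : realType) :
    {measure set (plane R) -> \bar R} :=
  @completed_measure_extension _ _ _ (@borel_measure2 R).

Definition J_BJ (R : realType) (p : R) (Omega : set (plane R))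
    (f : R -> R[i]) : \bar R :=
  ('N[@lebesgue_measure2 R]_(p%:E)
     [(fun z : plane R => (cabs (born_jordan f z))%:E) \_ Omega])%E.

(* Main.v *)
From HB Require Import structures.
Require Import Defs.
From mathcomp Require Import all_boot all_order all_algebra.
From mathcomp Require Import all_classical all_reals all_analysis.
From mathcomp Require Import complex measurable_realfun.
From mathcomp Require Import ring lra.

(** Why weak convergence suffices.

    Write W f (x, xi) as the integral over 0 < t < 1 and y in R of
    e^(- 2 i pi xi y) f (x + t y) conj (f (x - (1 - t) y)).  By Cauchy-Schwarz
    the integral in y is at most ||f||^2 / sqrt (t (1 - t)), and this is
    integrable in t, so |W f| is bounded by a multiple of ||f||^2 on the whole
    plane ([form_le], [born_jordan_le]).  Weakly convergent sequences are bounded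
    ([weak_bounded], by a gliding hump), hence the W f_n are uniformly bounded.
    As Omega has finite measure, all but a small part of it lies in a large
    square; it is therefore enough that W f_n tends to W f in L^1 of every square
    ([Lnorm_restrict_cvg]).

    Pointwise convergence is too much to ask for: with f_n(x) = sqrt n g(n x),
    which tends weakly to 0, the value W f_n (0, 0) does not depend on n.  The
    concentration at y = 0, and the escape at y = oo which is dual to it, are
    removed by splitting the range of y in three ([bj_form_split]).

    - |y| < e.  For fixed (y, t) the integral over x of
      |f (x + t y) f (x - (1 - t) y)| is at most ||f||^2, so this part is at most
      2 e ||f||^2 in L^1(dx), uniformly in xi ([integral_form_near_le]).

    - |y| >= M.  The integral over t of f (x + t y) conj (f (x - (1 - t) y)) is at
      most ||f||^2 / |y| ([fiber_le]), so as a function of y on |y| >= M its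
      squared L^2 norm is O(1 / M).  This part is its Fourier transform, so
      Plancherel makes it small in L^2(d xi), uniformly in x.  Only the norm on a
      bounded range of xi matters, for which an elementary inequality with a
      parabolic window is enough ([window_plancherel], [integral_form_far_le]).

    - e <= |y| < M.  With p = x + t y in place of t, this part becomes the pairing
      of f with the image of f by an integral operator whose kernel is bounded
      with bounded support.  That operator is Hilbert-Schmidt, hence turns weak
      convergence into strong convergence, and this part converges at every point
      ([kernel_op_compact], [form_mid_cvg]), then in L^1 of a square by dominated
      convergence ([bj_mid_box_cvg]).

    Choosing e small and then M large gives the L^1 convergence ([bj_box_cvg]).
    All this is done for real bilinear forms with a cosine or a sine in place of
    the exponential; the real and imaginary parts of W f are signed sums of four
    such forms in the real and imaginary parts of f ([born_jordan_Re],
    [born_jordan_Im]). *)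

Import Order.TTheory GRing.Theory Num.Theory.
Import numFieldNormedType.Exports.
Local Open Scope classical_set_scope.
Local Open Scope ring_scope.

Set Implicit Arguments.
Unset Strict Implicit.
Unset Printing Implicit Defensive.

(** * Integration on the line and on the plane *)

Section measure_toolkit.
Context {R : realType}.
Local Notation mu := (@lebesgue_measure R).
Local Notation RT := (measurableTypeR R).

Lemma lebesgue_measure_affine (c a : R) (A : set RT) : a != 0 ->
  measurable A ->
  (mu ((fun y : R => c + a * y)%R @^-1` A) = (`|a|^-1)%:E * mu A)%E.
Proof.
move=> a0 mA.
have mf : measurable_fun setT (fun y : RT => (c + a * y)%R : RT).
  by apply: measurable_funD => //; exact: measurable_funM.
pose phi : RT -> RT := fun y => c + a * y.
have na0 : 0 <= `|a| by [].
have mphi : measurable_fun setT phi by [].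
suff H : mu A = (`|a|%:E * mu (phi @^-1` A))%E.
  by rewrite H muleA -EFinM mulVf ?mul1e// normr_eq0.
pose nu := mscale (NngNum na0) (pushforward mu phi).
have -> : (`|a|%:E * mu (phi @^-1` A) = nu mphi A)%E by [].
move: A mA; apply: lebesgue_measure_unique => _ [[u v]] _ <-/=.
rewrite /nu /mscale /= /pushforward.
(* The preimage of ]u, v] is open on the left or on the right according to the
   sign of a, so the two signs are treated apart. *)
have [ap|an] : 0 < a \/ a < 0 by case: (ltgtP a 0) a0 => //; [right|left].
- rewrite (_ : phi @^-1` _ = `](u - c) / a, (v - c) / a]%classic); last first.
    apply/seteqP; split => y /=; rewrite /phi !in_itv/= ltr_pdivrMr// ler_pdivlMr//
      ltrBlDl lerBrDl mulrC//.
  rewrite !lebesgue_measure_itv/= !lte_fin ltr_pM2r ?invr_gt0// ltrD2r gtr0_norm//.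
  case: ifP => _; last by rewrite mule0.
  rewrite -EFinD -EFinM; congr (_%:E); field.
  by rewrite gt_eqF.
- rewrite (_ : phi @^-1` _ = `[(v - c) / a, (u - c) / a[%classic); last first.
    apply/seteqP; split => y /=; rewrite /phi !in_itv/= ler_ndivrMr// ltr_ndivlMr//
      ltrBlDl lerBrDl mulrC// andbC//.
  rewrite !lebesgue_measure_itv/= !lte_fin ltr_nM2r ?invr_lt0// ltrD2r ltr0_norm//.
  case: ifP => _; last by rewrite mule0.
  rewrite -EFinD -EFinM; congr (_%:E); field.
  by rewrite lt_eqF.
Qed.

Lemma ge0_integral_affine (c a : R) (f : R -> \bar R) : a != 0 ->
  measurable_fun [set: RT] f -> (forall y, 0 <= f y)%E ->
  (\int[mu]_y f (c + a * y)%R = (`|a|^-1)%:E * \int[mu]_y f y)%E.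
Proof.
move=> a0 mf f0.
pose phi : RT -> RT := fun y => c + a * y.
have mphi : measurable_fun setT phi.
  by apply: measurable_funD => //; exact: measurable_funM.
have na0 : 0 <= `|a|^-1 by rewrite invr_ge0.
have := @ge0_integral_pushforward _ _ _ _ R phi mphi mu setT f measurableT mf
  (fun y _ => f0 y).
rewrite preimage_setT => <-.
rewrite -(@ge0_integral_mscale _ _ _ mu _ measurableT (NngNum na0))//.
apply: eq_measure_integral => A mA _.
by rewrite [LHS]lebesgue_measure_affine.
Qed.

Lemma integrable_affine (c a : R) (f : R -> R) : a != 0 ->
  mu.-integrable setT (EFin \o f) ->
  mu.-integrable setT (EFin \o (fun y => f (c + a * y))).
Proof.
move=> a0 /integrableP[mf fi]; apply/integrableP; split.
  apply: (measurableT_comp mf).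
  by apply: measurable_funD => //; exact: measurable_funM.
rewrite (ge0_integral_affine c (f := fun y => `|(EFin \o f) y|%E) a0)//; last first.
  exact: measurableT_comp.
by rewrite lte_mul_pinfty// lee_fin invr_ge0.
Qed.

Lemma Rintegral_affine (c a : R) (f : R -> R) : a != 0 ->
  mu.-integrable setT (EFin \o f) ->
  \int[mu]_y f (c + a * y) = `|a|^-1 * \int[mu]_y f y.
Proof.
move=> a0 fi; have /integrableP[mf _] := fi.
rewrite /Rintegral -[X in X * _]/(fine (`|a|^-1)%:E) -fineM//; last first.
  exact: (integrable_fin_num _ fi).
congr fine; rewrite [LHS]integralE [X in (_ * X)%E]integralE.
have E1 (y : R) : ((fun x => (f (c + a * x)%R)%:E)^\+ y = (EFin \o f)^\+ (c + a * y)%R)%E by rewrite unlock.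
have E2 (y : R) : ((fun x => (f (c + a * x)%R)%:E)^\- y = (EFin \o f)^\- (c + a * y)%R)%E by rewrite unlock.
under eq_integral do rewrite E1.
under [X in (_ - X)%E]eq_integral do rewrite E2.
rewrite (ge0_integral_affine c (f := (EFin \o f)^\+%E) a0)//; last exact: measurable_funepos.
rewrite (ge0_integral_affine c (f := (EFin \o f)^\-%E) a0)//; last exact: measurable_funeneg.
by rewrite [RHS]muleBr//; exact: (integrable_add_def measurableT fi).
Qed.
End measure_toolkit.

Lemma le_integral_EFin {R : realType} d (T : measurableType d)
    (m : {measure set T -> \bar R}) (f g : T -> R) :
  measurable_fun setT f -> measurable_fun setT g ->
  (forall x, 0 <= f x) -> (forall x, f x <= g x) ->
  (\int[m]_x (f x)%:E <= \int[m]_x (g x)%:E)%E.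
Proof.
move=> mf mg f0 fg.
apply: (ge0_le_integral m measurableT).
- by move=> x _; rewrite lee_fin.
- exact/measurable_EFinP.
- exact/measurable_EFinP.
- by move=> x _; rewrite lee_fin.
Qed.

Lemma integralD_EFin_ge0 {R : realType} d (T : measurableType d)
    (m : {measure set T -> \bar R}) (f g : T -> R) :
  measurable_fun setT f -> measurable_fun setT g ->
  (forall x, 0 <= f x) -> (forall x, 0 <= g x) ->
  (\int[m]_x (f x + g x)%:E = \int[m]_x (f x)%:E + \int[m]_x (g x)%:E)%E.
Proof.
move=> mf mg f0 g0.
apply: (ge0_integralD m measurableT (f1 := EFin \o f) (f2 := EFin \o g)).
- by move=> x _; rewrite /= lee_fin.
- exact/measurable_EFinP.
- by move=> x _; rewrite /= lee_fin.
- exact/measurable_EFinP.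
Qed.

Lemma integralZl_EFin_ge0 {R : realType} d (T : measurableType d)
    (m : {measure set T -> \bar R}) (f : T -> R) (k : R) :
  measurable_fun setT f -> (forall x, 0 <= f x) -> 0 <= k ->
  (\int[m]_x (k * f x)%:E = k%:E * \int[m]_x (f x)%:E)%E.
Proof.
move=> mf f0 k0.
apply: (ge0_integralZl_EFin m measurableT (f1 := EFin \o f)) => //.
- by move=> x _; rewrite /= lee_fin.
- exact/measurable_EFinP.
Qed.

Section fubini_toolkit.
Context {R : realType} d1 d2 (T1 : measurableType d1) (T2 : measurableType d2).
Variables (m1 : {sigma_finite_measure set T1 -> \bar R})
          (m2 : {sigma_finite_measure set T2 -> \bar R}).

Lemma measurable_Rintegral (F : T1 * T2 -> R) : measurable_fun setT F ->
  measurable_fun setT (fun x => \int[m2]_y F (x, y)).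
Proof.
move=> mF; apply: measurableT_comp => //.
have mEF : measurable_fun setT (EFin \o F) by exact/measurable_EFinP.
under eq_fun do rewrite integralE.
apply: emeasurable_funB.
- rewrite [X in measurable_fun _ X](_ : _ =
      (fun x => \int[m2]_y (EFin \o F)^\+ (x, y))%E); last first.
    by apply/funext => x; apply: eq_integral => y _; rewrite unlock.
  by apply: (measurable_fun_fubini_tonelli_F (EFin \o F)^\+%E) => //;
    exact: measurable_funepos.
- rewrite [X in measurable_fun _ X](_ : _ =
      (fun x => \int[m2]_y (EFin \o F)^\- (x, y))%E); last first.
    by apply/funext => x; apply: eq_integral => y _; rewrite unlock.
  by apply: (measurable_fun_fubini_tonelli_F (EFin \o F)^\-%E) => //;
    exact: measurable_funeneg.
Qed.

(** The inner integral of a Fubini theorem with values in the extended reals is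
    finite only almost everywhere.  [Rintegral] sends an infinite value to 0, and
    changing it on a null set does not change the outer integral. *)
Lemma Rfubini1 (F : T1 * T2 -> R) : (m1 \x m2)%E.-integrable setT (EFin \o F) ->
  \int[(m1 \x m2)%E]_z F z = \int[m1]_x \int[m2]_y F (x, y).
Proof.
move=> iF; rewrite /Rintegral -integral12_prod_meas1//; congr fine.
have /integrableP[/measurable_EFinP mF _] := iF.
apply: ae_eq_integral => //.
- exact: measurable_fubini_F iF.
- exact/measurable_EFinP/(measurable_Rintegral mF).
apply: filterS (ae_integrable1 iF) => x /= ix _.
by rewrite fineK//; exact: (integrable_fin_num _ ix).
Qed.

Lemma Rfubini1_integrable (F : T1 * T2 -> R) :
  (m1 \x m2)%E.-integrable setT (EFin \o F) ->
  m1.-integrable setT (EFin \o (fun x => \int[m2]_y F (x, y))).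
Proof.
move=> iF; have /integrableP[/measurable_EFinP mF _] := iF.
have mG := measurable_Rintegral mF.
apply/integrableP; split; first exact/measurable_EFinP.
have /integrableP[mF1] := integrable_fubini_F iF.
apply: le_lt_trans; rewrite le_eqVlt; apply/orP; left; apply/eqP.
apply: ae_eq_integral => //.
- by apply: measurableT_comp => //; exact/measurable_EFinP.
- exact: measurableT_comp.
apply: filterS (ae_integrable1 iF) => x ix _.
by congr abse; apply: fineK; exact: (integrable_fin_num _ ix).
Qed.
End fubini_toolkit.

Lemma Rfubini2 {R : realType} d1 d2 (T1 : measurableType d1)
    (T2 : measurableType d2) (m1 : {sigma_finite_measure set T1 -> \bar R})
    (m2 : {sigma_finite_measure set T2 -> \bar R}) (F : T1 * T2 -> R) : (m1 \x m2)%E.-integrable setT (EFin \o F) ->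
  \int[(m1 \x m2)%E]_z F z = \int[m2]_y \int[m1]_x F (x, y).
Proof.
move=> iF; have /integrableP[/measurable_EFinP mF _] := iF.
have mS : measurable_fun setT (fun z : T2 * T1 => (z.2, z.1)).
  by apply: measurable_fun_pair; [exact: measurable_snd|exact: measurable_fst].
have mFs : measurable_fun setT (fun z : T2 * T1 => F (z.2, z.1)).
  exact: (measurableT_comp mF mS).
have mG : measurable_fun setT (fun y => \int[m1]_x F (x, y)).
  by have := measurable_Rintegral m1 mFs.
rewrite /Rintegral -[LHS]/(fine (\int[m1 \x m2]_z (EFin \o F) z)%E).
rewrite -integral21_prod_meas1//; congr fine.
apply: ae_eq_integral => //.
- exact: measurable_fubini_G iF.
- exact/measurable_EFinP.
apply: filterS (ae_integrable2 iF) => y /= iy _.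
by rewrite fineK//; exact: (integrable_fin_num _ iy).
Qed.

Section lebesgue2.
Context {R : realType}.
Local Notation mu := (@lebesgue_measure R).
Local Notation RT := (measurableTypeR R).

(** The product of two Lebesgue measures, as a constant of its own so that it
    carries the sigma-finite structure that a further product with the Lebesgue
    measure requires. *)
Definition lebesgue2 : set (RT * RT)%type -> \bar R := (mu \x mu)%E.
HB.instance Definition _ := Measure.copy lebesgue2 (mu \x mu)%E.

Lemma lebesgue2_sigma_finite : sigma_finite setT lebesgue2.
Proof.
have /sigma_finiteP[F [TF ndF Foo]] := sigma_finiteT mu.
exists (fun n => F n `*` F n).
  rewrite -setXTT TF predeqE => -[x y]; split.
    move=> [/= [n _ Fnx] [k _ Fky]]; exists (maxn n k) => //; split.
    - by move: x Fnx; exact/subsetPset/ndF/leq_maxl.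
    - by move: y Fky; exact/subsetPset/ndF/leq_maxr.
  by move=> [n _ []/= ? ?]; split; exists n.
move=> k; have [mF Fk] := Foo k; split; first exact: measurableX.
by rewrite /lebesgue2 product_measure1E// lte_mul_pinfty// ge0_fin_numE.
Qed.

HB.instance Definition _ :=
  Measure_isSigmaFinite.Build _ _ _ lebesgue2 lebesgue2_sigma_finite.

Lemma lebesgue2_tonelli1 (F : RT * RT -> \bar R) : measurable_fun setT F ->
  (forall z, 0 <= F z)%E ->
  (\int[lebesgue2]_z F z = \int[mu]_x \int[mu]_y F (x, y))%E.
Proof. exact: fubini_tonelli1. Qed.

Lemma lebesgue2_tonelli2 (F : RT * RT -> \bar R) : measurable_fun setT F ->
  (forall z, 0 <= F z)%E ->
  (\int[lebesgue2]_z F z = \int[mu]_y \int[mu]_x F (x, y))%E.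
Proof. exact: fubini_tonelli2. Qed.

Lemma lebesgue2_fubini1 (F : RT * RT -> R) :
  lebesgue2.-integrable setT (EFin \o F) ->
  \int[lebesgue2]_z F z = \int[mu]_x \int[mu]_y F (x, y).
Proof. exact: Rfubini1. Qed.

Lemma lebesgue2_fubini2 (F : RT * RT -> R) :
  lebesgue2.-integrable setT (EFin \o F) ->
  \int[lebesgue2]_z F z = \int[mu]_y \int[mu]_x F (x, y).
Proof. exact: Rfubini2. Qed.

Lemma lebesgue2_fubini1_integrable (F : RT * RT -> R) :
  lebesgue2.-integrable setT (EFin \o F) ->
  mu.-integrable setT (EFin \o (fun x => \int[mu]_y F (x, y))).
Proof. exact: Rfubini1_integrable. Qed.

Lemma lebesgue2_integrable12 (F : RT * RT -> R) :
  measurable_fun setT F -> (\int[mu]_x \int[mu]_y `|F (x, y)|%:E < +oo)%E ->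
  lebesgue2.-integrable setT (EFin \o F).
Proof.
move=> mF Foo; have mE : measurable_fun setT (EFin \o F) by exact/measurable_EFinP.
exact: (integrable12ltyP mu mu mE).2.
Qed.

End lebesgue2.

(** * Two convergent integrals *)

Section constants.
Context {R : realType}.
Local Notation mu := (@lebesgue_measure R).
Local Notation RT := (measurableTypeR R).

Lemma measurable_inv_sqrt : measurable_fun [set: RT] (fun t : R => (Num.sqrt t)^-1).
Proof.
apply: measurable_funTS.
rewrite (_ : (fun t : R => _) = fun t => (\1_(`]0%R, +oo[) t) * (t `^ (- 2^-1))).
  apply: measurable_funM; first exact: measurable_indic.
  exact: measurable_powR.
apply/funext => t; rewrite indicE mem_setE in_itv/= andbT.
have [t0|t0] := ltP 0 t; last by rewrite ler0_sqrtr// invr0 mul0r.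
by rewrite mul1r powRN powR12_sqrt// ltW.
Qed.

(** Exhausting ]0, 1] by [1 / (n + 2), 1] keeps away from the singularity: there
    the primitive 2 sqrt t bounds every integral by 2. *)
Lemma integral_inv_sqrt_lty :
  (\int[mu]_(t in `]0%R, 1%R]) ((Num.sqrt t)^-1)%:E < +oo)%E.
Proof.
have mEF D : measurable_fun D (fun t : RT => ((Num.sqrt t)^-1)%:E).
  by apply: measurable_funTS; apply/measurable_EFinP; exact: measurable_inv_sqrt.
pose F n : set RT := `[n.+2%:R^-1, 1]%classic.
have Fn n : (\int[mu]_(t in F n) ((Num.sqrt t)^-1)%:E <= 2%:E)%E.
  have n0 : 0 < n.+2%:R^-1 :> R by rewrite invr_gt0.
  have n1 : n.+2%:R^-1 < 1 :> R by rewrite invf_lt1// ltr1n.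
  have csqrt (x : R) : 0 < x -> {for x, continuous (@Num.sqrt R)}.
    by move=> x0; exact: sqrt_continuous.
  rewrite (@continuous_FTC2 _ _ (fun t => 2 * Num.sqrt t))//.
  - rewrite -EFinB lee_fin sqrtr1 mulr1 lerBlDr lerDl mulr_ge0//.
  - apply: continuous_in_subspaceT => x /set_mem; rewrite /= in_itv/= => /andP[x1 _].
    have x0 : 0 < x by apply: lt_le_trans x1.
    by apply: continuousV; [rewrite gt_eqF// sqrtr_gt0|exact: csqrt].
  - split.
    + move=> x; rewrite in_itv/= => /andP[x1 _]; have x0 : 0 < x by apply: lt_trans x1.
      have ? := is_derive1_sqrt x0; exact: derivableM.
    + by apply: cvg_at_right_filter; apply: cvgM; [exact: cvg_cst|exact: csqrt].
    + by apply: cvg_at_left_filter; apply: cvgM; [exact: cvg_cst|exact: csqrt].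
  - move=> x; rewrite in_itv/= => /andP[x1 _]; have x0 : 0 < x by apply: lt_trans x1.
    have ? := is_derive1_sqrt x0.
    rewrite derive1E derive_val -[LHS]/(2 * _).
    by rewrite invfM mulrA mulfV ?mul1r.
have UF : \bigcup_n F n = `]0, 1]%classic.
  apply/seteqP; split => [x [n _]|x]; rewrite /F/= !in_itv/=.
    by move=> /andP[x1 ->]; rewrite andbT; apply: lt_le_trans x1; rewrite invr_gt0.
  move=> /andP[x0 x1]; have [n nx] := ltr_add_invr x0.
  exists n => //=; rewrite in_itv/= x1 andbT; apply: ltW; apply: le_lt_trans nx.
  by rewrite add0r lef_pV2 ?posrE// ler_nat.
have := @ge0_nondecreasing_set_cvg_integral _ RT R F
  (fun t => ((Num.sqrt t)^-1)%:E) mu _ _ _ _.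
rewrite UF => H; apply: (@le_lt_trans _ _ 2%:E); last exact: ltry.
apply: (cvge_le _ (H _ _ _ _)); first exact: nearW.
- apply/nondecreasing_seqP => n; rewrite subsetEset => x /=.
  rewrite /F/= !in_itv/= => /andP[x1 ->]; rewrite andbT; apply: le_trans x1.
  by rewrite lef_pV2 ?posrE// ler_nat.
- by move=> n; exact: measurable_itv.
- by [].
- by move=> i x _; rewrite lee_fin invr_ge0 sqrtr_ge0.
Qed.

Lemma measurable_inv_oneDsqr : measurable_fun [set: RT] (fun y : R => (1 + y ^+ 2)^-1).
Proof.
apply: measurable_funTS; apply: continuous_measurable_fun => x.
by apply: (@continuous_oneDsqrV R).
Qed.

Lemma integral_inv_oneDsqr_lty : (\int[mu]_y ((1 + y ^+ 2)^-1)%:E < +oo)%E.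
Proof.
rewrite (_ : (\int[mu]_y _ = \int[mu]_y (oneDsqr y)^-1%:E)%E)//.
rewrite (@ge0_symfun_integralT R (fun y => (oneDsqr y)^-1)).
- rewrite [X in (_ * X < _)%E](_ : _ = (pi / 2)%:E)%E; first by rewrite -EFinM ltry.
  by rewrite -integral0y_oneDsqr set_itvcy.
- by move=> x; rewrite invr_ge0 addr_ge0// sqr_ge0.
- exact: continuous_oneDsqrV.
- by move=> x; rewrite /= /oneDsqr sqrrN.
Qed.

End constants.

(** * Square-integrable functions *)

(** Proves measurability by following the syntax of the function, down to the
    measurability hypotheses in the context. *)
Ltac mfun := repeat first
  [ assumption
  | match goal with |- measurable_fun _ (fun z => mule _ _) =>
      refine (emeasurable_funM _ _) end
  | match goal with |- measurable_fun _ (fun z => (@?g z)%:E) =>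
      apply/measurable_EFinP end
  | match goal with |- measurable_fun _ (EFin \o _) =>
      apply/measurable_EFinP end
  | match goal with |- measurable_fun setT (fun z => ?c) => exact: measurable_cst end
  | match goal with |- measurable_fun setT (fun z => z) => exact: measurable_id end
  | match goal with |- measurable_fun setT (fun z => z.1) => exact: measurable_fst end
  | match goal with |- measurable_fun setT (fun z => z.2) => exact: measurable_snd end
  | match goal with H : measurable_fun setT ?f |- measurable_fun setT (fun z => ?f (@?g z)) =>
      refine (measurableT_comp (f:=f) (g:=g) H _) end
  | match goal with |- measurable_fun setT (fun z => (_ z).1) =>
      refine (measurableT_comp measurable_fst _) end
  | match goal with |- measurable_fun setT (fun z => (_ z).2) =>
      refine (measurableT_comp measurable_snd _) end
  | match goal with |- measurable_fun setT (fun z => (@?g z ^+ _)%R) =>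
      refine (measurable_funX _ _) end
  | match goal with |- measurable_fun setT (fun z => (@?g z * @?h z)%R) =>
      refine (measurable_funM _ _) end
  | match goal with |- measurable_fun setT (fun z => (- @?g z)%R) =>
      refine (measurable_funN _) end
  | match goal with |- measurable_fun setT (fun z => (@?g z + @?h z)%R) =>
      first [refine (measurable_funD _ _) | refine (emeasurable_funD _ _)] end
  | match goal with |- measurable_fun setT (fun z => `|@?g z|%R) =>
      refine (measurableT_comp (@normr_measurable _ setT) _) end ].

Section square_integrable.
Context {R : realType}.
Local Notation mu := (@lebesgue_measure R).
Local Notation RT := (measurableTypeR R).
Implicit Types (f g u v : R -> R) (B C : R).

(** A bound on the square of the L^2 norm, measurability included. *)
Definition L2le B u :=
  measurable_fun [set: RT] u /\ (\int[mu]_y (u y ^+ 2)%:E <= B%:E)%E.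

(** Cauchy-Schwarz is used through this weighted form, which integrates directly
    and needs no square root of an integral.  The weight l is chosen afterwards. *)
Lemma amgm (l a b : R) : 0 < l -> `|a * b| <= l / 2 * a ^+ 2 + l^-1 / 2 * b ^+ 2.
Proof.
move=> l0; rewrite normrM -(real_normK (num_real a)) -(real_normK (num_real b)).
set x := `|a|; set y := `|b|.
have : 0 <= (l * x - y) ^+ 2 / (2 * l) by rewrite divr_ge0 ?sqr_ge0// mulr_ge0// ltW.
have -> : (l * x - y) ^+ 2 / (2 * l) = l / 2 * x ^+ 2 + l^-1 / 2 * y ^+ 2 - x * y.
  by field; rewrite gt_eqF.
lra.
Qed.

Lemma integral_amgm d (T : measurableType d) (m : {measure set T -> \bar R})
    (u v : T -> R) l : 0 < l ->
  measurable_fun setT u -> measurable_fun setT v ->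
  (\int[m]_z `|u z * v z|%:E <=
   (l / 2)%:E * \int[m]_z (u z ^+ 2)%:E + (l^-1 / 2)%:E * \int[m]_z (v z ^+ 2)%:E)%E.
Proof.
move=> l0 mu_ mv.
have l2 : 0 <= l / 2 by rewrite divr_ge0// ltW.
have l2' : 0 <= l^-1 / 2 by rewrite divr_ge0// invr_ge0 ltW.
rewrite -!integralZl_EFin_ge0//; [|by mfun|by move=> z; rewrite sqr_ge0
  |by mfun|by move=> z; rewrite sqr_ge0].
rewrite -integralD_EFin_ge0//; [|by mfun|by mfun|..]; last 2 first.
- by move=> x; rewrite mulr_ge0// sqr_ge0.
- by move=> x; rewrite mulr_ge0// sqr_ge0.
by apply: le_integral_EFin => //; [by mfun|by mfun|move=> x; exact: amgm].
Qed.

Lemma L2le_affine B u (c a : R) : a != 0 -> L2le B u ->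
  L2le (`|a|^-1 * B) (fun y => u (c + a * y)).
Proof.
move=> a0 [mu_ uB]; split; first by mfun.
rewrite (ge0_integral_affine c (f := fun y => (u y ^+ 2)%:E) a0); last 2 first.
- by mfun.
- by move=> y; rewrite lee_fin sqr_ge0.
by rewrite EFinM lee_pmul2l// lte_fin invr_gt0 normr_gt0.
Qed.

Lemma L2le_mul_le B C u v l : 0 < l -> L2le B u -> L2le C v ->
  (\int[mu]_y `|u y * v y|%:E <= (l / 2 * B + l^-1 / 2 * C)%:E)%E.
Proof.
move=> l0 [mu_ uB] [mv vC]; apply: le_trans (integral_amgm mu l0 mu_ mv) _.
by rewrite EFinD !EFinM; apply: leeD; apply: lee_wpmul2l;
  rewrite // lee_fin divr_ge0// ?invr_ge0 ltW.
Qed.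

Lemma L2le_integrable B C u v : L2le B u -> L2le C v ->
  mu.-integrable setT (EFin \o (fun y => u y * v y)).
Proof.
move=> uB vC; apply/integrableP; split.
  by case: uB => mu_ _; case: vC => mv _; mfun.
by apply: le_lt_trans (L2le_mul_le ltr01 uB vC) _; rewrite ltry.
Qed.

Lemma L2le_Rintegral B C u v l : 0 < l -> L2le B u -> L2le C v ->
  `|\int[mu]_y (u y * v y)| <= l / 2 * B + l^-1 / 2 * C.
Proof.
move=> l0 uB vC; have uvi := L2le_integrable uB vC.
rewrite -lee_fin EFin_normr_Rintegral//.
apply: le_trans (L2le_mul_le l0 uB vC).
have /integrableP[muv _] := uvi.
exact: (le_trans (le_abse_integral mu measurableT muv)).
Qed.

Lemma L2le_ge0 B u : L2le B u -> 0 <= B.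
Proof.
by move=> [_ uB]; rewrite -lee_fin; apply: le_trans uB; apply: integral_ge0 => y _;
  rewrite lee_fin sqr_ge0.
Qed.

End square_integrable.

(** * The bilinear form and its bound *)

Section form.
Context {R : realType}.
Local Notation mu := (@lebesgue_measure R).
Local Notation RT := (measurableTypeR R).
Local Notation mu2 := (@lebesgue2 R).
Implicit Types (u v w : R -> R) (B C x : R).

Local Notation J := (`]0%R, 1%R[%classic : set RT).
Let mJ : measurable_fun [set: RT] (\1_J : R -> R).
Proof. exact: measurable_indic. Qed.

(** The density of the arcsine law up to the factor pi: it is the norm in L^2 of
    y |-> u (x + t y), times that of y |-> v (x - (1 - t) y), when u and v have
    norm 1. *)
Definition arcsine_weight (t : R) : R := \1_J t * (Num.sqrt t * Num.sqrt (1 - t))^-1.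

Lemma measurable_arcsine_weight : measurable_fun [set: RT] arcsine_weight.
Proof.
pose isqrt (t : R) : R := (Num.sqrt t)^-1.
have mi : measurable_fun [set: RT] isqrt by exact: measurable_inv_sqrt.
rewrite (_ : arcsine_weight = fun t => \1_J t * (isqrt t * isqrt (1 - t))); last first.
  by apply/funext => t; rewrite /arcsine_weight invfM.
by mfun.
Qed.

Lemma arcsine_weight_ge0 t : 0 <= arcsine_weight t.
Proof. by rewrite mulr_ge0// ?invr_ge0 ?mulr_ge0 ?sqrtr_ge0// indicE. Qed.

(** With a = sqrt t and b = sqrt (1 - t), the sum 1 / a + 1 / b is
    (a + b) / (a b), and a + b >= 1 because a^2 + b^2 = 1.  Each singularity is
    thus isolated in a term of its own. *)
Lemma arcsine_weight_le t : arcsine_weight t <=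
  \1_(`]0%R, 1%R] : set R) t * (Num.sqrt t)^-1 +
  \1_(`]0%R, 1%R] : set R) (1 - t) * (Num.sqrt (1 - t))^-1.
Proof.
rewrite /arcsine_weight !indicE !mem_setE !in_itv/=.
have [/andP[t0 t1]|_] := boolP (0 < t < 1); last first.
  by rewrite mul0r addr_ge0// mulr_ge0// ?invr_ge0 ?sqrtr_ge0.
rewrite t0 (ltW t1) subr_gt0 t1 gerBl (ltW t0) !mul1r.
have a0 : 0 < Num.sqrt t by rewrite sqrtr_gt0.
have b0 : 0 < Num.sqrt (1 - t) by rewrite sqrtr_gt0 subr_gt0.
have a2 : Num.sqrt t ^+ 2 = t by rewrite sqr_sqrtr// ltW.
have b2 : Num.sqrt (1 - t) ^+ 2 = 1 - t by rewrite sqr_sqrtr// subr_ge0 ltW.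
move: a0 b0 a2 b2; set a := Num.sqrt t; set b := Num.sqrt (1 - t) => a0 b0 a2 b2.
have -> : a^-1 + b^-1 = (a + b) * (a * b)^-1.
  by field; rewrite !gt_eqF.
rewrite -[leLHS]mul1r ler_wpM2r// ?invr_ge0 ?mulr_ge0 ?ltW//.
have h : 1 < (a + b) ^+ 2 by rewrite sqrrD a2 b2 addrAC subrKC ltrDl mulr2n addr_gt0// mulr_gt0.
rewrite ltNge; apply/negP => ab; move: h; apply/negP; rewrite -leNgt.
by rewrite expr_le1// addr_ge0// ltW.
Qed.

Lemma integral_arcsine_weight_lty : (\int[mu]_t (arcsine_weight t)%:E < +oo)%E.
Proof.
pose g (t : R) : R := \1_(`]0%R, 1%R] : set RT) t * (Num.sqrt t)^-1.
have g0 t : 0 <= g t by rewrite mulr_ge0// ?invr_ge0 ?sqrtr_ge0// indicE.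
have mg : measurable_fun [set: RT] g.
  apply: measurable_funM; first exact: measurable_indic.
  exact: measurable_inv_sqrt.
have gi : (\int[mu]_t (g t)%:E < +oo)%E.
  rewrite (_ : (\int[mu]_t _ = \int[mu]_(t in `]0%R, 1%R]) ((Num.sqrt t)^-1)%:E)%E); last first.
    rewrite [RHS]integral_mkcond; apply: eq_integral => t _.
    by rewrite patchE /g indicE mem_setE; case: ifP => _; rewrite ?mul1r ?mul0r.
  exact: integral_inv_sqrt_lty.
have mg1 : measurable_fun [set: RT] (fun t => g (1 + (-1) * t)) by mfun.
apply: (@le_lt_trans _ _ (\int[mu]_t (g t + g (1 + (-1) * t)%R)%:E)%E).
  apply: le_integral_EFin; [exact: measurable_arcsine_weight|by mfun|..].
  - exact: arcsine_weight_ge0.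
  - by move=> t; rewrite mulN1r; exact: arcsine_weight_le.
rewrite integralD_EFin_ge0//.
have n1 : -1 != 0 :> R by rewrite oppr_eq0 oner_eq0.
rewrite (ge0_integral_affine 1 (f := fun t => (g t)%:E) n1)//; last by mfun.
by rewrite lte_add_pinfty// normrN normr1 invr1 mul1e.
Qed.

Definition form_bound : R := fine (\int[mu]_t (arcsine_weight t)%:E).

Lemma form_boundE : (\int[mu]_t (arcsine_weight t)%:E = form_bound%:E)%E.
Proof.
rewrite /form_bound fineK// ge0_fin_numE ?integral_arcsine_weight_lty//.
by apply: integral_ge0 => t _; rewrite lee_fin arcsine_weight_ge0.
Qed.

Lemma form_bound_ge0 : 0 <= form_bound.
Proof. by apply: Rintegral_ge0 => t _; exact: arcsine_weight_ge0. Qed.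

Definition integrand w u v x (z : RT * RT) : R :=
  \1_J z.2 * w z.1 * (u (x + z.2 * z.1) * v (x - (1 - z.2) * z.1)).

(** For w y = e^(- 2 i pi xi y) and v = conj u this is the Born-Jordan distribution
    of u at (x, xi), as an integral over the pairs (y, t).  The weight is left
    free so that it can also cut off a range of y. *)
Definition form w u v x := \int[mu2]_z integrand w u v x z.

Definition weight w := measurable_fun [set: RT] w /\ forall y, `|w y| <= 1.

Lemma measurable_integrand w u v x : measurable_fun [set: RT] w ->
  measurable_fun [set: RT] u -> measurable_fun [set: RT] v ->
  measurable_fun setT (integrand w u v x).
Proof. by move=> mw mu_ mv; rewrite /integrand; mfun. Qed.

(** For fixed t the two factors have squared norms B / t and B / (1 - t) in y;
    weighting them by l = sqrt (t / (1 - t)) balances the two terms, and both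
    become half of B / sqrt (t (1 - t)). *)
Lemma integral_integrand_le w u v x B : weight w -> L2le B u -> L2le B v ->
  (\int[mu2]_z `|integrand w u v x z|%:E <= (form_bound * B)%:E)%E.
Proof.
move=> [mw w1] uB vB; have [mu_ _] := uB; have [mv _] := vB.
have mI := measurable_integrand x mw mu_ mv.
rewrite (lebesgue2_tonelli2 (F := fun z => `|integrand w u v x z|%:E)); [|by mfun|by []].
have B0 := L2le_ge0 uB; have maw := measurable_arcsine_weight.
rewrite mulrC EFinM -form_boundE -integralZl_EFin_ge0//; last exact: arcsine_weight_ge0.
apply: (ge0_le_integral mu measurableT).
- by move=> t _; exact: integral_ge0.
- apply: (measurable_fun_fubini_tonelli_G (fun z => `|integrand w u v x z|%:E)) => //.
  by mfun.
- by mfun.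
move=> t _; rewrite /fubini_G /integrand/=.
have [tJ|tJ] := boolP (t \in J); last first.
  rewrite integral0_eq; last by move=> y _; rewrite indicE (negbTE tJ) !mul0r normr0.
  by rewrite lee_fin mulr_ge0// arcsine_weight_ge0.
have := tJ; rewrite mem_setE in_itv/= => /andP[t0 t1].
have t1' : 0 < 1 - t by rewrite subr_gt0.
pose l := Num.sqrt t / Num.sqrt (1 - t).
have st0 : 0 < Num.sqrt t by rewrite sqrtr_gt0.
have st1 : 0 < Num.sqrt (1 - t) by rewrite sqrtr_gt0.
have l0 : 0 < l by rewrite divr_gt0.
have nt1 : - (1 - t) != 0 by rewrite oppr_eq0 gt_eqF.
have := L2le_mul_le l0 (L2le_affine x (lt0r_neq0 t0) uB) (L2le_affine x nt1 vB).
rewrite normrN !gtr0_norm// => H.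
apply: (@le_trans _ _ (\int[mu]_y `|u (x + t * y) * v (x + - (1 - t) * y)|%:E)%E).
  apply: le_integral_EFin => //; [by mfun|by mfun|].
  move=> y; rewrite indicE tJ mul1r mulNr normrM.
  by rewrite -[leRHS]mul1r ler_wpM2r.
apply: le_trans H _; rewrite lee_fin /arcsine_weight indicE tJ mul1r /l.
have a2 : Num.sqrt t ^+ 2 = t by rewrite sqr_sqrtr// ltW.
have b2 : Num.sqrt (1 - t) ^+ 2 = 1 - t by rewrite sqr_sqrtr// ltW.
have Et : t^-1 = (Num.sqrt t ^+ 2)^-1 by rewrite a2.
have E1t : (1 - t)^-1 = (Num.sqrt (1 - t) ^+ 2)^-1 by rewrite b2.
rewrite Et E1t le_eqVlt; apply/orP; left; apply/eqP.
by field; rewrite !gt_eqF.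
Qed.

Lemma integrable_integrand w u v x B : weight w -> L2le B u -> L2le B v ->
  mu2.-integrable setT (EFin \o integrand w u v x).
Proof.
move=> ww uB vB; apply/integrableP; split.
  by case: ww => mw _; case: uB => mu_ _; case: vB => mv _;
    apply/measurable_EFinP; exact: measurable_integrand.
by apply: le_lt_trans (integral_integrand_le x ww uB vB) _; rewrite ltry.
Qed.

Lemma form_le w u v x B : weight w -> L2le B u -> L2le B v ->
  `|form w u v x| <= form_bound * B.
Proof.
move=> ww uB vB; have I := integrable_integrand x ww uB vB.
rewrite -lee_fin EFin_normr_Rintegral//.
apply: le_trans (integral_integrand_le x ww uB vB).
have /integrableP[mI _] := I.
exact: (le_trans (le_abse_integral _ measurableT mI)).
Qed.

End form.

(** * Small y, and integration along fibers *)

Section form_pieces.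
Context {R : realType}.
Local Notation mu := (@lebesgue_measure R).
Local Notation RT := (measurableTypeR R).
Local Notation mu2 := (@lebesgue2 R).
Implicit Types (u v w : R -> R) (B C x : R).

Local Notation J := (`]0%R, 1%R[%classic : set RT).
Let mJ : measurable_fun [set: RT] (\1_J : R -> R).
Proof. exact: measurable_indic. Qed.

Lemma formDl w1 w2 u v x B : weight w1 -> weight w2 -> L2le B u -> L2le B v ->
  form (fun y => w1 y + w2 y) u v x = form w1 u v x + form w2 u v x.
Proof.
move=> ww1 ww2 uB vB; rewrite /form -RintegralD//; last 2 first.
- exact: integrable_integrand uB vB.
- exact: integrable_integrand uB vB.
by apply: eq_Rintegral => z _; rewrite /integrand; ring.
Qed.

Lemma L2le_shift B u c : L2le B u -> L2le B (fun x => u (x + c)).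
Proof.
move=> /(L2le_affine c (oner_neq0 R)); rewrite normr1 invr1 mul1r.
by congr (L2le B _); apply/funext => x; rewrite mul1r addrC.
Qed.

Lemma integral_indic_itv_oo (a b : R) : a <= b ->
  (\int[mu]_y (\1_(`]a, b[%classic : set RT) y)%:E = (b - a)%:E)%E.
Proof.
move=> ab; rewrite (@integral_indic _ RT R mu setT measurableT `]a, b[%classic (measurable_itv `]a, b[)).
rewrite setIT; apply: (eq_trans (lebesgue_measure_itv `]a, b[)); rewrite /= lte_fin.
by case: ltgtP ab => // -> _; rewrite subrr.
Qed.

Lemma integral_indic_itv_cc (a b : R) : a <= b ->
  (\int[mu]_y (\1_(`[a, b]%classic : set RT) y)%:E = (b - a)%:E)%E.
Proof.
move=> ab; rewrite (@integral_indic _ RT R mu setT measurableT `[a, b]%classic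
  (measurable_itv `[a, b])).
rewrite setIT; apply: (eq_trans (lebesgue_measure_itv `[a, b])); rewrite /= lte_fin.
by case: ltgtP ab => // -> _; rewrite subrr.
Qed.

(** The form is not small at a given x: only its mean over x is.  Integrating in x
    first makes the two factors translates of u and v, whose pairing is at most B
    for every (y, t), and the remaining set of pairs (y, t) has measure 2 e. *)
Lemma integral_form_near_le w u v e B : 0 < e -> weight w ->
  (forall y, e <= `|y| -> w y = 0) -> L2le B u -> L2le B v ->
  (\int[mu]_x `|form w u v x|%:E <= (2 * e * B)%:E)%E.
Proof.
move=> e0 ww we uB vB; have [mw w1] := ww; have [mu_ _] := uB; have [mv _] := vB.
have B0 := L2le_ge0 uB.
pose F (p : RT * (RT * RT)) : R := integrand w u v p.1 p.2.
have mF : measurable_fun setT F by rewrite /F /integrand; mfun.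
have mFa : measurable_fun setT (fun p => `|F p|%:E) by mfun.
pose E : set RT := `](- e), e[%classic.
have mE : measurable_fun [set: RT] (\1_E : R -> R).
  by apply: measurable_indic; exact: measurable_itv.
apply: (@le_trans _ _ (\int[mu]_x \int[mu2]_z `|F (x, z)|%:E)%E).
  apply: (ge0_le_integral mu measurableT) => //.
  - have : measurable_fun setT (fun x => form w u v x) by exact: (measurable_Rintegral mu2 mF).
    by move=> mform; mfun.
  - exact: (measurable_fun_fubini_tonelli_F (fun p => `|F p|%:E)).
  - move=> x _; have I := integrable_integrand x ww uB vB.
    rewrite EFin_normr_Rintegral//; have /integrableP[mI _] := I.
    exact: (le_trans (le_abse_integral _ measurableT mI)).
(* From here on x is the inner variable. *)
rewrite (fubini_tonelli (fun p => `|F p|%:E))//.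
apply: (@le_trans _ _ (\int[mu2]_z (B * (\1_E z.1 * \1_J z.2))%:E)%E).
  apply: (ge0_le_integral mu2 measurableT) => //.
  - by move=> z _; exact: integral_ge0.
  - exact: (measurable_fun_fubini_tonelli_G (fun p => `|F p|%:E)).
  - by mfun.
  move=> [y t] _; rewrite /F /integrand/=.
  under eq_integral do rewrite normrM.
  have mux : measurable_fun setT (fun x : RT => `|u (x + t * y) * v (x - (1 - t) * y)|).
    by mfun.
  rewrite integralZl_EFin_ge0// EFinM muleC.
  have := L2le_mul_le ltr01 (L2le_shift (t * y) uB) (L2le_shift (- ((1 - t) * y)) vB).
  rewrite invr1 -mulrDl -splitr mul1r => H.
  apply: lee_pmul; rewrite ?lee_fin//; first exact: integral_ge0.
  have J0 : 0 <= \1_J t :> R by rewrite indicE.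
  rewrite normrM mulrC [`|\1_J t|]ger0_norm// ler_wpM2r// /E indicE mem_setE in_itv/=.
  rewrite -ltr_norml; case: ltP => ye; first exact: w1.
  by rewrite we// normr0.
have mEJ : measurable_fun setT (fun z : RT * RT => \1_E z.1 * \1_J z.2 : R) by mfun.
rewrite integralZl_EFin_ge0//.
rewrite (lebesgue2_tonelli1 (F := fun z => (\1_E z.1 * \1_J z.2)%:E)); last 2 first.
- by mfun.
- by move=> z; rewrite lee_fin mulr_ge0 ?indicE.
rewrite /fubini_F/=.
have Ey (y : RT) : (\int[mu]_t (\1_E y * \1_J t)%:E = (\1_E y)%:E)%E.
  have E0 : 0 <= \1_E y :> R by rewrite indicE.
  have J0 t : 0 <= \1_J t :> R by rewrite indicE.
  by rewrite integralZl_EFin_ge0// integral_indic_itv_oo// subr0 mule1.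
under eq_integral do rewrite Ey.
rewrite integral_indic_itv_oo; last by lra.
by rewrite -EFinM lee_fin; lra.
Qed.

(** The part of the form at a given y.  Its integral over y against w gives the form
    back when w vanishes at y = 0, the one point where the integrand need not be
    integrable in t ([form_fiber]). *)
Definition fiber u v x y := \int[mu]_t (\1_J t * u (x + t * y) * v (x - (1 - t) * y)).

Lemma measurable_fiber u v x : measurable_fun [set: RT] u ->
  measurable_fun [set: RT] v -> measurable_fun [set: RT] (fiber u v x).
Proof.
move=> mu_ mv.
pose F (z : RT * RT) : R := \1_J z.2 * u (x + z.2 * z.1) * v (x - (1 - z.2) * z.1).
have mF : measurable_fun setT F by rewrite /F; mfun.
exact: (measurable_Rintegral mu mF).
Qed.

Lemma L2le_indicM B u (A : set RT) : measurable A -> L2le B u ->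
  L2le B (fun t => \1_A t * u t).
Proof.
move=> mA [mu_ uB]; have mi : measurable_fun [set: RT] (\1_A : R -> R).
  exact: measurable_indic.
split; first by mfun.
apply: le_trans uB; apply: le_integral_EFin; [by mfun|by mfun|..].
- by move=> y; exact: sqr_ge0.
- by move=> y; rewrite exprMn indicE; case: (_ \in _);
    rewrite ?expr1n ?mul1r// expr0n mul0r sqr_ge0.
Qed.

Lemma fiber_factors B u v x y : y != 0 -> L2le B u -> L2le B v ->
  L2le (`|y|^-1 * B) (fun t => \1_J t * u (x + t * y)) /\
  L2le (`|y|^-1 * B) (fun t => v (x - (1 - t) * y)).
Proof.
move=> y0 uB vB; split.
  apply: L2le_indicM; first exact: measurable_itv.
  rewrite (_ : (fun t => u _) = fun t => u (x + y * t)); first exact: L2le_affine.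
  by apply/funext => t; rewrite [t * y]mulrC.
rewrite (_ : (fun t => v _) = fun t => v (x - y + y * t)); first exact: L2le_affine.
by apply/funext => t; congr v; ring.
Qed.

(** As t varies on the interval, x + t y runs through an interval at speed |y|, so
    each factor has squared norm at most B / |y| in t. *)
Lemma fiber_le B u v x y : y != 0 -> L2le B u -> L2le B v ->
  `|fiber u v x y| <= B / `|y|.
Proof.
move=> y0 uB vB; have [u' v'] := fiber_factors x y0 uB vB.
apply: le_trans (L2le_Rintegral ltr01 u' v') _.
by rewrite invr1 -mulrDl -splitr mul1r mulrC.
Qed.

Lemma form_fiber B w u v x : weight w -> w 0 = 0 ->
  L2le B u -> L2le B v ->
  form w u v x = \int[mu]_y (w y * fiber u v x y) /\
  mu.-integrable setT (EFin \o (fun y => w y * fiber u v x y)).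
Proof.
move=> ww w0 uB vB; have I := integrable_integrand x ww uB vB.
have E y : \int[mu]_t integrand w u v x (y, t) = w y * fiber u v x y.
  have [->|y0] := eqVneq y 0.
    rewrite w0 mul0r /integrand/=; under eq_Rintegral do rewrite w0 mulr0 mul0r.
    by rewrite Rintegral_cst// mul0r.
  have [u' v'] := fiber_factors x y0 uB vB.
  rewrite /fiber -RintegralZl//; last exact: L2le_integrable u' v'.
  by apply: eq_Rintegral => t _; rewrite /integrand/=; ring.
split; first by rewrite /form (lebesgue2_fubini1 I); apply: eq_Rintegral => y _; exact: E.
have := lebesgue2_fubini1_integrable I; congr (mu.-integrable _ _).
by apply/funext => y/=; rewrite E.
Qed.

End form_pieces.

(** * A window with integrable cosine transform *)

Section window.
Context {R : realType}.
Local Notation mu := (@lebesgue_measure R).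
Local Notation RT := (measurableTypeR R).
Local Notation mu2 := (@lebesgue2 R).
Implicit Types (L a : R).

(** The primitive comes from integrating by parts twice, the quadratic factor
    losing one degree each time. *)
Lemma window_primitive L a (x : R) : a != 0 ->
  is_derive x 1 (fun s : R => (L ^+ 2 - s ^+ 2) * (a^-1 * sin (a * s))
                 - 2 * a^-2 * (s * cos (a * s)) + 2 * a^-3 * sin (a * s))
    ((L ^+ 2 - x ^+ 2) * cos (a * x)).
Proof.
move=> a0.
pose l : R -> R := a \*: idfun.
have dl : is_derive x 1 l a.
  have := is_deriveZ a (is_derive_id x (1 : R)).
  by rewrite /GRing.scale/= mulr1.
have dsin : is_derive x 1 (sin \o l) (cos (l x) * a) by exact: is_derive1_comp.
have dcos : is_derive x 1 (cos \o l) (- sin (l x) * a) by exact: is_derive1_comp.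
have dq : is_derive x 1 (cst (L ^+ 2) - (@idfun R) ^+ 2) (- (2 * x)).
  apply: is_derive_eq; rewrite sub0r/= expr1 /GRing.scale/= mulr1.
  by [].
have did : is_derive x 1 (@idfun R) 1 by exact: is_derive_id.
have H := is_deriveD (is_deriveB (is_deriveM dq (is_deriveZ a^-1 dsin))
  (is_deriveZ (2 * a^-2) (is_deriveM did dcos))) (is_deriveZ (2 * a^-3) dsin).
apply: (is_derive_eq (f := fun s : R => (L ^+ 2 - s ^+ 2) * (a^-1 * sin (a * s))
                 - 2 * a^-2 * (s * cos (a * s)) + 2 * a^-3 * sin (a * s)) H).
rewrite /GRing.scale/= /GRing.scale/=.
rewrite (_ : (cst (L ^+ 2) - _) x = L ^+ 2 - x ^+ 2); last by [].
by field.
Qed.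

(** The parabola vanishes at both ends of its support, so that its transform decays
    like a^-2; a plain indicator would only give a^-1, which is not integrable. *)
Definition window L (s : R) : R := \1_(`[- L, L]%classic : set RT) s * (L ^+ 2 - s ^+ 2).

Lemma window_ge0 L s : 0 <= window L s.
Proof.
rewrite /window indicE mem_setE in_itv/=; case: andP => [[s1 s2]|_]; last by rewrite mul0r.
by rewrite mul1r subr_ge0 -(real_normK (num_real s)) lerXn2r// ?nnegrE ?ler_norml ?s1//
  (le_trans (normr_ge0 s))// ler_norml s1.
Qed.

Lemma measurable_window L : measurable_fun [set: RT] (window L).
Proof.
have m1 : measurable_fun [set: RT] (\1_(`[- L, L]%classic : set RT) : R -> R).
  by apply: measurable_indic; exact: measurable_itv.
by rewrite /window; mfun.
Qed.

Lemma window_le L s : window L s <= L ^+ 2 * \1_(`[- L, L]%classic : set RT) s.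
Proof.
rewrite mulrC /window ler_wpM2l ?indicE//.
by rewrite lerBlDr lerDl sqr_ge0.
Qed.

Let measurable_indicL L : measurable_fun [set: RT] (\1_(`[- L, L]%classic : set RT) : R -> R).
Proof. by apply: measurable_indic; exact: measurable_itv. Qed.

Lemma integral_window_le L : 0 < L ->
  (\int[mu]_s (window L s)%:E <= (2 * L ^+ 3)%:E)%E.
Proof.
move=> L0.
apply: (@le_trans _ _ (\int[mu]_s (L ^+ 2 * \1_(`[- L, L]%classic : set RT) s)%:E)%E).
  apply: le_integral_EFin; [exact: measurable_window|exact: measurable_funM|..].
  - exact: window_ge0.
  - exact: window_le.
rewrite integralZl_EFin_ge0; [|by []|by move=> s; rewrite indicE|exact: sqr_ge0].
rewrite integral_indic_itv_cc; last by lra.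
by rewrite -EFinM lee_fin (_ : L ^+ 2 * _ = 2 * L ^+ 3)//; ring.
Qed.

Definition window_cos L a := \int[mu]_s (window L s * cos (a * s)).

Lemma measurable_cos : measurable_fun [set: R] (@cos R).
Proof. by apply: continuous_measurable_fun; exact: continuous_cos. Qed.

Lemma measurable_sin : measurable_fun [set: R] (@sin R).
Proof. by apply: continuous_measurable_fun; exact: continuous_sin. Qed.

Lemma integral_window_cos_le L a : 0 < L ->
  (\int[mu]_s `|window L s * cos (a * s)|%:E <= (2 * L ^+ 3)%:E)%E.
Proof.
move=> L0; have mcos := measurable_cos; have mw := @measurable_window L.
apply: le_trans (integral_window_le L0).
apply: le_integral_EFin; [by mfun|by []|by []|].
move=> s; rewrite normrM ger0_norm ?window_ge0//.
by rewrite ler_piMr ?window_ge0// ler_norml cos_geN1 cos_le1.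
Qed.

Lemma integrable_window_cos L a : 0 < L ->
  mu.-integrable setT (EFin \o (fun s => window L s * cos (a * s))).
Proof.
move=> L0; have mcos := measurable_cos; have mw := @measurable_window L.
apply/integrableP; split; first by mfun.
by apply: le_lt_trans (integral_window_cos_le a L0) _; rewrite ltry.
Qed.

Lemma window_cosE L a : 0 < L -> a != 0 ->
  window_cos L a = 4 * sin (a * L) / a ^+ 3 - 4 * L * cos (a * L) / a ^+ 2.
Proof.
move=> L0 a0.
pose F s : R := (L ^+ 2 - s ^+ 2) * (a^-1 * sin (a * s))
                 - 2 * a^-2 * (s * cos (a * s)) + 2 * a^-3 * sin (a * s).
have LL : - L < L by rewrite gtrN.
have ccos : continuous (fun s : R => (L ^+ 2 - s ^+ 2) * cos (a * s)).
  move=> s; apply: cvgM.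
    by apply: cvgB; [exact: cvg_cst|exact: exprn_continuous].
  by apply: (continuous_comp (f := fun s => a * s)); [exact: mulrl_continuous|exact: continuous_cos].
have cF : continuous F.
  by move=> s; have [dF _] := window_primitive L s a0; exact/differentiable_continuous/derivable1_diffP.
rewrite /window_cos /Rintegral.
rewrite (_ : (\int[mu]_s _ = \int[mu]_(s in `[(- L)%R, L%R]) ((L ^+ 2 - s ^+ 2) * cos (a * s))%R%:E)%E).
  rewrite (@continuous_FTC2 _ _ F)//=.
  - by rewrite /F mulrN sinN cosN; field.
  - exact: continuous_subspaceT.
  - split.
    + by move=> s _; have [dF _] := window_primitive L s a0.
    + exact/cvg_at_right_filter/cF.
    + exact/cvg_at_left_filter/cF.
  - move=> s _; rewrite derive1E.
    by have [_ ->] := window_primitive L s a0.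
rewrite [RHS]integral_mkcond; apply: eq_integral => s _.
by rewrite patchE /window indicE mem_setE; case: ifP => _; rewrite ?mul1r ?mul0r.
Qed.

Definition window_const L : R := 8 * (1 + L) + 4 * L ^+ 3.

(** The explicit formula gives the decay for |a| >= 1, and the mass of the window
    gives a bound for |a| < 1. *)
Lemma window_cos_le L a : 0 < L ->
  `|window_cos L a| <= window_const L / (1 + a ^+ 2).
Proof.
move=> L0; have L0' := ltW L0; have d0 : 0 < 1 + a ^+ 2 by rewrite ltr_wpDr// sqr_ge0.
rewrite ler_pdivlMr// /window_const.
(* For |a| >= 1, both a^-2 and |a|^-3 are at most 2 / (1 + a^2). *)
have [a1|a1] := leP 1 `|a|.
  have a0 : a != 0 by rewrite -normr_gt0 (lt_le_trans ltr01).
  have na0 : 0 < `|a| by exact: lt_le_trans a1.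
  have h : `|window_cos L a| <= 4 * (1 + L) / `|a| ^+ 2.
    rewrite window_cosE//; apply: le_trans (ler_normB _ _) _.
    have s1 : `|sin (a * L)| <= 1 by rewrite ler_norml sin_geN1 sin_le1.
    have c1 : `|cos (a * L)| <= 1 by rewrite ler_norml cos_geN1 cos_le1.
    rewrite !normrM !normfV !normrX !(@ger0_norm _ 4)// (ger0_norm L0') mulrDr mulr1 mulrDl.
    apply: lerD.
      apply: (@le_trans _ _ (4 * `|a| ^- 3)).
        by rewrite ler_wpM2r ?invr_ge0 ?exprn_ge0// ler_piMr.
      by rewrite ler_wpM2l// lef_pV2 ?posrE ?exprn_gt0// ler_weXn2l.
    by rewrite ler_wpM2r ?invr_ge0 ?exprn_ge0// ler_piMr// mulr_ge0.
  rewrite -(real_normK (num_real a)); set n := `|a| in a1 na0 h *.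
  apply: (@le_trans _ _ (4 * (1 + L) / n ^+ 2 * (1 + n ^+ 2))).
    by rewrite ler_wpM2r// addr_ge0// sqr_ge0.
  apply: (@le_trans _ _ (4 * (1 + L) * 2)).
    rewrite -mulrA ler_wpM2l// ?mulr_ge0// ?addr_ge0//.
    rewrite ler_pdivrMl ?exprn_gt0//.
    have : 1 <= n ^+ 2 by rewrite exprn_ege1.
    lra.
  have : 0 <= L ^+ 3 by rewrite exprn_ge0.
  lra.
have h : `|window_cos L a| <= 2 * L ^+ 3.
  have I := integrable_window_cos a L0.
  rewrite -lee_fin EFin_normr_Rintegral//.
  apply: le_trans (integral_window_cos_le a L0); have /integrableP[mI _] := I.
  exact: (le_trans (le_abse_integral mu measurableT mI)).
have a2 : a ^+ 2 <= 1.
  by rewrite -(real_normK (num_real a)) expr_le1// ltW.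
have L3 : 0 <= L ^+ 3 by rewrite exprn_ge0.
apply: (@le_trans _ _ (2 * L ^+ 3 * (1 + a ^+ 2))).
  by rewrite ler_wpM2r// ltW.
apply: (@le_trans _ _ (2 * L ^+ 3 * 2)); last by lra.
by rewrite ler_wpM2l//; lra.
Qed.

End window.

(** * A local Plancherel inequality *)

Section window_plancherel.
Context {R : realType}.
Local Notation mu := (@lebesgue_measure R).
Local Notation RT := (measurableTypeR R).
Local Notation mu2 := (@lebesgue2 R).
Implicit Types (L a c B : R) (g p q : R -> R).

Lemma integrable_tensor p q :
  mu.-integrable setT (EFin \o p) -> mu.-integrable setT (EFin \o q) ->
  mu2.-integrable setT (EFin \o (fun z => p z.1 * q z.2)).
Proof.
move=> /integrableP[/measurable_EFinP mp ip] /integrableP[/measurable_EFinP mq iq].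
apply: lebesgue2_integrable12; first by mfun.
have mpn : measurable_fun [set: RT] (fun x => `|p x|) by mfun.
have mqn : measurable_fun [set: RT] (fun x => `|q x|) by mfun.
have Iq : (\int[mu]_y `|q y|%:E)%E \is a fin_num.
  by rewrite ge0_fin_numE//; exact: integral_ge0.
have E x : (\int[mu]_y `|p x * q y|%:E = (fine (\int[mu]_y `|q y|%:E) * `|p x|)%:E)%E.
  by under eq_integral do rewrite normrM; rewrite integralZl_EFin_ge0// mulrC EFinM fineK.
under eq_integral do rewrite E.
rewrite integralZl_EFin_ge0//; last by apply: fine_ge0; exact: integral_ge0.
by rewrite lte_mul_pinfty ?lee_fin//; apply: fine_ge0; exact: integral_ge0.
Qed.

Lemma Rintegral_tensor p q :
  mu.-integrable setT (EFin \o p) -> mu.-integrable setT (EFin \o q) ->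
  \int[mu2]_z (p z.1 * q z.2) = (\int[mu]_y p y) * (\int[mu]_y q y).
Proof.
move=> ip iq; rewrite (lebesgue2_fubini1 (integrable_tensor ip iq))/=.
under eq_Rintegral do rewrite RintegralZl//.
by rewrite RintegralZr.
Qed.

Lemma integrableM_bounded p q : mu.-integrable setT (EFin \o p) ->
  measurable_fun [set: RT] q -> (forall y, `|q y| <= 1) ->
  mu.-integrable setT (EFin \o (fun y => p y * q y)).
Proof.
move=> /integrableP[/measurable_EFinP mp ip] mq q1.
apply/integrableP; split; first by mfun.
apply: le_lt_trans ip; apply: le_integral_EFin; [by mfun|by mfun|by []|].
by move=> y; rewrite normrM ler_piMr.
Qed.

(** Equal to pi. *)
Definition cauchy_mass : R := fine (\int[mu]_y ((1 + y ^+ 2)^-1)%:E).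

Let mcauchy := @measurable_inv_oneDsqr R.

Lemma cauchy_gt0 (y : R) : 0 < (1 + y ^+ 2)^-1.
Proof. by rewrite invr_gt0 ltr_wpDr// sqr_ge0. Qed.

Lemma integral_cauchy_affine b c : c != 0 ->
  (\int[mu]_y ((1 + (b + c * y) ^+ 2)^-1)%:E = (`|c|^-1 * cauchy_mass)%:E)%E.
Proof.
move=> c0; rewrite (ge0_integral_affine b (f := fun y => ((1 + y ^+ 2)^-1)%:E) c0)//.
- rewrite EFinM fineK// ge0_fin_numE ?integral_inv_oneDsqr_lty//.
  by apply: integral_ge0 => y _; rewrite lee_fin ltW// cauchy_gt0.
- exact/measurable_EFinP.
- by move=> y; rewrite lee_fin ltW// cauchy_gt0.
Qed.

(** Expanding the two squares and integrating over s turns the left-hand side into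
    the double integral of g y g y' against the cosine transform of the window at
    c (y - y').  That transform is dominated by an integrable function of y - y',
    so Schur's test bounds the double integral by a constant times the integral
    of g^2. *)
Lemma window_plancherel L c g B : 0 < L -> c != 0 ->
  mu.-integrable setT (EFin \o g) -> L2le B g ->
  (\int[mu]_s (window L s * ((\int[mu]_y (g y * cos (s * (c * y)))) ^+ 2
                           + (\int[mu]_y (g y * sin (s * (c * y)))) ^+ 2))%R%:E
   <= (window_const L * (`|c|^-1 * cauchy_mass) * B)%:E)%E.
Proof.
move=> L0 c0 ig [mg gB]; have B0 := L2le_ge0 (conj mg gB).
have mcos := @measurable_cos R; have msin := @measurable_sin R.
have mw := @measurable_window R L.
pose F (x : RT * (RT * RT)) : R :=
  window L x.1 * (g x.2.1 * g x.2.2 * cos (c * (x.2.1 - x.2.2) * x.1)).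
have mF : measurable_fun setT F by rewrite /F; mfun.
have gg := integrable_tensor (integrable_norm ig) (integrable_norm ig).
have mgg : measurable_fun setT (fun z : RT * RT => `|g z.1| * `|g z.2|) by mfun.
pose M := fine (\int[mu2]_z (`|g z.1| * `|g z.2|)%R%:E)%E.
have ME : (\int[mu2]_z (`|g z.1| * `|g z.2|)%R%:E = M%:E)%E.
  by rewrite /M fineK//; exact: (integrable_fin_num _ gg).
have M0 : 0 <= M by apply: fine_ge0; apply: integral_ge0 => z _; rewrite lee_fin mulr_ge0.
have iF : (mu \x mu2)%E.-integrable setT (EFin \o F).
  apply/(integrable12ltyP mu mu2 (f := EFin \o F)); first exact/measurable_EFinP.
  apply: (@le_lt_trans _ _ (\int[mu]_s (M * window L s)%:E)%E).
    apply: (ge0_le_integral mu measurableT).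
    - by move=> s _; exact: integral_ge0.
    - apply: (measurable_fun_fubini_tonelli_F (fun z => `|F z|%:E)) => //.
      by mfun.
    - by mfun.
    move=> s _; rewrite mulrC EFinM -ME -integralZl_EFin_ge0; [|by mfun|by move=> z; rewrite mulr_ge0
      |exact: window_ge0].
    apply: le_integral_EFin; [by rewrite /F/=; mfun|by mfun|by []|].
    move=> z; rewrite /F/= normrM (ger0_norm (window_ge0 _ _)) ler_wpM2l ?window_ge0//.
    rewrite normrM [`|g _ * _|]normrM.
    by rewrite ler_piMr// ?mulr_ge0// ler_norml cos_geN1 cos_le1.
  rewrite integralZl_EFin_ge0; [|by []|exact: window_ge0|by []].
  rewrite lte_mul_pinfty ?lee_fin//.
  by apply: le_lt_trans (integral_window_le L0) _; rewrite ltry.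
pose C s := \int[mu]_y (g y * cos (s * (c * y))).
pose S s := \int[mu]_y (g y * sin (s * (c * y))).
have icos s : mu.-integrable setT (EFin \o (fun y => g y * cos (s * (c * y)))).
  apply: integrableM_bounded => //; first by mfun.
  by move=> y; rewrite ler_norml cos_geN1 cos_le1.
have isin s : mu.-integrable setT (EFin \o (fun y => g y * sin (s * (c * y)))).
  apply: integrableM_bounded => //; first by mfun.
  by move=> y; rewrite ler_norml sin_geN1 sin_le1.
(* cos (p - q) = cos p cos q + sin p sin q turns the square of an integral into a
   double integral. *)
have FE s : \int[mu2]_z F (s, z) = window L s * (C s ^+ 2 + S s ^+ 2).
  rewrite !expr2 -(Rintegral_tensor (icos s) (icos s)) -(Rintegral_tensor (isin s) (isin s)).
  have ic := integrable_tensor (icos s) (icos s).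
  have is_ := integrable_tensor (isin s) (isin s).
  rewrite -RintegralD// -RintegralZl//; last first.
    by have := integrableD measurableT ic is_.
  apply: eq_Rintegral => z _; rewrite /F/=.
  rewrite (_ : c * (z.1 - z.2) * s = s * (c * z.1) - s * (c * z.2)); last by ring.
  by rewrite cosB; ring.
have iG : mu.-integrable setT (EFin \o (fun s => window L s * (C s ^+ 2 + S s ^+ 2))).
  by have := Rfubini1_integrable iF; congr (mu.-integrable _ _);
    apply/funext => s; rewrite /= FE.
rewrite -[leLHS]fineK; last exact: (integrable_fin_num _ iG).
have -> : fine (\int[mu]_s (window L s * (C s ^+ 2 + S s ^+ 2))%R%:E)%E
    = \int[mu2]_z (g z.1 * g z.2 * window_cos L (c * (z.1 - z.2))).
  transitivity (\int[mu]_s \int[mu2]_z F (s, z)).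
    by rewrite -/(Rintegral _ _ _); apply: eq_Rintegral => s _; rewrite FE.
  rewrite -(Rfubini1 iF) (Rfubini2 iF); apply: eq_Rintegral => z _.
  rewrite /window_cos -RintegralZl//; last exact: integrable_window_cos.
  by apply: eq_Rintegral => s _; rewrite /F/=; ring.
pose k (y y' : R) : R := (1 + (c * (y - y')) ^+ 2)^-1.
have mk : measurable_fun setT (fun z : RT * RT => k z.1 z.2).
  refine (measurableT_comp (g := fun z : RT * RT => c * (z.1 - z.2)) mcauchy _).
  by mfun.
have k0 y y' : 0 <= k y y' by exact/ltW/cauchy_gt0.
have W0 : 0 <= window_const L.
  by rewrite addr_ge0// mulr_ge0// ?addr_ge0// ?exprn_ge0// ltW.
(* The two marginal integrals of the Schur test. *)
have k1 y : (\int[mu]_y' (k y y')%:E = (`|c|^-1 * cauchy_mass)%:E)%E.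
  rewrite -normrN -(integral_cauchy_affine (c * y)) ?oppr_eq0//.
  by apply: eq_integral => y' _; rewrite /k; congr ((1 + _ ^+ 2)^-1)%:E; ring.
have k2 y' : (\int[mu]_y (k y y')%:E = (`|c|^-1 * cauchy_mass)%:E)%E.
  rewrite -(integral_cauchy_affine (- (c * y')))//.
  by apply: eq_integral => y _; rewrite /k; congr ((1 + _ ^+ 2)^-1)%:E; ring.
have m0 : 0 <= `|c|^-1 * cauchy_mass.
  by rewrite -lee_fin -(k1 0); apply: integral_ge0 => y _; rewrite lee_fin.
have mgk1 : measurable_fun setT (fun z : RT * RT => g z.1 ^+ 2 * k z.1 z.2) by mfun.
have mgk2 : measurable_fun setT (fun z : RT * RT => g z.2 ^+ 2 * k z.1 z.2) by mfun.
have I1 : (\int[mu2]_z (g z.1 ^+ 2 * k z.1 z.2)%:E <= (`|c|^-1 * cauchy_mass * B)%:E)%E.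
  rewrite lebesgue2_tonelli1; [|by mfun|by move=> z; rewrite lee_fin mulr_ge0 ?sqr_ge0].
  rewrite /=; have E y : (\int[mu]_y' (g y ^+ 2 * k y y')%:E =
      (`|c|^-1 * cauchy_mass * g y ^+ 2)%:E)%E.
    rewrite integralZl_EFin_ge0 ?sqr_ge0// ?k1 -?EFinM 1?mulrC//.
    exact: (measurableT_comp mk (measurable_pair1 y)).
  under eq_integral do rewrite E.
  rewrite integralZl_EFin_ge0; [|by mfun|by move=> y; exact: sqr_ge0|by []].
  by rewrite [leRHS]EFinM lee_wpmul2l// lee_fin.
have I2 : (\int[mu2]_z (g z.2 ^+ 2 * k z.1 z.2)%:E <= (`|c|^-1 * cauchy_mass * B)%:E)%E.
  rewrite lebesgue2_tonelli2; [|by mfun|by move=> z; rewrite lee_fin mulr_ge0 ?sqr_ge0].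
  rewrite /=; have E y' : (\int[mu]_y (g y' ^+ 2 * k y y')%:E =
      (`|c|^-1 * cauchy_mass * g y' ^+ 2)%:E)%E.
    rewrite integralZl_EFin_ge0 ?sqr_ge0// ?k2 -?EFinM 1?mulrC//.
    exact: (measurableT_comp mk (measurable_pair2 y')).
  under eq_integral do rewrite E.
  rewrite integralZl_EFin_ge0; [|by mfun|by move=> y; exact: sqr_ge0|by []].
  by rewrite [leRHS]EFinM lee_wpmul2l// lee_fin.
have mwc : measurable_fun [set: RT] (window_cos L).
  pose H (x : RT * RT) : R := window L x.2 * cos (x.1 * x.2).
  have mH : measurable_fun setT H by rewrite /H; mfun.
  exact: (measurable_Rintegral mu mH).
have mK : measurable_fun setT (fun z : RT * RT => g z.1 * g z.2 * window_cos L (c * (z.1 - z.2))).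
  by mfun.
have Kle (z : RT * RT) : `|g z.1 * g z.2 * window_cos L (c * (z.1 - z.2))| <=
    (window_const L / 2) * (g z.1 ^+ 2 * k z.1 z.2 + g z.2 ^+ 2 * k z.1 z.2).
  rewrite normrM; have h1 := amgm (g z.1) (g z.2) ltr01; rewrite invr1 in h1.
  have h2 := window_cos_le (c * (z.1 - z.2)) L0.
  apply: le_trans (ler_pM (normr_ge0 _) (normr_ge0 _) h1 h2) _.
  by rewrite le_eqVlt; apply/orP; left; apply/eqP; rewrite /k; ring.
have bound : (\int[mu2]_z `|g z.1 * g z.2 * window_cos L (c * (z.1 - z.2))|%:E <=
    (window_const L * (`|c|^-1 * cauchy_mass) * B)%:E)%E.
  apply: (@le_trans _ _ (\int[mu2]_z ((window_const L / 2) *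
      (g z.1 ^+ 2 * k z.1 z.2 + g z.2 ^+ 2 * k z.1 z.2))%:E)%E).
    by apply: le_integral_EFin; [by mfun|by mfun|by []|].
  have g1 (z : RT * RT) : 0 <= g z.1 ^+ 2 * k z.1 z.2 by rewrite mulr_ge0// sqr_ge0.
  have g2 (z : RT * RT) : 0 <= g z.2 ^+ 2 * k z.1 z.2 by rewrite mulr_ge0// sqr_ge0.
  have W2 : 0 <= window_const L / 2 by rewrite divr_ge0.
  rewrite integralZl_EFin_ge0; [|by mfun|by move=> z; rewrite addr_ge0|by []].
  rewrite integralD_EFin_ge0//.
  apply: (@le_trans _ _ ((window_const L / 2)%:E * ((`|c|^-1 * cauchy_mass * B)%:E
    + (`|c|^-1 * cauchy_mass * B)%:E))%E).
    by rewrite lee_wpmul2l ?lee_fin// leeD.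
  by rewrite -EFinD -EFinM lee_fin; lra.
have iK : mu2.-integrable setT
    (EFin \o (fun z => g z.1 * g z.2 * window_cos L (c * (z.1 - z.2)))).
  apply/integrableP; split; first exact/measurable_EFinP.
  by apply: le_lt_trans bound _; rewrite ltry.
apply: le_trans bound; have /integrableP[mKE _] := iK.
apply: le_trans (le_abse_integral mu2 measurableT mKE).
rewrite -EFin_normr_Rintegral// lee_fin; exact: ler_norm.
Qed.

End window_plancherel.

(** * Large y *)

Section far_piece.
Context {R : realType}.
Local Notation mu := (@lebesgue_measure R).
Local Notation RT := (measurableTypeR R).
Local Notation mu2 := (@lebesgue2 R).
Implicit Types (u v w : R -> R) (B c x : R).

(** Cosine and sine share every estimate; the boolean selects one of them. *)
Definition osc (b : bool) : R -> R := if b then cos else sin.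

Lemma measurable_osc b : measurable_fun [set: R] (osc b).
Proof. by case: b; [exact: measurable_cos|exact: measurable_sin]. Qed.

Lemma osc_le1 b (y : R) : `|osc b y| <= 1.
Proof. by case: b; rewrite /osc ler_norml ?cos_geN1 ?cos_le1 ?sin_geN1 ?sin_le1. Qed.

Definition near_set (e : R) : set RT := `](- e), e[%classic.

Lemma near_setE (e y : R) : (y \in near_set e) = (`|y| < e).
Proof. by rewrite mem_setE in_itv/= -ltr_norml. Qed.

Lemma measurable_indic_near e : measurable_fun [set: RT] (\1_(near_set e) : R -> R).
Proof. by apply: measurable_indic; exact: measurable_itv. Qed.

Lemma measurable_indic_far e : measurable_fun [set: RT] (\1_(~` near_set e) : R -> R).
Proof. by apply: measurable_indic; apply: measurableC; exact: measurable_itv. Qed.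

Lemma indic_far (e y : R) : \1_(~` near_set e) y = (e <= `|y|)%R%:R :> R.
Proof. by rewrite indicE in_setC near_setE -leNgt. Qed.

(** The fiber is at most B / |y|, and 1 / y^2 <= 2 / (M^2 + y^2) where |y| >= M.
    The right-hand side is a rescaled Cauchy density, integrable on the whole line
    with integral of order 1 / M. *)
Lemma fiber_far_L2le B u v x M : 0 < M -> L2le B u -> L2le B v ->
  L2le (2 * cauchy_mass * B ^+ 2 / M) (fun y => \1_(~` near_set M) y * fiber u v x y).
Proof.
move=> M0 uB vB; have B0 := L2le_ge0 uB.
have mf : measurable_fun [set: RT] (fiber u v x).
  by apply: measurable_fiber; [case: uB|case: vB].
have mi := measurable_indic_far M.
split; first by mfun.
pose q (y : R) : R := (1 + (0 + M^-1 * y) ^+ 2)^-1.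
have mq : measurable_fun [set: RT] q.
  by refine (measurableT_comp (g := fun y : R => 0 + M^-1 * y) (@measurable_inv_oneDsqr R) _); mfun.
have c2 : 0 <= B ^+ 2 * 2 * M ^- 2 by rewrite !mulr_ge0// ?sqr_ge0// invr_ge0 sqr_ge0.
have q0 y : 0 <= q y by exact/ltW/cauchy_gt0.
have iM0 : M^-1 != 0 by rewrite invr_eq0 gt_eqF.
apply: (@le_trans _ _ (\int[mu]_y (B ^+ 2 * 2 * M ^- 2 * q y)%:E)%E).
  apply: le_integral_EFin; [by mfun|by mfun|by move=> y; exact: sqr_ge0|].
  move=> y; rewrite indic_far; have [yM|yM] := leP M `|y|; last first.
    by rewrite mul0r expr0n/= mulr_ge0.
  have y0 : 0 < `|y| by exact: lt_le_trans yM.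
  have y0' : y != 0 by rewrite -normr_gt0.
  have h := fiber_le x y0' uB vB.
  rewrite mul1r -(real_normK (num_real (fiber _ _ _ _))).
  apply: (@le_trans _ _ ((B / `|y|) ^+ 2)).
    by rewrite lerXn2r ?nnegrE// divr_ge0.
  rewrite exprMn -!mulrA ler_wpM2l ?sqr_ge0// /q add0r exprVn real_normK ?num_real//.
  have y2 : 0 < y ^+ 2 by rewrite -(real_normK (num_real y)) exprn_gt0.
  have M2 : M ^+ 2 <= y ^+ 2.
    by rewrite -(real_normK (num_real y)) lerXn2r ?nnegrE// ltW.
  have M2' : 0 < M ^+ 2 by rewrite exprn_gt0.
  have -> : M ^- 2 * (1 + (M^-1 * y) ^+ 2)^-1 = (M ^+ 2 + y ^+ 2)^-1.
    by rewrite -invfM; congr _^-1; field; rewrite gt_eqF.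
  rewrite ler_wpM2l//.
  by rewrite ler_pdivlMr ?addr_gt0// mulrC ler_pdivrMr//; lra.
rewrite integralZl_EFin_ge0; [|by []|by move=> y; rewrite ltW// cauchy_gt0|by []].
rewrite integral_cauchy_affine// -EFinM lee_fin gtr0_norm ?invr_gt0// invrK.
by rewrite le_eqVlt; apply/orP; left; apply/eqP; field; rewrite gt_eqF.
Qed.

Definition far_const L c : R :=
  window_const L * (`|c|^-1 * cauchy_mass) * (2 * cauchy_mass).

(** As a function of s the form is the cosine or sine transform of the fiber cut
    off at |y| >= M, which is integrable because the full form converges. *)
Lemma integral_form_far_le b u v x L c M B : 0 < L -> c != 0 -> 0 < M ->
  L2le B u -> L2le B v ->
  (\int[mu]_s (window L s * (form (fun y => \1_(~` near_set M) y * osc b (s * (c * y)))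
     u v x) ^+ 2)%:E <= (far_const L c * B ^+ 2 / M)%:E)%E.
Proof.
move=> L0 c0 M0 uB vB.
have mi := measurable_indic_far M.
have mo := @measurable_osc.
have w1 : weight (fun y => \1_(~` near_set M) y : R).
  by split => // y; rewrite indicE ger0_norm// lern1 leq_b1.
have far0 : \1_(~` near_set M) 0 = 0 :> R.
  by rewrite indic_far normr0 leNgt M0.
have ws s b' : weight (fun y => \1_(~` near_set M) y * osc b' (s * (c * y))).
  split; first by have mob := mo b'; mfun.
  by move=> y; rewrite normrM mulr_ile1// ?osc_le1//; case: w1.
have [_ ig] := form_fiber x w1 far0 uB vB.
have gB := fiber_far_L2le x M0 uB vB.
have E s b' : form (fun y => \1_(~` near_set M) y * osc b' (s * (c * y))) u v x =
    \int[mu]_y (\1_(~` near_set M) y * fiber u v x y * osc b' (s * (c * y))).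
  have ws0 : \1_(~` near_set M) 0 * osc b' (s * (c * 0)) = 0 by rewrite far0 mul0r.
  have [-> _] := form_fiber x (ws s b') ws0 uB vB.
  by apply: eq_Rintegral => y _; ring.
have := window_plancherel L0 c0 ig gB.
rewrite (_ : far_const L c * B ^+ 2 / M = window_const L * (`|c|^-1 * cauchy_mass) *
  (2 * cauchy_mass * B ^+ 2 / M)); last by rewrite /far_const; ring.
apply: le_trans; under eq_integral do rewrite E.
have mw := @measurable_window R L.
have mf : measurable_fun [set: RT] (fiber u v x).
  by apply: measurable_fiber; [case: uB|case: vB].
have mI b' : measurable_fun [set: RT] (fun s =>
    \int[mu]_y (\1_(~` near_set M) y * fiber u v x y * osc b' (s * (c * y)))).
  pose H (z : RT * RT) : R := \1_(~` near_set M) z.2 * fiber u v x z.2 * osc b' (z.1 * (c * z.2)).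
  have mob := mo b'; have mH : measurable_fun setT H by rewrite /H; mfun.
  exact: (measurable_Rintegral mu mH).
have mI1 := mI b; have mIc := mI true; have mIs := mI false.
apply: le_integral_EFin; first by mfun.
- by rewrite /= in mIc mIs; mfun.
- by move=> s; rewrite mulr_ge0 ?window_ge0// sqr_ge0.
move=> s; rewrite ler_wpM2l ?window_ge0//.
by case: b {mI1}; rewrite /= ?lerDl ?lerDr sqr_ge0.
Qed.

End far_piece.

(** * Intermediate y: weak convergence becomes strong *)

Section weak_convergence.
Context {R : realType}.
Local Notation mu := (@lebesgue_measure R).
Local Notation RT := (measurableTypeR R).
Local Notation mu2 := (@lebesgue2 R).
Implicit Types (u v w g : R -> R) (B C x : R) (un vn : nat -> R -> R).

(** The test functions are those with a finite [L2le] bound, that is, all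
    square-integrable ones. *)
Definition weak_cvgR un u := forall g C, L2le C g ->
  (\int[mu]_y (un n y * g y) @[n --> \oo] --> \int[mu]_y (u y * g y)).

(** The weight l in the weighted inequality is taken small first, which controls
    the bounded factor; the other term then tends to 0. *)
Lemma weak_strong_cvg0 B (dn : nat -> R) un gn : 
  (forall n, L2le B (un n)) -> (forall n, L2le (dn n) (gn n)) ->
  dn n @[n --> \oo] --> (0 : R) ->
  \int[mu]_y (un n y * gn n y) @[n --> \oo] --> (0 : R).
Proof.
move=> unB gnd d0; have B0 := L2le_ge0 (unB 0%N).
apply/cvgrPdist_le => e e0.
pose l := e / (B + 1).
have B1 : 0 < B + 1 by rewrite ltr_wpDl.
have l0 : 0 < l by rewrite divr_gt0.
near=> n.
rewrite sub0r normrN; apply: le_trans (L2le_Rintegral l0 (unB n) (gnd n)) _.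
have h1 : l / 2 * B <= e / 2.
  rewrite mulrAC ler_wpM2r// /l mulrAC ler_pdivrMr// ler_wpM2l ?(ltW e0)// lerDl//.
have h2 : l^-1 / 2 * dn n <= e / 2.
  rewrite mulrAC ler_wpM2r// ler_pdivrMl//.
  near: n; apply: (cvgr_le _ d0).
  by rewrite mulr_gt0// divr_gt0.
by rewrite [leRHS]splitr lerD.
Unshelve. all: by end_near. Qed.

Lemma L2leB B C u v : L2le B u -> L2le C v -> L2le (2 * (B + C)) (fun y => u y - v y).
Proof.
move=> [mu_ uB] [mv vC]; split; first by mfun.
apply: (@le_trans _ _ (\int[mu]_y (2 * (u y ^+ 2 + v y ^+ 2))%:E)%E).
  apply: le_integral_EFin; [by mfun|by mfun|by move=> y; exact: sqr_ge0|].
  move=> y; have : 0 <= (u y + v y) ^+ 2 by exact: sqr_ge0.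
  by rewrite sqrrD sqrrB; lra.
rewrite integralZl_EFin_ge0; [|by mfun|by move=> y; rewrite addr_ge0// sqr_ge0|by []].
rewrite integralD_EFin_ge0; [|by mfun|by mfun|by move=> y; rewrite sqr_ge0
  |by move=> y; rewrite sqr_ge0].
by rewrite EFinM (EFinD B C); apply: lee_wpmul2l => //; exact: leeD.
Qed.

End weak_convergence.

Section mid_piece.
Context {R : realType}.
Local Notation mu := (@lebesgue_measure R).
Local Notation RT := (measurableTypeR R).
Local Notation mu2 := (@lebesgue2 R).
Implicit Types (u v g : R -> R) (B C : R) (un vn : nat -> R -> R).

Lemma measurable_invR : measurable_fun [set: R] (fun y : R => y^-1).
Proof.
rewrite (_ : (fun y : R => y^-1) = fun y => y * (`|y| `^ (-1)) ^+ 2).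
  have mp := @measurable_powR R (-1).
  apply: measurable_funM => //; apply: measurable_funX.
  exact: (measurableT_comp mp).
apply/funext => y; rewrite powRN powRr1// exprVn real_normK ?num_real//.
have [->|y0] := eqVneq y 0; first by rewrite invr0 mul0r.
by field.
Qed.

Variables (w : R -> R) (x e M : R).
Hypotheses (e0 : 0 < e) (M0 : 0 < M) (ww : weight w)
  (wnear : forall y, `|y| < e -> w y = 0) (wfar : forall y, M <= `|y| -> w y = 0).

Local Notation J := (`]0%R, 1%R[%classic : set RT).

Let mJ : measurable_fun [set: RT] (\1_J : R -> R).
Proof. exact: measurable_indic. Qed.

(** The Jacobian |y|^-1 and the indicator come from the substitution p = x + t y at
    fixed y: t = (p - x) / y runs through ]0, 1[. *)
Definition kernel (y p : R) : R := w y * `|y|^-1 * \1_J (y^-1 * (p - x)).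

Lemma measurable_kernel : measurable_fun setT (fun z : RT * RT => kernel z.1 z.2).
Proof.
have [mw _] := ww; have mi := measurable_invR; rewrite /kernel.
have man : measurable_fun [set: RT] (fun y => `|y|^-1).
  exact: (measurableT_comp mi (@normr_measurable R setT)).
have mz1 : measurable_fun setT (fun z : RT * RT => z.1^-1).
  exact: (measurableT_comp mi measurable_fst).
apply: measurable_funM.
  apply: measurable_funM; first by mfun.
  exact: (measurableT_comp man measurable_fst).
refine (measurableT_comp (g := fun z : RT * RT => z.1^-1 * (z.2 - x)) mJ _).
by mfun.
Qed.

Lemma kernel_le y p : `|kernel y p| <= e^-1 * \1_(near_set M) y.
Proof.
rewrite indicE near_setE; have [yM|yM] := ltP `|y| M; last first.
  by rewrite /kernel wfar// !mul0r normr0 mulr0.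
rewrite mulr1; have [ye|ye] := ltP `|y| e.
  by rewrite /kernel wnear// !mul0r normr0 invr_ge0 ltW.
have y0 : 0 < `|y| by exact: lt_le_trans ye.
rewrite /kernel !normrM normfV normr_id; have [_ w1] := ww.
apply: (@le_trans _ _ (1 * e^-1 * 1)); last by rewrite mul1r mulr1.
apply: ler_pM; [by rewrite mulr_ge0// invr_ge0|by []|..].
- by apply: ler_pM; rewrite ?invr_ge0// lef_pV2 ?posrE.
- by rewrite indicE ger0_norm ?lern1 ?leq_b1.
Qed.

(** If 0 < (p - x) / y < 1 then |p - x| < |y|, and the weight vanishes unless
    |y| < M. *)
Lemma kernel_supp y p : M <= `|p - x| -> kernel y p = 0.
Proof.
move=> px; rewrite /kernel indicE mem_setE in_itv/=.
have [yM|yM] := ltP `|y| M; last by rewrite wfar// !mul0r.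
have [/andP[h0 h1]|_] := boolP (0 < _ < 1); last by rewrite mulr0.
have y0 : y != 0 by apply: contraTneq h0 => ->; rewrite invr0 mul0r ltxx.
have : `|p - x| < `|y|.
  have -> : p - x = y * (y^-1 * (p - x)) by rewrite mulrA mulfV// mul1r.
  by rewrite normrM gtr_pMr ?normr_gt0// gtr0_norm.
by move=> /(le_lt_trans px) /(lt_trans yM); rewrite ltxx.
Qed.

Lemma form_kernel B u v : L2le B u -> L2le B v ->
  form w u v x = \int[mu]_y \int[mu]_p (kernel y p * (u p * v (p - y))).
Proof.
move=> uB vB.
have w0 : w 0 = 0 by apply: wnear; rewrite normr0.
have [-> _] := form_fiber x ww w0 uB vB.
apply: eq_Rintegral => y _.
have [->|y0] := eqVneq y 0.
  by rewrite w0 mul0r; under eq_Rintegral do rewrite /kernel w0 !mul0r;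
    rewrite Rintegral_cst// mul0r.
have vB' := L2le_shift (- y) vB.
have mJ' : measurable_fun [set: RT] (fun p : R => \1_J (y^-1 * (p - x)) : R).
  by refine (measurableT_comp (g := fun p : R => y^-1 * (p - x)) mJ _); mfun.
have iuv := L2le_integrable uB vB'.
have iJ : mu.-integrable setT (EFin \o (fun p => u p * v (p - y) * \1_J (y^-1 * (p - x)))).
  by apply: integrableM_bounded => // p; rewrite indicE ger0_norm ?lern1 ?leq_b1.
transitivity (w y * \int[mu]_t (fun p => u p * v (p - y) * \1_J (y^-1 * (p - x))) (x + y * t)).
  congr (_ * _); apply: eq_Rintegral => t _.
  rewrite (_ : x + y * t - x = y * t); last by ring.
  rewrite mulKf// (_ : x + y * t - y = x - (1 - t) * y); last by ring.
  by rewrite [y * t]mulrC; ring.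
rewrite (Rintegral_affine x y0 iJ) mulrA -RintegralZl//.
by apply: eq_Rintegral => p _; rewrite /kernel; ring.
Qed.

Lemma integral_near_set : (\int[mu]_y (\1_(near_set M) y)%:E = (2 * M)%:E)%E.
Proof.
have MM : - M <= M by apply: le_trans (ltW M0); rewrite oppr_le0 ltW.
by rewrite integral_indic_itv_oo// (_ : M - - M = 2 * M)//; ring.
Qed.

Lemma integrable_kernel B u v : L2le B u -> L2le B v ->
  mu2.-integrable setT (EFin \o (fun z => kernel z.1 z.2 * (u z.2 * v (z.2 - z.1)))).
Proof.
move=> uB vB; have [mu_ _] := uB; have [mv _] := vB; have B0 := L2le_ge0 uB.
have mk := measurable_kernel.
have muv : measurable_fun setT (fun z : RT * RT => u z.2 * v (z.2 - z.1)) by mfun.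
have mF : measurable_fun setT (fun z : RT * RT => kernel z.1 z.2 * (u z.2 * v (z.2 - z.1))).
  exact: measurable_funM.
apply: lebesgue2_integrable12 => //=.
have mn := measurable_indic_near M.
apply: (@le_lt_trans _ _ (\int[mu]_y (e^-1 * B * \1_(near_set M) y)%:E)%E); last first.
  rewrite integralZl_EFin_ge0; [|by []|by move=> y; rewrite indicE
    |by rewrite mulr_ge0// invr_ge0 ltW].
  by rewrite integral_near_set -EFinM ltry.
apply: (ge0_le_integral mu measurableT).
- by move=> y _; exact: integral_ge0.
- have mFa : measurable_fun setT
      (fun z : RT * RT => `|kernel z.1 z.2 * (u z.2 * v (z.2 - z.1))|%:E) by mfun.
  by have := measurable_fun_fubini_tonelli_F (m2 := mu) _ mFa; apply.
- by mfun.
move=> y _.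
have c0 : 0 <= e^-1 * \1_(near_set M) y by rewrite indicE mulr_ge0// invr_ge0 ltW.
have := L2le_mul_le ltr01 uB (L2le_shift (- y) vB).
rewrite invr1 -mulrDl -splitr mul1r => H.
have mn2 : measurable_fun [set: RT] (fun p => `|u p * v (p - y)|) by mfun.
apply: (@le_trans _ _ (\int[mu]_p (e^-1 * \1_(near_set M) y * `|u p * v (p - y)|)%:E)%E).
  have mF1 : measurable_fun [set: RT] (fun p => kernel y p * (u p * v (p - y))).
    exact: (measurableT_comp mF (measurable_pair1 y)).
  apply: le_integral_EFin; [by mfun|by mfun|by []|].
  by move=> p; rewrite normrM ler_wpM2r// kernel_le.
rewrite integralZl_EFin_ge0//.
rewrite [e^-1 * B * _]mulrAC [leRHS]EFinM; apply: lee_wpmul2l => //.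
Qed.

Definition kernel_op v (p : R) := \int[mu]_q (kernel (p - q) p * v q).

Lemma kernel_L2le p : L2le (e^-1 ^+ 2 * (2 * M)) (fun q => kernel (p - q) p).
Proof.
have mk : measurable_fun [set: RT] (fun q => kernel (p - q) p).
  refine (measurableT_comp (g := fun q : RT => (p - q, p)) measurable_kernel _).
  by apply: measurable_fun_pair; mfun.
split => //.
have mn : measurable_fun [set: RT] (fun q => \1_(near_set M) (p + (-1) * q) : R).
  by refine (measurableT_comp (g := fun q : RT => p + (-1) * q) (measurable_indic_near M) _); mfun.
have i0 q : 0 <= \1_(near_set M) q :> R by rewrite indicE.
apply: (@le_trans _ _ (\int[mu]_q (e^-1 ^+ 2 * \1_(near_set M) (p + (-1) * q))%:E)%E).
  apply: le_integral_EFin; [by mfun|by mfun|by move=> q; exact: sqr_ge0|].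
  move=> q; rewrite -(real_normK (num_real (kernel _ _))).
  have h := kernel_le (p - q) p.
  apply: (@le_trans _ _ ((e^-1 * \1_(near_set M) (p - q)) ^+ 2)).
    by rewrite lerXn2r ?nnegrE// mulr_ge0// invr_ge0 ltW.
  rewrite exprMn mulN1r ler_wpM2l ?sqr_ge0// indicE.
  by case: (_ \in _); rewrite ?expr1n// expr0n.
rewrite integralZl_EFin_ge0; [|by []|by []|exact: sqr_ge0].
have n1 : -1 != 0 :> R by rewrite oppr_eq0 oner_eq0.
rewrite (ge0_integral_affine p (f := fun q => (\1_(near_set M) q)%:E) n1)//.
  by rewrite normrN normr1 invr1 mul1e integral_near_set -EFinM.
by apply/measurable_EFinP; exact: measurable_indic_near.
Qed.

Lemma kernel_op_far v p : M <= `|p - x| -> kernel_op v p = 0.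
Proof.
move=> px; rewrite /kernel_op; under eq_Rintegral do rewrite kernel_supp// mul0r.
by rewrite Rintegral_cst// mul0r.
Qed.

Lemma kernel_op_le B v p : L2le B v ->
  `|kernel_op v p| <= (e^-1 ^+ 2 * (2 * M) + B) / 2 * \1_(near_set M) (p - x).
Proof.
move=> vB; rewrite indicE near_setE.
have [px|px] := ltP `|p - x| M; last by rewrite kernel_op_far// normr0 mulr0.
apply: le_trans (L2le_Rintegral ltr01 (kernel_L2le p) vB) _.
by rewrite invr1 mulr1; lra.
Qed.

Lemma form_kernel_op B u v : L2le B u -> L2le B v ->
  form w u v x = \int[mu]_p (u p * kernel_op v p).
Proof.
move=> uB vB; rewrite (form_kernel uB vB).
have I := integrable_kernel uB vB.
rewrite -(lebesgue2_fubini1 I) (lebesgue2_fubini2 I)/=.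
apply: eq_Rintegral => p _; rewrite /kernel_op.
have iK : mu.-integrable setT (EFin \o (fun q => kernel (p - q) p * v q)).
  exact: L2le_integrable (kernel_L2le p) vB.
have n1 : -1 != 0 :> R by rewrite oppr_eq0 oner_eq0.
have := Rintegral_affine p n1 iK; rewrite normrN normr1 invr1 mul1r => <-.
rewrite -RintegralZl//; last exact: (integrable_affine p n1 iK).
apply: eq_Rintegral => y _; rewrite mulN1r (_ : p - (p - y) = y); last by ring.
by ring.
Qed.

Lemma measurable_kernel_op v : measurable_fun [set: RT] v ->
  measurable_fun [set: RT] (kernel_op v).
Proof.
move=> mv; pose H (z : RT * RT) : R := kernel (z.1 - z.2) z.1 * v z.2.
have mH : measurable_fun setT H.
  apply: measurable_funM; last by mfun.
  refine (measurableT_comp (g := fun z : RT * RT => (z.1 - z.2, z.1)) measurable_kernel _).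
  by apply: measurable_fun_pair; mfun.
exact: (measurable_Rintegral mu mH).
Qed.

Let C0 B : R := (e^-1 ^+ 2 * (2 * M) + B) / 2.

Let mdisk : measurable_fun [set: RT] (fun p => \1_(near_set M) (p - x) : R).
Proof.
by refine (measurableT_comp (g := fun p : RT => p - x) (measurable_indic_near M) _); mfun.
Qed.

Let integral_disk : (\int[mu]_p (\1_(near_set M) (p - x))%:E = (2 * M)%:E)%E.
Proof.
have := ge0_integral_affine (- x) (f := fun q => (\1_(near_set M) q)%:E) (oner_neq0 R).
rewrite normr1 invr1 mul1e integral_near_set => <-.
- by apply: eq_integral => p _; rewrite mul1r addrC.
- by apply/measurable_EFinP; exact: measurable_indic_near.
- by move=> y; rewrite lee_fin indicE.
Qed.

Lemma kernel_op_L2le B v : L2le B v -> L2le (C0 B ^+ 2 * (2 * M)) (kernel_op v).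
Proof.
move=> vB; have [mv _] := vB; have mo := measurable_kernel_op mv.
have i0 q : 0 <= \1_(near_set M) q :> R by rewrite indicE.
have C00 : 0 <= C0 B.
  by rewrite /C0 divr_ge0// addr_ge0 ?(L2le_ge0 vB)// mulr_ge0 ?sqr_ge0// mulr_ge0// ltW.
split => //.
apply: (@le_trans _ _ (\int[mu]_p (C0 B ^+ 2 * \1_(near_set M) (p - x))%:E)%E).
  apply: le_integral_EFin; [by mfun|by mfun|by move=> q; exact: sqr_ge0|].
  move=> p; rewrite -(real_normK (num_real (kernel_op _ _))).
  have h := kernel_op_le p vB.
  apply: (@le_trans _ _ ((C0 B * \1_(near_set M) (p - x)) ^+ 2)).
    by rewrite lerXn2r ?nnegrE// mulr_ge0.
  rewrite exprMn ler_wpM2l ?sqr_ge0// indicE.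
  by case: (_ \in _); rewrite ?expr1n// expr0n.
rewrite integralZl_EFin_ge0; [|by []|by []|exact: sqr_ge0].
by rewrite integral_disk -EFinM.
Qed.

(** At a fixed p the operator pairs its argument with a square-integrable
    function, so weak convergence gives pointwise convergence.  The images are
    bounded and supported in |p - x| < M uniformly in n, so dominated convergence
    applies to the square of the difference. *)
Lemma kernel_op_compact B vn v : (forall n, L2le B (vn n)) -> L2le B v ->
  weak_cvgR vn v ->
  fine (\int[mu]_p ((kernel_op (vn n) p - kernel_op v p) ^+ 2)%:E)%E @[n --> \oo] --> (0 : R).
Proof.
move=> vnB vB vnv.
have mo g : L2le B g -> measurable_fun [set: RT] (kernel_op g).
  by move=> [mg _]; exact: measurable_kernel_op.
have mv := mo _ vB; have mvn n := mo _ (vnB n).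
have i0 q : 0 <= \1_(near_set M) q :> R by rewrite indicE.
have C00 : 0 <= C0 B.
  by rewrite /C0 divr_ge0// addr_ge0 ?(L2le_ge0 vB)// mulr_ge0 ?sqr_ge0// mulr_ge0// ltW.
have := @dominated_cvg _ _ _ mu setT measurableT
  (fun n p => ((kernel_op (vn n) p - kernel_op v p) ^+ 2)%:E) (cst 0%E)
  (fun p => ((2 * C0 B) ^+ 2 * \1_(near_set M) (p - x))%:E).
rewrite integral0 => H; apply: fine_cvg; apply: H.
- by move=> n; have mvn' := mvn n; mfun.
- move=> p _; apply: cvg_EFin; first exact: nearW.
  rewrite (_ : 0 = (kernel_op v p - kernel_op v p) ^+ 2); last by rewrite subrr expr0n.
  have : kernel_op (vn n) p @[n --> \oo] --> kernel_op v p.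
    have := vnv _ _ (kernel_L2le p); rewrite /kernel_op.
    under eq_Rintegral do rewrite mulrC.
    by under eq_fun do under eq_Rintegral do rewrite mulrC.
  move=> h; rewrite !expr2; apply: cvgM; apply: cvgB => //; exact: cvg_cst.
- by [].
- apply/integrableP; split; first by mfun.
  rewrite (_ : (\int[mu]_p _ = \int[mu]_p ((2 * C0 B) ^+ 2 * \1_(near_set M) (p - x))%:E)%E).
    by rewrite integralZl_EFin_ge0 ?sqr_ge0// integral_disk -EFinM ltry.
  by apply: eq_integral => p _; rewrite /= ger0_norm// mulr_ge0// sqr_ge0.
- move=> n p _; rewrite abse_EFin lee_fin ger0_norm ?sqr_ge0//.
  rewrite -(real_normK (num_real (_ - _))).
  apply: (@le_trans _ _ ((2 * C0 B * \1_(near_set M) (p - x)) ^+ 2)).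
    have h : `|kernel_op (vn n) p - kernel_op v p| <= 2 * C0 B * \1_(near_set M) (p - x).
      apply: le_trans (ler_normB _ _) _.
      have k1 : `|kernel_op (vn n) p| <= C0 B * \1_(near_set M) (p - x) by exact: kernel_op_le.
      have k2 : `|kernel_op v p| <= C0 B * \1_(near_set M) (p - x) by exact: kernel_op_le.
      by apply: le_trans (lerD k1 k2) _; rewrite -mulrA mulr_natl mulr2n.
    have h0 : 0 <= 2 * C0 B * \1_(near_set M) (p - x).
      by apply: mulr_ge0 => //; apply: mulr_ge0.
    by rewrite lerXn2r.
  rewrite exprMn ler_wpM2l ?sqr_ge0// indicE.
  by case: (_ \in _); rewrite ?expr1n// expr0n.
Qed.

(** Both arguments converge only weakly; the operator makes one of them strongly
    convergent, and a weakly and a strongly convergent sequence can be paired. *)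
Lemma form_mid_cvg B un vn u v :
  (forall n, L2le B (un n)) -> (forall n, L2le B (vn n)) -> L2le B u -> L2le B v ->
  weak_cvgR un u -> weak_cvgR vn v ->
  form w (un n) (vn n) x @[n --> \oo] --> form w u v x.
Proof.
move=> unB vnB uB vB unu vnv.
have dL n : L2le (fine (\int[mu]_p ((kernel_op (vn n) p - kernel_op v p) ^+ 2)%:E)%E)
    (fun p => kernel_op (vn n) p - kernel_op v p).
  have [mk kB] := L2leB (kernel_op_L2le (vnB n)) (kernel_op_L2le vB).
  split => //; rewrite fineK// ge0_fin_numE.
    by apply: le_lt_trans kB _; rewrite ltry.
  by apply: integral_ge0 => p _; rewrite lee_fin sqr_ge0.
have h1 := weak_strong_cvg0 unB dL (kernel_op_compact vnB vB vnv).
have h2 := unu _ _ (kernel_op_L2le vB).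
have E n : form w (un n) (vn n) x =
    \int[mu]_p (un n p * (kernel_op (vn n) p - kernel_op v p)) +
    \int[mu]_p (un n p * kernel_op v p).
  have i1 := L2le_integrable (unB n) (dL n).
  have i2 := L2le_integrable (unB n) (kernel_op_L2le vB).
  rewrite (form_kernel_op (unB n) (vnB n)) -RintegralD//.
  by apply: eq_Rintegral => p _; ring.
rewrite (form_kernel_op uB vB) -[X in _ --> X]add0r.
under eq_fun do rewrite E.
exact: (cvgD h1 h2).
Qed.

End mid_piece.

(** * Convergence in mean on squares *)

Section box_convergence.
Context {R : realType}.
Local Notation mu := (@lebesgue_measure R).
Local Notation RT := (measurableTypeR R).
Local Notation mu2 := (@lebesgue2 R).
Implicit Types (u v w : R -> R) (B : R) (un vn : nat -> R -> R).
Variables (b : bool) (c : R).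
Hypothesis c0 : c != 0.

(** With c = 2 pi this is a real bilinear version of the Born-Jordan distribution,
    as a function of z = (x, s), restricted in y by the weight w. *)
Definition bj_form w u v (z : RT * RT) : R :=
  form (fun y => w y * osc b (z.2 * (c * y))) u v z.1.

Lemma weight_osc w s : weight w -> weight (fun y => w y * osc b (s * (c * y))).
Proof.
move=> [mw w1]; have mo := @measurable_osc R b; split; first by mfun.
by move=> y; rewrite normrM mulr_ile1 ?osc_le1.
Qed.

Lemma measurable_bj_form w u v : measurable_fun [set: RT] w ->
  measurable_fun [set: RT] u -> measurable_fun [set: RT] v ->
  measurable_fun setT (bj_form w u v).
Proof.
move=> mw mu_ mv; have mo := @measurable_osc R b.
have mJ : measurable_fun [set: RT] (\1_(`]0%R, 1%R[%classic : set RT) : R -> R).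
  by apply: measurable_indic; exact: measurable_itv.
pose H (p : (RT * RT) * (RT * RT)) : R :=
  integrand (fun y => w y * osc b (p.1.2 * (c * y))) u v p.1.1 p.2.
have mH : measurable_fun setT H by rewrite /H /integrand; mfun.
exact: (measurable_Rintegral mu2 mH).
Qed.

Lemma bj_form_le w u v B z : weight w -> L2le B u -> L2le B v ->
  `|bj_form w u v z| <= form_bound * B.
Proof. by move=> ww uB vB; apply: form_le => //; exact: weight_osc. Qed.

Definition box (N : R) (z : RT * RT) : R := \1_(near_set N) z.1 * \1_(near_set N) z.2.

Lemma box_ge0 N z : 0 <= box N z.
Proof. by rewrite mulr_ge0// indicE. Qed.

Lemma measurable_box N : measurable_fun setT (box N).
Proof. by have mn := measurable_indic_near N; rewrite /box; mfun. Qed.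

Lemma integral_box N : 0 < N -> (\int[mu2]_z (box N z)%:E = (4 * N ^+ 2)%:E)%E.
Proof.
move=> N0; have mn := measurable_indic_near N.
rewrite lebesgue2_tonelli1; [|by apply/measurable_EFinP; exact: measurable_box
  |by move=> z; rewrite lee_fin box_ge0].
have E (x : RT) : (\int[mu]_y (box N (x, y))%:E = (2 * N * \1_(near_set N) x)%:E)%E.
  rewrite /box/= integralZl_EFin_ge0; [|by []|by move=> y; rewrite indicE|by rewrite indicE].
  by rewrite integral_near_set// muleC.
under eq_integral do rewrite E.
rewrite integralZl_EFin_ge0; [|by []|by move=> y; rewrite indicE|by rewrite mulr_ge0// ltW].
by rewrite integral_near_set// -EFinM; congr _%:E; ring.
Qed.

Lemma integral_box_near_le w u v N e B : 0 < N -> 0 < e -> weight w ->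
  (forall y, e <= `|y| -> w y = 0) -> L2le B u -> L2le B v ->
  (\int[mu2]_z (box N z * `|bj_form w u v z|)%:E <= (4 * N * e * B)%:E)%E.
Proof.
move=> N0 e0 ww we uB vB; have B0 := L2le_ge0 uB.
have [mw _] := ww; have [mu_ _] := uB; have [mv _] := vB.
have mn := measurable_indic_near N; have mb := measurable_box N.
have mbj := measurable_bj_form mw mu_ mv.
have mF : measurable_fun setT (fun z => (box N z * `|bj_form w u v z|)%:E) by mfun.
have F0 z : (0 <= (box N z * `|bj_form w u v z|)%:E)%E.
  by rewrite lee_fin mulr_ge0// box_ge0.
rewrite lebesgue2_tonelli2//.
apply: (@le_trans _ _ (\int[mu]_s (2 * e * B * \1_(near_set N) s)%:E)%E); last first.
  rewrite integralZl_EFin_ge0; [|by []|by move=> y; rewrite indicE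
    |by rewrite !mulr_ge0// ltW].
  by rewrite integral_near_set// -EFinM lee_fin le_eqVlt; apply/orP; left; apply/eqP; ring.
apply: (ge0_le_integral mu measurableT).
- by move=> s _; exact: integral_ge0.
- by have := measurable_fun_fubini_tonelli_G (m1 := mu) _ mF F0.
- by mfun.
move=> s _.
have mbs : measurable_fun [set: RT] (fun x : RT => bj_form w u v (x, s)).
  exact: (measurableT_comp mbj (measurable_pair2 s)).
have mbx : measurable_fun [set: RT] (fun x : RT => box N (x, s)).
  exact: (measurableT_comp mb (measurable_pair2 s)).
apply: (@le_trans _ _ (\int[mu]_x (\1_(near_set N) s * `|bj_form w u v (x, s)|)%:E)%E).
  apply: le_integral_EFin; [by mfun|by mfun|by move=> x; rewrite mulr_ge0// box_ge0|].
  move=> x; rewrite /box/= ler_wpM2r// ler_piMl ?indicE//.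
  by rewrite lern1 leq_b1.
rewrite integralZl_EFin_ge0; [|by mfun|by []|by rewrite indicE].
rewrite mulrC EFinM; apply: lee_wpmul2l; first by rewrite lee_fin indicE.
have we' y : e <= `|y| -> w y * osc b (s * (c * y)) = 0.
  by move=> ye; rewrite we// mul0r.
exact: (integral_form_near_le e0 (weight_osc s ww) we' uB vB).
Qed.

Definition far_weight (M : R) : R -> R := \1_(~` near_set M).

Lemma weight_far M : weight (far_weight M).
Proof.
split; first exact: measurable_indic_far.
by move=> y; rewrite /far_weight indicE ger0_norm// lern1 leq_b1.
Qed.

(** The estimate for large y is quadratic in the form, whereas the mean over the
    square is linear: |F| <= h / 2 + F^2 / (2 h) relates the two, h being the
    price per unit of area.  The window of half-width 2 N is at least N^2 on the
    square. *)
Lemma integral_box_far_le u v N h M B : 0 < N -> 0 < h -> 0 < M ->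
  L2le B u -> L2le B v ->
  (\int[mu2]_z (box N z * `|bj_form (far_weight M) u v z|)%:E
    <= (2 * N ^+ 2 * h + far_const (2 * N) c * B ^+ 2 / (N * h * M))%:E)%E.
Proof.
move=> N0 h0 M0 uB vB; have B0 := L2le_ge0 uB.
have ww := weight_far M.
have [mw _] := ww; have [mu_ _] := uB; have [mv _] := vB.
have mn := measurable_indic_near N; have mb := measurable_box N.
have mbj := measurable_bj_form mw mu_ mv.
pose F z := bj_form (far_weight M) u v z.
have mF : measurable_fun setT (fun z => (box N z * `|F z|)%:E) by mfun.
have F0 z : (0 <= (box N z * `|F z|)%:E)%E.
  by rewrite lee_fin mulr_ge0// box_ge0.
rewrite lebesgue2_tonelli1//.
pose K := far_const (2 * N) c * B ^+ 2 / M.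
have N20 : 0 < 2 * N by rewrite mulr_gt0.
have K0 : 0 <= K.
  have := integral_form_far_le b 0 N20 c0 M0 uB vB.
  rewrite -/K => H; rewrite -lee_fin; apply: le_trans H.
  by apply: integral_ge0 => s _; rewrite lee_fin mulr_ge0 ?window_ge0 ?sqr_ge0.
pose A := h * N + (2 * h * N ^+ 2)^-1 * K.
have k0 : 0 <= (2 * h * N ^+ 2)^-1.
  by rewrite invr_ge0 mulr_ge0 ?sqr_ge0// mulr_ge0// ltW.
have A0 : 0 <= A.
  by rewrite /A addr_ge0// mulr_ge0// ltW.
apply: (@le_trans _ _ (\int[mu]_x (A * \1_(near_set N) x)%:E)%E); last first.
  rewrite integralZl_EFin_ge0; [|by []|by move=> y; rewrite indicE|by []].
  rewrite integral_near_set// -EFinM lee_fin /A /K le_eqVlt; apply/orP; left; apply/eqP.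
  by field; rewrite !gt_eqF.
apply: (ge0_le_integral mu measurableT).
- by move=> x _; exact: integral_ge0.
- by have := measurable_fun_fubini_tonelli_F (m2 := mu) _ mF F0.
- by mfun.
move=> x _.
have mbs : measurable_fun [set: RT] (fun s : RT => F (x, s)).
  exact: (measurableT_comp mbj (measurable_pair1 x)).
have mbx : measurable_fun [set: RT] (fun s : RT => box N (x, s)).
  exact: (measurableT_comp mb (measurable_pair1 x)).
have mwin := @measurable_window R (2 * N).
have i0 s : 0 <= \1_(near_set N) s :> R by rewrite indicE.
have wF0 s : 0 <= window (2 * N) s * F (x, s) ^+ 2.
  by rewrite mulr_ge0 ?window_ge0 ?sqr_ge0.
have h20 : 0 <= h / 2 by rewrite divr_ge0// ltW.
have hi0 s : 0 <= h / 2 * \1_(near_set N) s by rewrite mulr_ge0.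
have kwF0 s : 0 <= (2 * h * N ^+ 2)^-1 * (window (2 * N) s * F (x, s) ^+ 2).
  by rewrite mulr_ge0.
apply: (@le_trans _ _ (\int[mu]_s (\1_(near_set N) x * (h / 2 * \1_(near_set N) s +
     (2 * h * N ^+ 2)^-1 * (window (2 * N) s * F (x, s) ^+ 2)))%:E)%E).
  apply: le_integral_EFin; [by mfun|by mfun|by move=> s; rewrite mulr_ge0// box_ge0|].
  move=> s; rewrite /box/= -[leLHS]mulrA; apply: ler_wpM2l => //.
  rewrite [\1_(near_set N) s]indicE near_setE.
  have [sN|sN] := boolP (`|s| < N); last first.
    by rewrite mul0r mulr0 add0r.
  rewrite mul1r mulr1.
  have := amgm 1 (F (x, s)) h0; rewrite mul1r expr1n mulr1 => H.
  apply: le_trans H _; rewrite lerD2l.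
  have -> : h^-1 / 2 * F (x, s) ^+ 2 = (2 * h * N ^+ 2)^-1 * (N ^+ 2 * F (x, s) ^+ 2).
    by field; rewrite !gt_eqF.
  rewrite ler_wpM2l// ler_wpM2r ?sqr_ge0//.
  rewrite /window indicE mem_setE in_itv/= -ler_norml.
  have s2 : s ^+ 2 <= N ^+ 2.
    by rewrite -(real_normK (num_real s)) lerXn2r ?nnegrE// ltW.
  have -> : `|s| <= 2 * N by apply: le_trans (ltW sN) _; lra.
  rewrite mul1r exprMn; have := sqr_ge0 N; lra.
rewrite integralZl_EFin_ge0; [|by mfun|by move=> s; rewrite addr_ge0|by []].
rewrite [A * _]mulrC [leRHS]EFinM; apply: lee_wpmul2l; first by rewrite lee_fin.
rewrite integralD_EFin_ge0; [|by mfun|by mfun|by []|by []].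
rewrite !integralZl_EFin_ge0//; last by mfun.
rewrite integral_near_set// -EFinM (_ : h / 2 * (2 * N) = h * N); last by field.
rewrite EFinD; apply: leeD => //; rewrite EFinM; apply: lee_wpmul2l; first by rewrite lee_fin.
by have := integral_form_far_le b x N20 c0 M0 uB vB.
Qed.

Definition mid_weight (e M y : R) : R := \1_(near_set M) y * \1_(~` near_set e) y.
(** The factor for |y| < M makes the three weights sum to 1 for every e and M,
    with no order assumed between them. *)
Definition near_weight (e M y : R) : R := \1_(near_set M) y * \1_(near_set e) y.

Lemma weight_mid e M : weight (mid_weight e M).
Proof.
have m1 := measurable_indic_near M; have m2 := measurable_indic_far e.
split; first by rewrite /mid_weight; mfun.
by move=> y; rewrite /mid_weight !indicE -natrM ger0_norm// lern1;
  case: (_ \in _); case: (_ \in _).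
Qed.

Lemma weight_near e M : weight (near_weight e M).
Proof.
have m1 := measurable_indic_near M; have m2 := measurable_indic_near e.
split; first by rewrite /near_weight; mfun.
by move=> y; rewrite /near_weight !indicE -natrM ger0_norm// lern1;
  case: (_ \in _); case: (_ \in _).
Qed.

Lemma weight1 : weight (cst 1 : R -> R).
Proof. by split => // y; rewrite normr1. Qed.

Lemma bj_form_split e M u v B z : L2le B u -> L2le B v ->
  bj_form (cst 1) u v z = bj_form (near_weight e M) u v z +
     (bj_form (mid_weight e M) u v z + bj_form (far_weight M) u v z).
Proof.
move=> uB vB.
have wn := weight_osc z.2 (weight_near e M).
have wm := weight_osc z.2 (weight_mid e M).
have wf := weight_osc z.2 (weight_far M).
have E y : mid_weight e M y * osc b (z.2 * (c * y)) + far_weight M y * osc b (z.2 * (c * y))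
   = (mid_weight e M y + far_weight M y) * osc b (z.2 * (c * y)) by ring.
have wmf : weight (fun y => mid_weight e M y * osc b (z.2 * (c * y)) +
                           far_weight M y * osc b (z.2 * (c * y))).
  split; first by have [mm _] := wm; have [mf _] := wf; mfun.
  move=> y; rewrite E normrM mulr_ile1 ?osc_le1// /mid_weight /far_weight !indicE !in_setC.
  by case: (_ \in _); case: (_ \in _); rewrite /= ?mul0r ?mul1r ?mulr0 ?add0r ?addr0 ?normr0 ?normr1.
rewrite /bj_form -(formDl _ wm wf uB vB) -(formDl _ wn wmf uB vB).
congr (form _ u v z.1); apply/funext => y.
rewrite E -mulrDl; congr (_ * _).
rewrite /near_weight /mid_weight /far_weight /cst !indicE !in_setC.
by case: (_ \in _); case: (_ \in _); rewrite /= ?mul0r ?mul1r ?mulr0 ?add0r ?addr0.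
Qed.

(** Pointwise convergence together with the uniform bound of the form: dominated
    convergence on the square. *)
Lemma bj_mid_box_cvg N e M B un vn u v d : 0 < N -> 0 < e -> 0 < M -> 0 < d ->
  (forall n, L2le B (un n)) -> (forall n, L2le B (vn n)) -> L2le B u -> L2le B v ->
  weak_cvgR un u -> weak_cvgR vn v ->
  \forall n \near \oo, (\int[mu2]_z (box N z * `|bj_form (mid_weight e M) (un n) (vn n) z -
     bj_form (mid_weight e M) u v z|)%:E <= d%:E)%E.
Proof.
move=> N0 e0 M0 d0 unB vnB uB vB unu vnv; have B0 := L2le_ge0 uB.
have wm := weight_mid e M; have [mw _] := wm.
have mb := measurable_box N.
have mF : measurable_fun setT (bj_form (mid_weight e M) u v).
  by apply: measurable_bj_form => //; [case: uB|case: vB].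
have mFn n : measurable_fun setT (bj_form (mid_weight e M) (un n) (vn n)).
  by apply: measurable_bj_form => //; [case: (unB n)|case: (vnB n)].
pose a n z := box N z * `|bj_form (mid_weight e M) (un n) (vn n) z -
     bj_form (mid_weight e M) u v z|.
have a0 n z : 0 <= a n z by rewrite mulr_ge0 ?box_ge0.
have ma n : measurable_fun setT (a n) by have mFn' := mFn n; rewrite /a; mfun.
pose K : R := form_bound * B + form_bound * B.
have aK n z : a n z <= K * box N z.
  rewrite mulrC ler_wpM2l ?box_ge0//; apply: le_trans (ler_normB _ _) _.
  by apply: lerD; exact: bj_form_le.
have K0 : 0 <= K by rewrite addr_ge0// mulr_ge0// form_bound_ge0.
have an_fin n : (\int[mu2]_z (a n z)%:E)%E \is a fin_num.
  rewrite ge0_fin_numE; last by apply: integral_ge0 => z _; rewrite lee_fin.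
  apply: (@le_lt_trans _ _ (\int[mu2]_z (K * box N z)%:E)%E).
    by apply: le_integral_EFin; [by []|by mfun|by []|by []].
  rewrite integralZl_EFin_ge0; [|by []|exact: box_ge0|by []].
  by rewrite integral_box// -EFinM ltry.
have := @dominated_cvg _ _ _ mu2 setT measurableT (fun n z => (a n z)%:E) (cst 0%E)
  (fun z => (K * box N z)%:E).
rewrite integral0 => H.
have {}H : fine (\int[mu2]_z (a n z)%:E)%E @[n --> \oo] --> (0 : R).
  apply: fine_cvg; apply: H.
  - by move=> n; apply/measurable_EFinP.
  - move=> z _; apply: cvg_EFin; first exact: nearW.
    have c1 : bj_form (mid_weight e M) (un n) (vn n) z @[n --> \oo] -->
        bj_form (mid_weight e M) u v z.
      apply: (@form_mid_cvg R _ z.1 e M e0 M0 (weight_osc z.2 wm) _ _ B) => // y yy.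
      + by rewrite /mid_weight indic_far leNgt yy !mulr0 mul0r.
      + by rewrite /mid_weight indicE near_setE ltNge yy !mul0r.
    rewrite /a -[0](mulr0 (box N z)); apply: cvgMl_tmp.
    rewrite -(normr0 R) -(subrr (bj_form (mid_weight e M) u v z)).
    by apply: cvg_norm; apply: cvgB => //; exact: cvg_cst.
  - by [].
  - apply/integrableP; split; first by mfun.
    rewrite (_ : (\int[mu2]_z _ = \int[mu2]_z (K * box N z)%:E)%E).
      rewrite integralZl_EFin_ge0; [|by []|exact: box_ge0|by []].
      by rewrite integral_box// -EFinM ltry.
    by apply: eq_integral => z _; rewrite /= ger0_norm// mulr_ge0// box_ge0.
  - by move=> n z _; rewrite abse_EFin lee_fin ger0_norm.
near=> n.
rewrite -[leLHS](fineK (an_fin n)) lee_fin.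
by near: n; exact: (cvgr_le _ H).
Unshelve. all: by end_near. Qed.

(** The near and the far parts are small uniformly over all bounded pairs, so they
    are estimated for the sequence and for its limit separately; the middle part is
    the only one in which the convergence is used.  Five terms, a fifth of d for
    each. *)
Lemma bj_box_cvg N B un vn u v d : 0 < N -> 0 < d ->
  (forall n, L2le B (un n)) -> (forall n, L2le B (vn n)) -> L2le B u -> L2le B v ->
  weak_cvgR un u -> weak_cvgR vn v ->
  \forall n \near \oo, (\int[mu2]_z (box N z * `|bj_form (cst 1) (un n) (vn n) z -
     bj_form (cst 1) u v z|)%:E <= d%:E)%E.
Proof.
move=> N0 d0 unB vnB uB vB unu vnv; have B0 := L2le_ge0 uB.
have B1 : 0 < B + 1 by rewrite ltr_wpDl.
pose K : R := `|far_const (2 * N) c * B ^+ 2|.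
have K0 : 0 <= K by exact: normr_ge0.
have K1 : 0 < K + 1 by rewrite ltr_wpDl.
(* e makes the near part at most d / 10, and h makes the area term of the far part
   equal to d / 10; M is then chosen so that its other term is at most d / 10.
   Adding 1 to B and K keeps e and M positive when B or K is 0. *)
pose e := d / (40 * N * (B + 1)).
pose h := d / (20 * N ^+ 2).
pose M := 10 * (K + 1) / (N * h * d).
have e0 : 0 < e by rewrite divr_gt0// !mulr_gt0.
have h0 : 0 < h by rewrite divr_gt0// mulr_gt0// exprn_gt0.
have M0 : 0 < M by apply: divr_gt0; [exact: mulr_gt0|do 2 apply: mulr_gt0 => //].
have d5 : 0 < d / 5 by rewrite divr_gt0.
have hnear p q : L2le B p -> L2le B q ->
    (\int[mu2]_z (box N z * `|bj_form (near_weight e M) p q z|)%:E <= (d / 5)%:E)%E.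
  move=> pB qB; apply: (le_trans (integral_box_near_le N0 e0 (weight_near e M) _ pB qB)).
    by move=> y ye; rewrite /near_weight [X in _ * X]indicE near_setE ltNge ye mulr0.
  rewrite lee_fin (_ : 4 * N * e * B = d / 10 * (B / (B + 1))); last first.
    by rewrite /e; field; rewrite !gt_eqF.
  have BB : B / (B + 1) <= 1 by rewrite ler_pdivrMr// mul1r lerDl.
  have d10 : 0 <= d / 10 by rewrite divr_ge0// ltW.
  by apply: le_trans (ler_wpM2l d10 BB) _; rewrite mulr1; lra.
have hfar p q : L2le B p -> L2le B q ->
    (\int[mu2]_z (box N z * `|bj_form (far_weight M) p q z|)%:E <= (d / 5)%:E)%E.
  move=> pB qB; apply: (le_trans (integral_box_far_le N0 h0 M0 pB qB)).
  rewrite lee_fin (_ : 2 * N ^+ 2 * h = d / 10); last by rewrite /h; field; rewrite !gt_eqF.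
  apply: (@le_trans _ _ (d / 10 + K / (N * h * M))).
    have NhM0 : 0 < N * h * M by do 2 apply: mulr_gt0 => //.
    by rewrite lerD2l ler_wpM2r ?ler_norm// invr_ge0 ltW.
  have -> : K / (N * h * M) = d / 10 * (K / (K + 1)).
    by rewrite /M; field; rewrite !gt_eqF.
  have KK : K / (K + 1) <= 1 by rewrite ler_pdivrMr// mul1r lerDl.
  have d10 : 0 <= d / 10 by rewrite divr_ge0// ltW.
  by have := ler_wpM2l d10 KK; rewrite mulr1; lra.
have mb := measurable_box N.
have mF w p q : weight w -> L2le B p -> L2le B q -> measurable_fun setT (bj_form w p q).
  by move=> [mw _] [mp _] [mq _]; exact: measurable_bj_form.
near=> n.
have hmid : (\int[mu2]_z (box N z * `|bj_form (mid_weight e M) (un n) (vn n) z -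
     bj_form (mid_weight e M) u v z|)%:E <= (d / 5)%:E)%E.
  by near: n; exact: (bj_mid_box_cvg N0 e0 M0 d5 unB vnB uB vB unu vnv).
have m1 := mF _ _ _ (weight_near e M) (unB n) (vnB n).
have m2 := mF _ _ _ (weight_near e M) uB vB.
have m3 := mF _ _ _ (weight_mid e M) (unB n) (vnB n).
have m4 := mF _ _ _ (weight_mid e M) uB vB.
have m5 := mF _ _ _ (weight_far M) (unB n) (vnB n).
have m6 := mF _ _ _ (weight_far M) uB vB.
have m7 := mF _ _ _ weight1 (unB n) (vnB n).
have m8 := mF _ _ _ weight1 uB vB.
pose f1 z := box N z * `|bj_form (near_weight e M) (un n) (vn n) z|.
pose f2 z := box N z * `|bj_form (near_weight e M) u v z|.
pose f3 z := box N z * `|bj_form (mid_weight e M) (un n) (vn n) z - bj_form (mid_weight e M) u v z|.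
pose f4 z := box N z * `|bj_form (far_weight M) (un n) (vn n) z|.
pose f5 z := box N z * `|bj_form (far_weight M) u v z|.
have mf1 : measurable_fun setT f1 by rewrite /f1; mfun.
have mf2 : measurable_fun setT f2 by rewrite /f2; mfun.
have mf3 : measurable_fun setT f3 by rewrite /f3; mfun.
have mf4 : measurable_fun setT f4 by rewrite /f4; mfun.
have mf5 : measurable_fun setT f5 by rewrite /f5; mfun.
have p1 z : 0 <= f1 z by rewrite mulr_ge0// box_ge0.
have p2 z : 0 <= f2 z by rewrite mulr_ge0// box_ge0.
have p3 z : 0 <= f3 z by rewrite mulr_ge0// box_ge0.
have p4 z : 0 <= f4 z by rewrite mulr_ge0// box_ge0.
have p5 z : 0 <= f5 z by rewrite mulr_ge0// box_ge0.
apply: (@le_trans _ _ (\int[mu2]_z (f1 z + (f2 z + (f3 z + (f4 z + f5 z))))%:E)%E).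
  apply: le_integral_EFin; [by mfun|by mfun|by move=> z; rewrite mulr_ge0// box_ge0|].
  move=> z; rewrite /f1 /f2 /f3 /f4 /f5 -!mulrDr ler_wpM2l ?box_ge0//.
  rewrite (bj_form_split e M z (unB n) (vnB n)) (bj_form_split e M z uB vB).
  set x1 := bj_form _ _ _ _; set x2 := bj_form _ _ _ _; set x3 := bj_form _ _ _ _.
  set y1 := bj_form _ _ _ _; set y2 := bj_form _ _ _ _; set y3 := bj_form _ _ _ _.
  have -> : x1 + (x2 + x3) - (y1 + (y2 + y3)) = x1 + (- y1 + ((x2 - y2) + (x3 + - y3))).
    by ring.
  rewrite -(normrN y1) -(normrN y3).
  do 4 (apply: le_trans (ler_normD _ _) _; rewrite ?lerD2l).
  by [].
rewrite !integralD_EFin_ge0//; try (by mfun);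
  try (by move=> z; rewrite ?addr_ge0//).
apply: (@le_trans _ _ ((d / 5)%:E + ((d / 5)%:E + ((d / 5)%:E + ((d / 5)%:E + (d / 5)%:E))))%E).
  apply: leeD; first exact: hnear.
  apply: leeD; first exact: hnear.
  apply: leeD => //.
  by apply: leeD; exact: hfar.
by rewrite -!EFinD lee_fin; lra.
Unshelve. all: by end_near. Qed.

End box_convergence.

(** * Uniform boundedness of weakly convergent sequences *)

Section gliding_hump.
Context {R : realType}.
Local Notation mu := (@lebesgue_measure R).
Local Notation RT := (measurableTypeR R).
Variables (U : nat -> R -> R) (r : nat -> R).
Hypotheses (r0 : forall k, 0 < r k) (Ur : forall k, L2le (r k ^+ 2) (U k)).

(** The k-th function, normalized, with amplitude 3^-k: the ratio 1/3 is what makes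
    the sum of all later humps at most half of the current one. *)
Definition hump (k : nat) (t : R) : R := 3^-1 ^+ k * (U k t / r k).

(** The sign of each hump agrees with the pairing of its function against the
    previous humps, so that adding it cannot cancel that pairing. *)
Fixpoint hump_sum (m : nat) : R -> R :=
  if m is k.+1 then fun t => hump_sum k t +
    (if 0 <= \int[mu]_t (U k t * hump_sum k t) then 1 else -1) * hump k t
  else cst 0.

Definition hump_sign (k : nat) : R :=
  if 0 <= \int[mu]_t (U k t * hump_sum k t) then 1 else -1.

Lemma hump_sumE m t : hump_sum m t = series (fun k => hump_sign k * hump k t) m.
Proof.
elim: m => [|m IH]; first by rewrite /series/= big_geq.
by rewrite /= IH /series/= big_nat_recr//= -IH.
Qed.

(** Dominates the squares of all partial sums, by Cauchy-Schwarz with the weights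
    3^-k, and is integrable; this replaces the completeness of L^2. *)
Definition hump_energy (t : R) : \bar R :=
  (\sum_(k <oo) (3^-1 ^+ k * (U k t / r k) ^+ 2)%:E)%E.

Lemma geometric3_le m : \sum_(0 <= k < m) (3^-1 : R) ^+ k <= 3 / 2.
Proof.
suff : \sum_(0 <= k < m) (3^-1 : R) ^+ k = 3 / 2 - 3 / 2 * 3^-1 ^+ m.
  by move=> ->; rewrite lerBlDr lerDl mulr_ge0// exprn_ge0// invr_ge0.
elim: m => [|m IH]; first by rewrite big_geq// expr0; ring.
by rewrite big_nat_recr//= IH exprS; field.
Qed.

(** Cauchy-Schwarz for the weights w. *)
Lemma sqr_weighted_sum_le (w a : nat -> R) m : (forall k, 0 <= w k) -> (forall k, 0 <= a k) ->
  (\sum_(0 <= k < m) w k * a k) ^+ 2 <=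
  (\sum_(0 <= k < m) w k) * (\sum_(0 <= k < m) w k * a k ^+ 2).
Proof.
move=> w0 a0; elim: m => [|m IH]; first by rewrite !big_geq// expr0n mulr0.
rewrite !big_nat_recr//=.
have S0 : 0 <= \sum_(0 <= k < m) w k by exact: sumr_ge0.
have A0 : 0 <= \sum_(0 <= k < m) w k * a k by apply: sumr_ge0 => k _; exact: mulr_ge0.
have Q0 : 0 <= \sum_(0 <= k < m) w k * a k ^+ 2.
  by apply: sumr_ge0 => k _; rewrite mulr_ge0// sqr_ge0.
move: IH S0 A0 Q0; set A := \sum_(0 <= k < m) w k * a k; set S := \sum_(0 <= k < m) w k.
set Q := \sum_(0 <= k < m) _ => IH S0 A0 Q0.
have wm := w0 m; have am := a0 m.
(* The arithmetic-geometric mean inequality for Q and S a^2, whose geometric mean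
   is at least A a by the induction hypothesis. *)
have key : 2 * A * a m <= Q + S * a m ^+ 2.
  have h : (2 * A * a m) ^+ 2 <= (Q + S * a m ^+ 2) ^+ 2.
    have h1 : 4 * (A ^+ 2 * a m ^+ 2) <= 4 * (S * Q * a m ^+ 2).
      by rewrite ler_wpM2l// ler_wpM2r// sqr_ge0.
    have h2 : 0 <= (Q - S * a m ^+ 2) ^+ 2 by exact: sqr_ge0.
    have e1 : (2 * A * a m) ^+ 2 = 4 * (A ^+ 2 * a m ^+ 2) by ring.
    have e2 : (Q + S * a m ^+ 2) ^+ 2 = (Q - S * a m ^+ 2) ^+ 2 + 4 * (S * Q * a m ^+ 2) by ring.
    lra.
  have n1 : 0 <= 2 * A * a m by rewrite !mulr_ge0.
  have n2 : 0 <= Q + S * a m ^+ 2 by rewrite addr_ge0// mulr_ge0// sqr_ge0.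
  by move: h; rewrite ler_sqr.
have := ler_wpM2l wm key; rewrite sqrrD => h3.
have -> : (S + w m) * (Q + w m * a m ^+ 2) =
  S * Q + w m * (Q + S * a m ^+ 2) + (w m * a m) ^+ 2 by ring.
rewrite lerD2r mulr2n; lra.
Qed.

Lemma norm_hump k t : `|hump_sign k * hump k t| = 3^-1 ^+ k * `|U k t / r k|.
Proof.
rewrite normrM (_ : `|hump_sign k| = 1).
  by rewrite mul1r /hump normrM ger0_norm// exprn_ge0// invr_ge0.
by rewrite /hump_sign; case: ifP => _; rewrite ?normrN normr1.
Qed.

Lemma series_hump_le m t :
  ((series (fun k => `|hump_sign k * hump k t|) m ^+ 2)%:E <= 2%:E * hump_energy t)%E.
Proof.
pose a k := `|U k t / r k|.
have w0 k : 0 <= (3^-1 : R) ^+ k by rewrite exprn_ge0// invr_ge0.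
have E : series (fun k => `|hump_sign k * hump k t|) m = \sum_(0 <= k < m) 3^-1 ^+ k * a k.
  by rewrite /series/=; apply: eq_bigr => k _; rewrite norm_hump.
have h := sqr_weighted_sum_le m w0 (fun k => normr_ge0 (U k t / r k)).
rewrite E; apply: (@le_trans _ _ (2 * \sum_(0 <= k < m) 3^-1 ^+ k * a k ^+ 2)%:E).
  rewrite lee_fin; apply: le_trans h _; apply: ler_wpM2r.
    by apply: sumr_ge0 => k _; rewrite mulr_ge0// sqr_ge0.
  by apply: le_trans (geometric3_le m) _; lra.
rewrite EFinM; apply: lee_wpmul2l => //.
rewrite /hump_energy -sumEFin.
rewrite (eq_bigr (fun k => (3^-1 ^+ k * (U k t / r k) ^+ 2)%:E)); last first.
  by move=> k _; rewrite /a real_normK ?num_real.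
by apply: nneseries_lim_ge => k _ _; rewrite lee_fin mulr_ge0// sqr_ge0.
Qed.

Lemma hump_energy_ge0 t : (0 <= hump_energy t)%E.
Proof.
by apply: nneseries_ge0 => k _ _; rewrite lee_fin mulr_ge0 ?sqr_ge0// exprn_ge0// invr_ge0.
Qed.

Lemma hump_sum_sqr_le m t : ((hump_sum m t ^+ 2)%:E <= 2%:E * hump_energy t)%E.
Proof.
apply: le_trans (series_hump_le m t); rewrite lee_fin hump_sumE.
rewrite -(real_normK (num_real (series _ _))) lerXn2r ?nnegrE//.
  by rewrite /series/= sumr_ge0.
by rewrite /series/=; exact: ler_norm_sum.
Qed.

Lemma hump_sum_cvg t : (hump_energy t < +oo)%E -> cvgn (hump_sum ^~ t).
Proof.
move=> tD; have Gfin : hump_energy t \is a fin_num by rewrite ge0_fin_numE// hump_energy_ge0.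
rewrite (_ : hump_sum ^~ t = series (fun k => hump_sign k * hump k t)); last first.
  by apply/funext => m; rewrite hump_sumE.
apply: normed_cvg; apply: nondecreasing_is_cvgn.
  by apply/nondecreasing_seqP => m;
    rewrite [leRHS](seriesSr (fun k => `|hump_sign k * hump k t|)) lerDl.
exists (2 * fine (hump_energy t) + 1) => _ [m _ <-].
have := series_hump_le m t; rewrite -(fineK Gfin) -EFinM lee_fin.
set s := series _ m => h; rewrite -[X in X <= _]/s.
(* s <= s^2 + 1 *)
have : 0 <= (s - 1) ^+ 2 by exact: sqr_ge0.
have := sqr_ge0 s.
rewrite sqrrB1; lra.
Qed.

Let mU k : measurable_fun [set: RT] (U k). Proof. by case: (Ur k). Qed.

Lemma measurable_hump k : measurable_fun [set: RT] (hump k).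
Proof. by rewrite /hump; have := mU k => mUk; mfun. Qed.

Lemma measurable_hump_sum m : measurable_fun [set: RT] (hump_sum m).
Proof.
elim: m => [|m IH] /=; first exact: measurable_cst.
by have mh := measurable_hump m; mfun.
Qed.

Lemma measurable_hump_energy : measurable_fun [set: RT] hump_energy.
Proof.
apply: ge0_emeasurable_sum => k.
  by move=> t _ _; rewrite lee_fin mulr_ge0 ?sqr_ge0// exprn_ge0// invr_ge0.
by move=> _; have := mU k => mUk; mfun.
Qed.

Lemma integral_hump_energy_lty : (\int[mu]_t hump_energy t < +oo)%E.
Proof.
have w0 k : 0 <= (3^-1 : R) ^+ k by rewrite exprn_ge0// invr_ge0.
rewrite /hump_energy integral_nneseries//; last 2 first.
- by move=> k; have := mU k => mUk; mfun.
- by move=> k t _; rewrite lee_fin mulr_ge0// sqr_ge0.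
apply: (@le_lt_trans _ _ (3 / 2)%:E); last exact: ltry.
apply: lime_le; first by apply: is_cvg_nneseries => k _ _; apply: integral_ge0 => t _;
  rewrite lee_fin mulr_ge0// sqr_ge0.
apply: nearW => m; apply: (@le_trans _ _ (\sum_(0 <= k < m) (3^-1 ^+ k)%:E)%E); last first.
  by rewrite sumEFin lee_fin geometric3_le.
apply: lee_sum => k _; have := mU k => mUk.
rewrite integralZl_EFin_ge0; [|by mfun|by move=> t; exact: sqr_ge0|by []].
rewrite -[leRHS]mule1; apply: lee_wpmul2l; first by rewrite lee_fin.
have [_ h] := Ur k.
under eq_integral do rewrite exprMn mulrC.
rewrite integralZl_EFin_ge0; [|by mfun|by move=> t; exact: sqr_ge0|exact: sqr_ge0].
apply: (@le_trans _ _ (((r k)^-1 ^+ 2)%:E * (r k ^+ 2)%:E)%E).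
  by apply: lee_wpmul2l => //; rewrite lee_fin sqr_ge0.
by rewrite -EFinM -exprMn mulVf ?gt_eqF// expr1n.
Qed.

Lemma integral_hump_energy_fin : (\int[mu]_t hump_energy t)%E \is a fin_num.
Proof.
rewrite ge0_fin_numE ?integral_hump_energy_lty//.
by apply: integral_ge0 => t _; exact: hump_energy_ge0.
Qed.

Lemma hump_energy_L2le (f : R -> R) : measurable_fun [set: RT] f ->
  (forall t, ((f t ^+ 2)%:E <= 2%:E * hump_energy t)%E) -> exists C, L2le C f.
Proof.
move=> mf fE; have me := measurable_hump_energy.
exists (2 * fine (\int[mu]_t hump_energy t)%E); split => //.
rewrite EFinM fineK ?integral_hump_energy_fin//.
rewrite -(ge0_integralZl_EFin mu measurableT (fun t _ => hump_energy_ge0 t) me (k := 2))//.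
apply: (ge0_le_integral mu measurableT).
- by move=> t _; rewrite lee_fin sqr_ge0.
- by mfun.
- exact: (measurable_funeM 2%:E me).
- by move=> t _; exact: fE.
Qed.

Lemma hump_sum_L2le m : exists C, L2le C (hump_sum m).
Proof. exact: hump_energy_L2le (@measurable_hump_sum m) (hump_sum_sqr_le m). Qed.

(** The indicator sets the limit to 0 on the null set where the series may
    diverge, which keeps the limit measurable. *)
Definition hump_limit (t : R) : R :=
  limn (fun m => hump_sum m t * \1_[set t | (hump_energy t < +oo)%E] t).

Let D : set RT := [set t | (hump_energy t < +oo)%E].

Let mD : measurable D.
Proof.
have := @emeasurable_fun_infty_o _ RT R setT hump_energy measurableT measurable_hump_energy +oo%E.
by rewrite setTI.
Qed.

Lemma hump_limit_cvg t :
  (hump_sum m t * \1_D t) @[m --> \oo] --> hump_limit t.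
Proof.
suff : cvgn (fun m => hump_sum m t * \1_D t) by [].
have [tD|tD] := boolP (t \in D); rewrite indicE.
  rewrite tD; apply: is_cvgM; last exact: is_cvg_cst.
  by apply: hump_sum_cvg; move: tD; rewrite inE.
by rewrite (negbTE tD); under eq_fun do rewrite mulr0; exact: is_cvg_cst.
Qed.

Lemma measurable_hump_limit : measurable_fun [set: RT] hump_limit.
Proof.
apply: (@measurable_fun_cvg _ RT R setT (fun m t => hump_sum m t * \1_D t)).
- move=> m; have ms := measurable_hump_sum m.
  by apply: measurable_funM => //; exact: measurable_indic.
- by move=> t _; exact: hump_limit_cvg.
Qed.

Lemma hump_limit_L2le : exists C, L2le C hump_limit.
Proof.
apply: hump_energy_L2le => [|t]; first exact: measurable_hump_limit.
have [tD|tD] := boolP (t \in D); last first.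
  move: tD; rewrite notin_setE/= => /negP; rewrite -leNgt leye_eq => /eqP ->.
  by rewrite mulry gtr0_sg// mul1e leey.
have c1 := @hump_limit_cvg t.
have Gfin : hump_energy t \is a fin_num.
  by rewrite ge0_fin_numE ?hump_energy_ge0//; move: tD; rewrite inE.
rewrite -(fineK Gfin) -EFinM lee_fin.
have c2 : (hump_sum m t * \1_D t) ^+ 2 @[m --> \oo] --> hump_limit t ^+ 2.
  by rewrite expr2; under eq_fun do rewrite expr2; exact: cvgM.
rewrite -(cvg_lim _ c2)//; apply: limr_le; first by apply/cvg_ex; eexists; exact: c2.
apply: nearW => m.
rewrite indicE tD mulr1 -lee_fin [leRHS]EFinM fineK//; exact: hump_sum_sqr_le.
Qed.

Lemma L2le_hump j : L2le 1 (fun t => U j t / r j).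
Proof.
have mUj := mU j; have [_ h] := Ur j; split; first by mfun.
under eq_integral do rewrite exprMn mulrC.
rewrite integralZl_EFin_ge0; [|by mfun|by move=> t; exact: sqr_ge0|exact: sqr_ge0].
apply: (@le_trans _ _ (((r j)^-1 ^+ 2)%:E * (r j ^+ 2)%:E)%E).
  by apply: lee_wpmul2l => //; rewrite lee_fin sqr_ge0.
by rewrite -EFinM -exprMn mulVf ?gt_eqF// expr1n.
Qed.

Lemma Rintegral_humpE k j :
  \int[mu]_t (U k t * hump j t) = 3^-1 ^+ j * \int[mu]_t (U k t * (U j t / r j)).
Proof.
rewrite -RintegralZl//; last exact: L2le_integrable (Ur k) (L2le_hump j).
by apply: eq_Rintegral => t _; rewrite /hump; ring.
Qed.

Lemma Rintegral_hump_le k j : `|\int[mu]_t (U k t * hump j t)| <= r k * 3^-1 ^+ j.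
Proof.
rewrite Rintegral_humpE normrM ger0_norm ?exprn_ge0 ?invr_ge0// mulrC.
rewrite ler_wpM2r ?exprn_ge0 ?invr_ge0//.
have ri : 0 < (r k)^-1 by rewrite invr_gt0.
apply: le_trans (L2le_Rintegral ri (Ur k) (L2le_hump j)) _.
by rewrite le_eqVlt; apply/orP; left; apply/eqP; field; rewrite gt_eqF.
Qed.

Lemma Rintegral_hump_sumS k m : \int[mu]_t (U k t * hump_sum m.+1 t) =
  \int[mu]_t (U k t * hump_sum m t) + hump_sign m * \int[mu]_t (U k t * hump m t).
Proof.
have [C hC] := hump_sum_L2le m.
have ih : mu.-integrable setT (EFin \o (fun t => U k t * hump m t)).
  have [C1 h1] := hump_sum_L2le m.+1; have := L2leB h1 hC => hB.
  have := L2le_integrable (Ur k) (L2le_hump m) => i0.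
  have := integrableZl measurableT (3^-1 ^+ m) i0.
  by congr (mu.-integrable _ _); apply/funext => t /=;
    rewrite -EFinM /hump; congr _%:E; ring.
rewrite -RintegralZl// -RintegralD//; last 2 first.
- exact: L2le_integrable (Ur k) hC.
- have := integrableZl measurableT (hump_sign m) ih.
  by congr (mu.-integrable _ _); apply/funext.
by apply: eq_Rintegral => t _ /=; rewrite -/(hump_sign m); ring.
Qed.

Hypothesis Ueq : forall k, (\int[mu]_t (U k t ^+ 2)%:E = (r k ^+ 2)%:E)%E.

Lemma Rintegral_hump_self k : \int[mu]_t (U k t * hump k t) = r k * 3^-1 ^+ k.
Proof.
rewrite Rintegral_humpE mulrC; congr (_ * _).
have -> : \int[mu]_t (U k t * (U k t / r k)) = \int[mu]_t ((r k)^-1 * (U k t ^+ 2)).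
  by apply: eq_Rintegral => t _; ring.
rewrite RintegralZl//; last first.
  by have := L2le_integrable (Ur k) (Ur k); congr (mu.-integrable _ _);
    apply/funext => t /=; rewrite expr2.
rewrite [X in _ * X](_ : _ = r k ^+ 2); last by rewrite /Rintegral Ueq.
by rewrite expr2 mulKf// gt_eqF.
Qed.

(** Right after the k-th hump the pairing is at least r k / 3^k by the choice of
    the sign.  Later humps change it by at most the sum of r k / 3^j over j > k,
    which is half of that; the second term on the left keeps track of what is left
    of this allowance after i more humps. *)
Lemma hump_sum_large k i :
  r k * (2^-1 * 3^-1 ^+ k + 2^-1 * 3^-1 ^+ (k + i)) <=
  `|\int[mu]_t (U k t * hump_sum (k + i).+1 t)|.
Proof.
have q0 j : 0 <= (3^-1 : R) ^+ j by rewrite exprn_ge0// invr_ge0.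
elim: i => [|i IH].
  rewrite addn0 Rintegral_hump_sumS Rintegral_hump_self /hump_sign.
  have -> : r k * (2^-1 * 3^-1 ^+ k + 2^-1 * 3^-1 ^+ k) = r k * 3^-1 ^+ k by field.
  case: ifPn => [p0|].
    by rewrite mul1r ger0_norm ?addr_ge0// ?mulr_ge0 ?(ltW (r0 _))// lerDr.
  rewrite -ltNge => p0; rewrite mulN1r -normrN opprD opprK ger0_norm.
    by rewrite lerDr oppr_ge0 ltW.
  by rewrite addr_ge0// ?oppr_ge0 ?(ltW p0)// mulr_ge0// ltW.
rewrite addnS Rintegral_hump_sumS.
have h := Rintegral_hump_le k (k + i).+1.
apply: (@le_trans _ _ (`|\int[mu]_t (U k t * hump_sum (k + i).+1 t)| -
   `|hump_sign (k + i).+1 * \int[mu]_t (U k t * hump (k + i).+1 t)|)); last first.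
  by rewrite -[X in _ - X]normrN; apply: le_trans (lerB_dist _ _) _; rewrite opprK.
have -> : `|hump_sign (k + i).+1 * \int[mu]_t (U k t * hump (k + i).+1 t)| =
    `|\int[mu]_t (U k t * hump (k + i).+1 t)|.
  by rewrite normrM /hump_sign; case: ifP => _; rewrite ?normrN normr1 mul1r.
rewrite lerBrDr; apply: le_trans IH; apply: (le_trans (lerD (lexx _) h)).
by rewrite exprS le_eqVlt; apply/orP; left; apply/eqP; field.
Qed.

Lemma hump_limit_large k :
  2^-1 * (r k * 3^-1 ^+ k) <= `|\int[mu]_t (U k t * hump_limit t)|.
Proof.
have Ifin := integral_hump_energy_fin.
have mUk := mU k; have me := measurable_hump_energy.
have mG2 : measurable_fun [set: RT] (fun t => 2%:E * hump_energy t)%E.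
  exact: (measurable_funeM 2%:E me).
pose g t := ((U k t ^+ 2)%:E + 2%:E * hump_energy t)%E.
have g20 t : (0 <= 2%:E * hump_energy t)%E by rewrite mule_ge0// hump_energy_ge0.
have mg : measurable_fun [set: RT] g by rewrite /g; apply: emeasurable_funD => //; mfun.
have ig : mu.-integrable setT g.
  apply/integrableP; split => //.
  rewrite (_ : (\int[mu]_t `|g t| = \int[mu]_t g t)%E); last first.
    by apply: eq_integral => t _; rewrite gee0_abs// adde_ge0// lee_fin sqr_ge0.
  rewrite /g ge0_integralD//; last 2 first.
  - by move=> t _; rewrite lee_fin sqr_ge0.
  - by mfun.
  rewrite (ge0_integralZl_EFin mu measurableT (fun t _ => hump_energy_ge0 t) me (k := 2))//.
  by rewrite Ueq -(fineK Ifin) -EFinM -EFinD ltry.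
have iG : mu.-integrable setT hump_energy.
  apply/integrableP; split => //.
  rewrite (_ : (\int[mu]_t `|_| = \int[mu]_t hump_energy t)%E) ?integral_hump_energy_lty//.
  by apply: eq_integral => t _; rewrite gee0_abs// hump_energy_ge0.
have ms m := @measurable_hump_sum m.
have ml := measurable_hump_limit.
have := @dominated_convergence _ _ _ mu setT measurableT
  (fun m t => (U k t * hump_sum m t)%:E) (fun t => (U k t * hump_limit t)%:E) g.
case.
- by move=> m; have msm := ms m; mfun.
- by mfun.
- apply: filterS (integrable_ae measurableT iG) => t /(_ I) tfin _.
  have tD : (hump_energy t < +oo)%E by rewrite -ge0_fin_numE// hump_energy_ge0.
  apply: cvg_EFin; first exact: nearW.
  apply: cvgMl_tmp; have := @hump_limit_cvg t.
  by rewrite indicE mem_set//; under eq_fun do rewrite mulr1.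
- exact: ig.
- apply: aeW => t m _; rewrite abse_EFin.
  have h := amgm (U k t) (hump_sum m t) ltr01.
  apply: (@le_trans _ _ ((U k t ^+ 2)%:E + (hump_sum m t ^+ 2)%:E)%E).
    rewrite -EFinD lee_fin; apply: le_trans h _; rewrite invr1.
    have := sqr_ge0 (U k t); have := sqr_ge0 (hump_sum m t); lra.
  by rewrite /g leeD2l// hump_sum_sqr_le.
move=> il _ cv0.
have cv : \int[mu]_t (U k t * hump_sum m t) @[m --> \oo] --> \int[mu]_t (U k t * hump_limit t).
  by apply: fine_cvg; rewrite /Rintegral fineK//; exact: (integrable_fin_num _ il).
(* The pairings with the partial sums converge to the pairing with the limit, and
   satisfy the bound from the index k + 1 on. *)
have cvn : `|\int[mu]_t (U k t * hump_sum m t)| @[m --> \oo] -->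
    `|\int[mu]_t (U k t * hump_limit t)| by exact: cvg_norm cv.
rewrite -(cvg_lim _ cvn)//; apply: limr_ge; first by apply/cvg_ex; eexists; exact: cvn.
near=> m.
have km : (k < m)%N by near: m; exact: nbhs_infty_gt.
have -> : m = (k + (m - k.+1)).+1 by rewrite -addSn subnKC.
apply: le_trans (hump_sum_large _ _).
rewrite mulrDr mulrCA lerDl.
by rewrite mulr_ge0 ?(ltW (r0 _))// mulr_ge0// ?invr_ge0// exprn_ge0// invr_ge0.
Unshelve. all: by end_near. Qed.

End gliding_hump.

Section weak_boundedness.
Context {R : realType}.
Local Notation mu := (@lebesgue_measure R).
Local Notation RT := (measurableTypeR R).

(** If the norms were unbounded, a subsequence would have norms at least 4^k.  Its
    gliding hump would be a test function whose pairing with the k-th function is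
    at least (4/3)^k / 2, against the bound assumed for that test function. *)
Lemma weak_bounded (un : nat -> R -> R) : (forall n, exists B, L2le B (un n)) ->
  (forall g C, L2le C g -> exists K : R, forall n, `|\int[mu]_t (un n t * g t)| <= K) ->
  exists B, forall n, L2le B (un n).
Proof.
move=> unL unb; apply: contrapT => unbounded.
have mun n : measurable_fun [set: RT] (un n) by have [B []] := unL n.
pose E n := fine (\int[mu]_t (un n t ^+ 2)%:E)%E.
have EE n : (\int[mu]_t (un n t ^+ 2)%:E = (E n)%:E)%E.
  have [B [_ h]] := unL n; rewrite /E fineK// ge0_fin_numE.
    by apply: le_lt_trans h _; rewrite ltry.
  by apply: integral_ge0 => t _; rewrite lee_fin sqr_ge0.
have large k : exists n, ((4 : R) ^+ k) ^+ 2 <= E n.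
  apply: contrapT => small; apply: unbounded; exists (((4 : R) ^+ k) ^+ 2) => n.
  split; first exact: mun.
  by rewrite EE lee_fin leNgt; apply/negP => h; apply: small; exists n; exact: ltW.
have [phi phiE] := choice large.
pose r k := Num.sqrt (E (phi k)).
have q0 k : 0 < (4 : R) ^+ k by rewrite exprn_gt0.
have E0 k : 0 <= E (phi k) by apply: le_trans (phiE k); exact: sqr_ge0.
have r4 k : 4 ^+ k <= r k.
  by rewrite -(ger0_norm (ltW (q0 k))) -sqrtr_sqr ler_wsqrtr.
have r0 k : 0 < r k by exact: lt_le_trans (r4 k).
have Ueq k : (\int[mu]_t (un (phi k) t ^+ 2)%:E = (r k ^+ 2)%:E)%E.
  by rewrite EE /r sqr_sqrtr.
have Ur k : L2le (r k ^+ 2) (un (phi k)) by split => //; rewrite Ueq.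
have [C xC] := hump_limit_L2le r0 Ur.
have [K hK] := unb _ _ xC.
have hk k : 2^-1 * ((4 / 3) ^+ k) <= K.
  apply: le_trans (hK (phi k)); apply: le_trans (hump_limit_large r0 Ur Ueq k).
  rewrite ler_wpM2l ?invr_ge0// expr_div_n -exprVn ler_wpM2r// exprn_ge0//.
(* Bernoulli's inequality, which makes (4/3)^k exceed any bound. *)
have bern k : 1 + k%:R / 3 <= (4 / 3 : R) ^+ k.
  elim: k => [|k IH]; first by rewrite expr0 mul0r addr0.
  have k0 : 0 <= k%:R / 3 :> R by rewrite divr_ge0.
  have q1 : 0 <= 4 / 3 :> R by rewrite divr_ge0.
  by rewrite exprS -natr1; have := ler_wpM2l q1 IH; lra.
have Kk := archi_boundP (normr_ge0 (6 * K)).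
have := hk (Num.bound `|6 * K|); have := bern (Num.bound `|6 * K|).
have := ler_norm (6 * K); lra.
Qed.

End weak_boundedness.

(** * From squares to sets of finite measure *)

Section plane_transfer.
Context {R : realType}.
Local Notation mu := (@lebesgue_measure R).
Local Notation RT := (measurableTypeR R).
Local Notation mu2 := (@lebesgue2 R).

(** The plane carries the completed product measure.  On Borel sets it is the
    product measure, so the identity transfers measurability and integrals of Borel
    functions. *)
Lemma measurable_plane (A : set (RT * RT)) :
  measurable A -> measurable (A : set (plane R)).
Proof. exact: (@caratheodory_measurable_mu_ext _ _ _ (borel_measure2 R)). Qed.

Lemma lebesgue_measure2E (A : set (RT * RT)) :
  measurable A -> lebesgue_measure2 R A = mu2 A.
Proof. exact: (@measurable_mu_extE _ _ _ (borel_measure2 R)). Qed.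

Lemma measurable_fun_plane d (T : measurableType d) (F : RT * RT -> T) :
  measurable_fun setT F -> measurable_fun (setT : set (plane R)) F.
Proof.
by move=> mF _ Y mY; apply: measurable_plane; exact: mF.
Qed.

Lemma integral_plane (F : RT * RT -> \bar R) : measurable_fun setT F ->
  (forall z, 0 <= F z)%E ->
  (\int[lebesgue_measure2 R]_z F z = \int[mu2]_z F z)%E.
Proof.
move=> mF F0.
pose phi : plane R -> RT * RT := idfun.
have mphi : measurable_fun (setT : set (plane R)) phi.
  by move=> _ Y mY; rewrite setTI; exact: measurable_plane.
have := @ge0_integral_pushforward _ _ (plane R) (RT * RT)%type R phi mphi
  (lebesgue_measure2 R) setT F measurableT mF (fun z _ => F0 z).
rewrite preimage_setT => <-.
by apply: eq_measure_integral => A mA _; exact: lebesgue_measure2E.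
Qed.

End plane_transfer.

Section Lp_convergence.
Context {R : realType}.
Local Notation mu := (@lebesgue_measure R).
Local Notation RT := (measurableTypeR R).
Local Notation mu2 := (@lebesgue2 R).
Local Notation m2 := (@lebesgue_measure2 R).
Implicit Types (p K : R).

(** The reverse triangle inequality for the L^p norm. *)
Lemma Lnorm_cvg d (T : measurableType d) (m : {measure set T -> \bar R}) p
    (gn : nat -> T -> R) (g : T -> R) : 1 <= p ->
  (forall n, measurable_fun setT (gn n)) -> measurable_fun setT g ->
  (forall n, 'N[m]_p%:E[EFin \o gn n] < +oo)%E -> ('N[m]_p%:E[EFin \o g] < +oo)%E ->
  (forall e, 0 < e -> \forall n \near \oo,
    (\int[m]_z (`|gn n z - g z| `^ p)%:E <= e%:E)%E) ->
  ('N[m]_p%:E[EFin \o gn n])%E @[n --> \oo] --> ('N[m]_p%:E[EFin \o g])%E.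
Proof.
move=> p1 mgn mg gnoo goo small.
have p0 : 0 < p by exact: lt_le_trans p1.
have pn0 : p != 0 by rewrite gt_eqF.
pose hn n := (gn n \- g)%R.
have mhn n : measurable_fun setT (hn n) by exact: measurable_funB.
have finN f : ('N[m]_p%:E[EFin \o f] < +oo)%E -> 'N[m]_p%:E[EFin \o f]%E \is a fin_num.
  by move=> foo; rewrite ge0_fin_numE// Lnorm_ge0.
have gfin := finN _ goo.
rewrite -[X in _ --> X](fineK gfin); apply/fine_cvgP; split.
  by apply: nearW => n; exact: finN.
apply/cvgrPdist_le => e e0.
near=> n.
have hne : ('N[m]_p%:E[EFin \o hn n] <= e%:E)%E.
  have h : (\int[m]_z (`|gn n z - g z| `^ p)%:E <= (e `^ p)%:E)%E.
    by near: n; apply: small; rewrite powR_gt0.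
  have -> : 'N[m]_p%:E[EFin \o hn n]%E = (('N[m]_p%:E[EFin \o hn n] `^ p) `^ p^-1)%E.
    by rewrite -poweRrM mulfV// poweRe1// Lnorm_ge0.
  have -> : e%:E = ((e `^ p)%:E `^ p^-1)%E.
    by rewrite poweR_EFin -powRrM mulfV// powRr1// ltW.
  rewrite poweR_Lnorm//.
  have I0 : (0 <= \int[m]_z `|(EFin \o hn n) z| `^ p)%E.
    by apply: integral_ge0 => z _; exact: poweR_ge0.
  have q0 : 0 <= p^-1 by rewrite invr_ge0 ltW.
  apply: (gt0_ler_poweR q0) => //; first by rewrite in_itv/= leey andbT.
  by rewrite in_itv/= leey andbT lee_fin powR_ge0.
have hfin : 'N[m]_p%:E[EFin \o hn n]%E \is a fin_num.
  by apply: finN; apply: le_lt_trans hne _; rewrite ltry.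
have nfin := finN _ (gnoo n).
have l1 : ('N[m]_p%:E[EFin \o gn n] <= 'N[m]_p%:E[EFin \o hn n] + 'N[m]_p%:E[EFin \o g])%E.
  have := @minkowski_EFin _ _ _ m (hn n) g p (mhn n) mg p1.
  rewrite (_ : (hn n \+ g)%R = gn n)//.
  by apply/funext => z; rewrite /hn /= subrK.
have l2 : ('N[m]_p%:E[EFin \o g] <= 'N[m]_p%:E[EFin \o hn n] + 'N[m]_p%:E[EFin \o gn n])%E.
  have := @minkowski_EFin _ _ _ m (\- hn n)%R (gn n) p (measurable_funN (mhn n)) (mgn n) p1.
  rewrite (_ : (\- hn n \+ gn n)%R = g); last first.
    by apply/funext => z; rewrite /hn /= opprB subrK.
  by rewrite (_ : EFin \o (\- hn n)%R = \- (EFin \o hn n))%E// oppe_Lnorm.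
move: l1 l2 hne; rewrite -(fineK hfin) -(fineK nfin) -(fineK gfin) -!EFinD !lee_fin /=.
move=> l1 l2 hne; rewrite ler_norml; apply/andP; split; lra.
Unshelve. all: by end_near. Qed.

(** What turns L^1 convergence of bounded functions into L^p convergence. *)
Lemma powR_le_linear p K a : 1 <= p -> 0 <= a -> a <= K -> a `^ p <= K `^ (p - 1) * a.
Proof.
move=> p1 a0 aK; rewrite -(mulr_powRB1 a0 (lt_le_trans ltr01 p1)) mulrC ler_wpM2r//.
by apply: ge0_ler_powR; rewrite ?nnegrE ?subr_ge0// (le_trans a0).
Qed.

Definition boxset (N : R) : set (RT * RT) := near_set N `*` near_set N.

Lemma measurable_boxset N : measurable (boxset N).
Proof. by apply: measurableX; exact: measurable_itv. Qed.

Lemma box_indic N z : box N z = \1_(boxset N) z :> R.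
Proof. by case: z => x y; rewrite /box /boxset !indicE in_setX -natrM mulnb. Qed.

(** Continuity from above; the finite measure of Omega is what allows it. *)
Lemma boxset_exhausts (Omega : set (plane R)) : measurable Omega ->
  (m2 Omega < +oo)%E ->
  m2 (Omega `\` (boxset n%:R : set (plane R))) @[n --> \oo] --> 0%E.
Proof.
move=> mO Ofin.
have mb n : measurable (boxset n%:R : set (plane R)).
  exact: measurable_plane (measurable_boxset n%:R).
have mF n : measurable (Omega `\` (boxset n%:R : set (plane R))) by exact: measurableD.
have cap : \bigcap_n (Omega `\` (boxset n%:R : set (plane R))) = set0.
  apply/seteqP; split => // -[x y] /= h.
  have [_] := h (Num.bound `|x| + Num.bound `|y|)%N I; apply.
  have ax := archi_boundP (normr_ge0 x); have ay := archi_boundP (normr_ge0 y).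
  have bx : 0 <= (Num.bound `|x|)%:R :> R by [].
  have by_ : 0 <= (Num.bound `|y|)%:R :> R by [].
  by split; rewrite /near_set /= in_itv/= -ltr_norml natrD; lra.
rewrite -[X in _ --> X](@measure0 _ _ _ m2) -cap.
apply: nonincreasing_cvg_mu => //.
- by apply: le_lt_trans Ofin; apply: le_measure; rewrite ?inE//; exact: subDsetl.
- by rewrite cap; exact: measurable0.
- apply/nonincreasing_seqP => n; rewrite subsetEset.
  apply: setDS => -[x y] [] /=; rewrite /near_set /= !in_itv/= -!ltr_norml => hx hy.
  by split; rewrite /near_set /= !in_itv/= -!ltr_norml -natr1 ?(lt_trans hx) ?(lt_trans hy)// ltrDl.
Qed.

(** On Omega the p-th power of the difference is at most (2 K)^p outside a large
    square, and at most (2 K)^(p - 1) times the difference inside it.  The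
    square is fixed first, then n. *)
Lemma Lnorm_restrict_cvg p K (Omega : set (plane R))
    (Wn : nat -> RT * RT -> R) (W : RT * RT -> R) :
  1 <= p -> measurable Omega -> (m2 Omega < +oo)%E ->
  (forall n, measurable_fun setT (Wn n)) -> measurable_fun setT W ->
  (forall n z, `|Wn n z| <= K) -> (forall z, `|W z| <= K) ->
  (forall N e, 0 < N -> 0 < e -> \forall n \near \oo,
     (\int[mu2]_z (box N z * `|Wn n z - W z|)%:E <= e%:E)%E) ->
  ('N[m2]_p%:E[(EFin \o Wn n) \_ Omega])%E @[n --> \oo] -->
  ('N[m2]_p%:E[(EFin \o W) \_ Omega])%E.
Proof.
move=> p1 mO Ofin mWn mW WnK WK small.
have p0 : 0 < p by exact: lt_le_trans p1.
have K0 : 0 <= K by apply: le_trans (WK (0, 0)).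
have mi : measurable_fun (setT : set (plane R)) (\1_Omega : plane R -> R).
  exact: measurable_indic.
have rE (F : RT * RT -> R) : ((EFin \o F) \_ Omega)%E =
    EFin \o (fun z : plane R => \1_Omega z * F z).
  by apply/funext => z; rewrite patchE /= indicE; case: ifP => _; rewrite ?mul1r ?mul0r.
rewrite rE; under eq_fun do rewrite rE.
have mpl (F : RT * RT -> R) : measurable_fun setT F ->
    measurable_fun (setT : set (plane R)) (fun z : plane R => F z).
  by move=> mF; exact: measurable_fun_plane.
have O0 z : 0 <= \1_Omega z :> R by rewrite indicE.
have finN (F : RT * RT -> R) : measurable_fun setT F -> (forall z, `|F z| <= K) ->
    ('N[m2]_p%:E[EFin \o (fun z : plane R => \1_Omega z * F z)%R] < +oo)%E.
  move=> mF FK; have pn0 : p != 0 by rewrite gt_eqF.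
  apply: (lty_poweRy pn0); rewrite poweR_Lnorm//.
  apply: (@le_lt_trans _ _ (\int[m2]_z (K `^ p * \1_Omega z)%:E)%E); last first.
    rewrite integralZl_EFin_ge0//; last exact: powR_ge0.
    by rewrite integral_indic ?setIT// lte_mul_pinfty// lee_fin powR_ge0.
  apply: (ge0_le_integral m2 measurableT).
  - by move=> z _; exact: poweR_ge0.
  - rewrite (_ : (fun z => _) =
        EFin \o (fun z : plane R => `|\1_Omega z * F z| `^ p)); last first.
      by apply/funext => z; rewrite [(EFin \o _) z]/= abse_EFin poweR_EFin.
    have mG : measurable_fun (setT : set (plane R)) (fun z : plane R => \1_Omega z * F z).
      exact: measurable_funM mi (mpl F mF).
    have mn := measurableT_comp (@normr_measurable R setT) mG.
    exact/measurable_EFinP/(measurableT_comp (measurable_powR p) mn).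
  - by apply/measurable_EFinP; apply: measurable_funM.
  move=> z _; rewrite [(EFin \o _) z]/= abse_EFin poweR_EFin lee_fin indicE.
  case: (_ \in _).
    by rewrite mul1r mulr1 ge0_ler_powR ?nnegrE// ltW.
  by rewrite mul0r normr0 mulr0 powR0.
have mG (F : RT * RT -> R) : measurable_fun setT F ->
    measurable_fun (setT : set (plane R)) (fun z : plane R => \1_Omega z * F z).
  by move=> mF; exact: measurable_funM mi (mpl F mF).
apply: (Lnorm_cvg p1 (fun n => mG _ (mWn n)) (mG _ mW)
  (fun n => finN _ (mWn n) (WnK n)) (finN _ mW WK)).
move=> e e0.
pose K2 := 2 * K.
have K20 : 0 <= K2 by rewrite mulr_ge0.
(* The added 1 makes c1 and c2 positive also when K = 0. *)
pose c1 := K2 `^ p + 1.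
have c10 : 0 < c1 by rewrite ltr_wpDl// powR_ge0.
pose c2 := K2 `^ (p - 1) + 1.
have c20 : 0 < c2 by rewrite ltr_wpDl// powR_ge0.
have [N [N0 HN]] : exists N : nat, (0 < N)%N /\
    (m2 (Omega `\` (boxset N%:R : set (plane R))) <= (e / 2 / c1)%:E)%E.
  have ec : 0 < e / 2 / c1 by rewrite !divr_gt0.
  have /fine_cvgP[nfin ncv] := boxset_exhausts mO Ofin.
  have lt := cvgr_le _ ncv _ ec.
  have [N _ HN] : \forall n \near \oo, (0 < n)%N /\
      (m2 (Omega `\` (boxset n%:R : set (plane R))) <= (e / 2 / c1)%:E)%E.
    near=> n; split; first by near: n; exact: nbhs_infty_gt.
    have nf : m2 (Omega `\` (boxset n%:R : set (plane R))) \is a fin_num.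
      by near: n; exact: nfin.
    by rewrite -(fineK nf) lee_fin; near: n; exact: lt.
  by exists N; apply: HN => /=.
pose A : set (plane R) := Omega `\` (boxset N%:R : set (plane R)).
have mA : measurable A.
  by apply: measurableD => //; exact: measurable_plane (measurable_boxset N%:R).
have mAi : measurable_fun (setT : set (plane R)) (\1_A : plane R -> R).
  exact: measurable_indic.
have NR : 0 < N%:R :> R by rewrite ltr0n.
near=> n.
have hs : (\int[mu2]_z (box N%:R z * `|Wn n z - W z|)%:E <= (e / 2 / c2)%:E)%E.
  by near: n; apply: small => //; rewrite !divr_gt0.
pose D z := box N%:R z * `|Wn n z - W z|.
have mD : measurable_fun setT D.
  have mb := @measurable_box R N%:R; have mWnn := mWn n; rewrite /D; mfun.
have D0 z : 0 <= D z by rewrite mulr_ge0 ?box_ge0.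
have hD : (\int[m2]_z (D z)%:E <= (e / 2 / c2)%:E)%E.
  by rewrite integral_plane//; exact/measurable_EFinP.
have A0 (z : plane R) : 0 <= \1_A z :> R by rewrite indicE.
(* Outside Omega the left-hand side is 0.  Inside, the first term pays for the
   complement of the square and the second for the square. *)
have key (z : plane R) : `|\1_Omega z * Wn n z - \1_Omega z * W z| `^ p <= c1 * \1_A z + c2 * D z.
  have [zO|zO] := boolP (z \in Omega); last first.
    rewrite [\1_Omega z]indicE (negbTE zO) !mul0r subrr normr0 powR0 ?gt_eqF//.
    by apply: addr_ge0; apply: mulr_ge0 => //; exact: ltW.
  rewrite [\1_Omega z]indicE zO !mul1r.
  have dK : `|Wn n z - W z| <= K2.
    apply: le_trans (ler_normB _ _) _; rewrite /K2 mulr_natl mulr2n.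
    by apply: lerD; [exact: WnK|exact: WK].
  have [zb|zb] := boolP ((z : RT * RT) \in boxset N%:R).
    have -> : D z = `|Wn n z - W z| by rewrite /D box_indic indicE zb mul1r.
    have : 0 <= c1 * \1_A z by apply: mulr_ge0 => //; exact: ltW.
    have := powR_le_linear p1 (normr_ge0 (Wn n z - W z)) dK.
    have := normr_ge0 (Wn n z - W z); rewrite /c2; lra.
  have -> : \1_A z = 1 :> R.
    by rewrite indicE mem_set//; split; [rewrite inE in zO|rewrite notin_setE in zb].
  have : `|Wn n z - W z| `^ p <= K2 `^ p by rewrite ge0_ler_powR ?nnegrE// ltW.
  have : 0 <= c2 * D z by apply: mulr_ge0 => //; exact: ltW.
  rewrite /c1; lra.
have mDp : measurable_fun (setT : set (plane R)) (fun z : plane R => D z) by exact: mpl.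
have mpow := measurableT_comp (measurable_powR p) (measurableT_comp
  (@normr_measurable R setT) (measurable_funB (mG _ (mWn n)) (mG _ mW))).
have m1A : measurable_fun (setT : set (plane R)) (fun z : plane R => c1 * \1_A z).
  exact: measurable_funM (measurable_cst c1) mAi.
have m2D : measurable_fun (setT : set (plane R)) (fun z : plane R => c2 * D z).
  exact: measurable_funM (measurable_cst c2) mDp.
have c1A (z : plane R) : 0 <= c1 * \1_A z by apply: mulr_ge0 => //; exact: ltW.
have c2D (z : plane R) : 0 <= c2 * D z by apply: mulr_ge0 => //; exact: ltW.
have := le_integral_EFin m2 mpow (measurable_funD m1A m2D) (fun z => powR_ge0 _ _) key.
move=> /le_trans; apply.
rewrite (integralD_EFin_ge0 m2 m1A m2D c1A c2D).
rewrite (integralZl_EFin_ge0 m2 mAi A0 (ltW c10)).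
rewrite (integralZl_EFin_ge0 m2 mDp D0 (ltW c20)).
rewrite (integral_indic m2 measurableT mA) setIT.
apply: (@le_trans _ _ (c1%:E * (e / 2 / c1)%:E + c2%:E * (e / 2 / c2)%:E)%E).
  by apply: leeD; apply: lee_wpmul2l; [|exact: HN| |exact: hD]; rewrite lee_fin ltW.
rewrite -!EFinM -EFinD lee_fin [X in X + _]mulrC [X in _ + X]mulrC !divfK ?gt_eqF//.
by rewrite -splitr.
Unshelve. all: by end_near. Qed.

End Lp_convergence.

(** * The Born-Jordan distribution of a complex function *)

Section complex_reduction.
Context {R : realType}.
Local Open Scope complex_scope.
Local Notation mu := (@lebesgue_measure R).
Local Notation RT := (measurableTypeR R).
Local Notation mu2 := (@lebesgue2 R).
Local Notation Re := (@complex.Re R).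
Local Notation Im := (@complex.Im R).
Implicit Types (f g : R -> R[i]).

Lemma cabs_sqr (z : R[i]) : cabs z ^+ 2 = Re z ^+ 2 + Im z ^+ 2.
Proof. by case: z => a b; rewrite /cabs/= sqr_sqrtr// addr_ge0// sqr_ge0. Qed.

Lemma cabs_ge0 (z : R[i]) : 0 <= cabs z.
Proof. by case: z => a b; rewrite /cabs/= sqrtr_ge0. Qed.

Lemma cabs_le (z : R[i]) : cabs z <= `|Re z| + `|Im z|.
Proof.
have s0 : 0 <= `|Re z| + `|Im z| by rewrite addr_ge0.
rewrite -ler_sqr ?nnegrE ?cabs_ge0// cabs_sqr sqrrD !real_normK ?num_real//.
by rewrite addrAC lerDl mulrn_wge0// mulr_ge0.
Qed.

(** The modulus is 1-Lipschitz, and is at most the sum of the absolute values of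
    the two coordinates. *)
Lemma cabs_dist_le (z w : R[i]) : `|cabs z - cabs w| <= `|Re z - Re w| + `|Im z - Im w|.
Proof.
have tri (x y : R[i]) : cabs x <= `|Re x - Re y| + `|Im x - Im y| + cabs y.
  have := le_normcD (x - y) y; rewrite subrK => /le_trans; apply.
  rewrite lerD2r; have := cabs_le (x - y); rewrite /cabs.
  by case: x => a b; case: y => c d.
have h1 := tri z w; have := tri w z.
rewrite [`|Re w - _|]distrC [`|Im w - _|]distrC => h2.
rewrite ler_norml; apply/andP; split; lra.
Qed.

Lemma integral_cabs_sqr f : measurable_fun [set: RT] (fun y => Re (f y)) ->
  measurable_fun [set: RT] (fun y => Im (f y)) ->
  (\int[mu]_y (`|(cabs (f y))%:E| `^ 2) =
   \int[mu]_y (Re (f y) ^+ 2)%:E + \int[mu]_y (Im (f y) ^+ 2)%:E)%E.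
Proof.
move=> mr mi; rewrite -integralD_EFin_ge0; [|by mfun|by mfun
  |by move=> y; exact: sqr_ge0|by move=> y; exact: sqr_ge0].
apply: eq_integral => y _.
by rewrite abse_EFin poweR_EFin powR_mulrn// real_normK ?num_real// cabs_sqr.
Qed.

Lemma L2_parts f : L2 f -> exists B, L2le B (fun y => Re (f y)) /\ L2le B (fun y => Im (f y)).
Proof.
move=> [mr mi foo].
have two0 : (2 : R) != 0 by [].
have := poweR_lty 2 foo; rewrite poweR_Lnorm// integral_cabs_sqr//.
set a := (\int[mu]_y (Re (f y) ^+ 2)%:E)%E; set b := (\int[mu]_y (Im (f y) ^+ 2)%:E)%E => abo.
have a0 : (0 <= a)%E by apply: integral_ge0 => y _; rewrite lee_fin sqr_ge0.
have b0 : (0 <= b)%E by apply: integral_ge0 => y _; rewrite lee_fin sqr_ge0.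
have abfin : (a + b)%E \is a fin_num by rewrite ge0_fin_numE// adde_ge0.
exists (fine (a + b)%E); split; split => //; rewrite fineK//.
- by rewrite leeDl.
- by rewrite leeDr.
Qed.

Lemma L2_real (g : R -> R) C : L2le C g -> L2 (fun y => (g y)%:C).
Proof.
move=> [mg gC]; split => //.
have two0 : (2 : R) != 0 by [].
apply: (lty_poweRy two0); rewrite poweR_Lnorm// integral_cabs_sqr//=.
under [X in (_ + X)%E]eq_integral do rewrite expr0n/=.
by rewrite integral0 adde0; apply: le_lt_trans gC _; rewrite ltry.
Qed.

Lemma L2dot_real f (g : R -> R) :
  L2dot f (fun y => (g y)%:C) =
  (\int[mu]_y (Re (f y) * g y)) +i* (\int[mu]_y (Im (f y) * g y)).
Proof.
rewrite /L2dot /cintegral; congr (_ +i* _); apply: eq_Rintegral => y _.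
  by case: (f y) => a b /=; rewrite oppr0 mulr0 subr0.
by case: (f y) => a b /=; rewrite oppr0 mulr0 add0r.
Qed.

Lemma cvg_complex_parts (un : nat -> R[i]) (z : R[i]) :
  ((un : nat -> R[i]^o) @ \oo --> (z : R[i]^o)) ->
  (Re (un n) @[n --> \oo] --> Re z) /\ (Im (un n) @[n --> \oo] --> Im z).
Proof.
move=> /cvgrPdist_lt h.
have key e : 0 < e -> \forall n \near \oo, cabs (z - un n) < e.
  move=> e0; have := h e%:C; rewrite ltcR => /(_ e0).
  by apply: filterS => n; rewrite normc_def; case: (z - un n) => a b; rewrite ltcR.
have reim (x : R[i]) : `|Re x| <= cabs x /\ `|Im x| <= cabs x.
  by split; rewrite -ler_sqr ?nnegrE ?cabs_ge0// cabs_sqr real_normK ?num_real// ?lerDl ?lerDr sqr_ge0.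
split; apply/cvgrPdist_lt => e e0; apply: filterS (key e e0) => n; apply: le_lt_trans.
- by have [+ _] := reim (z - un n); case: z {h key} => a b; case: (un n).
- by have [_ +] := reim (z - un n); case: z {h key} => a b; case: (un n).
Qed.

(** Real test functions separate the real part of a pairing from its imaginary
    part. *)
Lemma weak_cvg_parts (fn : nat -> R -> R[i]) f : weak_cvg fn f ->
  weak_cvgR (fun n y => Re (fn n y)) (fun y => Re (f y)) /\
  weak_cvgR (fun n y => Im (fn n y)) (fun y => Im (f y)).
Proof.
move=> fnf; split => g C gC; have := fnf _ (L2_real gC);
  move=> /cvg_complex_parts[cr ci].
- rewrite (_ : (fun n => _) = fun n => Re (L2dot (fn n) (fun y => (g y)%:C))).
    by rewrite (_ : \int[mu]_y _ = Re (L2dot f (fun y => (g y)%:C)))// L2dot_real.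
  by apply/funext => n; rewrite L2dot_real.
- rewrite (_ : (fun n => _) = fun n => Im (L2dot (fn n) (fun y => (g y)%:C))).
    by rewrite (_ : \int[mu]_y _ = Im (L2dot f (fun y => (g y)%:C)))// L2dot_real.
  by apply/funext => n; rewrite L2dot_real.
Qed.

Local Notation c := (2 * pi : R).
Local Notation bj b u v p := (bj_form b c (cst 1) u v p).
Local Notation J := (`]0%R, 1%R[%classic : set RT).

Lemma integrable_bj b (u v : R -> R) (z : RT * RT) B : L2le B u -> L2le B v ->
  mu2.-integrable setT (EFin \o
    integrand (fun y => cst 1 y * osc b (z.2 * (c * y))) u v z.1).
Proof.
by move=> uB vB; exact: integrable_integrand (weight_osc b c z.2 weight1) uB vB.
Qed.

(** The distribution is defined with y as the inner variable and t as the outer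
    one, the forms as integrals over the pairs (y, t).  Fubini is applied to the sum
    P of the four integrands rather than to each, so that the inner integral of
    the sum never has to be split at a given t. *)
Lemma Rintegral_iterated (P : RT * RT -> R) (G : R -> R -> R) :
  mu2.-integrable setT (EFin \o P) ->
  (forall y t, P (y, t) = \1_J t * G t y) ->
  \int[mu]_(t in `]0%R, 1%R[) \int[mu]_y G t y = \int[mu2]_w P w.
Proof.
move=> iP PE; rewrite (lebesgue2_fubini2 iP) Rintegral_mkcond.
apply: eq_Rintegral => t _; rewrite patchE.
under [RHS]eq_Rintegral do rewrite PE indicE.
case: ifP => _; first by apply: eq_Rintegral => y _; rewrite mul1r.
by under eq_Rintegral do rewrite mul0r; rewrite Rintegral_cst// mul0r.
Qed.

(** Expanding e^(- i theta) f (p) conj (f (q)) gives four real products; the minus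
    sign in the exponential reverses the sign of the sine terms. *)
Lemma born_jordan_Re f (z : RT * RT) B :
  L2le B (fun y => Re (f y)) -> L2le B (fun y => Im (f y)) ->
  Re (born_jordan f z) =
    bj true (fun y => Re (f y)) (fun y => Re (f y)) z +
    bj true (fun y => Im (f y)) (fun y => Im (f y)) z +
    bj false (fun y => Im (f y)) (fun y => Re (f y)) z -
    bj false (fun y => Re (f y)) (fun y => Im (f y)) z.
Proof.
move=> aB bB; rewrite /born_jordan /cintegral/= /tau_wigner /cintegral/=.
have i1 := integrable_bj true z aB aB; have i2 := integrable_bj true z bB bB.
have i3 := integrable_bj false z bB aB; have i4 := integrable_bj false z aB bB.
have i12 := integrableD measurableT i1 i2.
have i123 := integrableD measurableT i12 i3.
have i1234 := integrableB measurableT i123 i4.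
rewrite /bj_form /form -RintegralD// -RintegralD// -RintegralB//.
apply: Rintegral_iterated; first exact: i1234.
move=> y t; rewrite /integrand/osc/= /cis.
rewrite (_ : z.2 * (c * y) = 2 * pi * z.2 * y); last by ring.
case: (f _) => a1 b1; case: (f _) => a2 b2 /=.
by rewrite cosN sinN; ring.
Qed.

Lemma born_jordan_Im f (z : RT * RT) B :
  L2le B (fun y => Re (f y)) -> L2le B (fun y => Im (f y)) ->
  Im (born_jordan f z) =
    bj true (fun y => Im (f y)) (fun y => Re (f y)) z -
    bj true (fun y => Re (f y)) (fun y => Im (f y)) z -
    bj false (fun y => Re (f y)) (fun y => Re (f y)) z -
    bj false (fun y => Im (f y)) (fun y => Im (f y)) z.
Proof.
move=> aB bB; rewrite /born_jordan /cintegral/= /tau_wigner /cintegral/=.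
have i1 := integrable_bj true z bB aB; have i2 := integrable_bj true z aB bB.
have i3 := integrable_bj false z aB aB; have i4 := integrable_bj false z bB bB.
have i12 := integrableB measurableT i1 i2.
have i123 := integrableB measurableT i12 i3.
have i1234 := integrableB measurableT i123 i4.
rewrite /bj_form /form -RintegralB// -RintegralB// -RintegralB//.
apply: Rintegral_iterated; first exact: i1234.
move=> y t; rewrite /integrand/osc/= /cis.
rewrite (_ : z.2 * (c * y) = 2 * pi * z.2 * y); last by ring.
case: (f _) => a1 b1; case: (f _) => a2 b2 /=.
by rewrite cosN sinN; ring.
Qed.

Lemma measurable_born_jordan f B :
  L2le B (fun y => Re (f y)) -> L2le B (fun y => Im (f y)) ->
  measurable_fun [set: RT * RT] (fun z => cabs (born_jordan f z)).
Proof.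
move=> aB bB; have [ma _] := aB; have [mb _] := bB.
have m1 : measurable_fun [set: RT] (cst 1 : R -> R) by exact: measurable_cst.
have mbj b (u v : R -> R) : measurable_fun [set: RT] u -> measurable_fun [set: RT] v ->
    measurable_fun [set: RT * RT] (bj_form b c (cst 1) u v).
  by move=> ? ?; exact: measurable_bj_form.
have mRe : measurable_fun [set: RT * RT] (fun z => Re (born_jordan f z)).
  under eq_fun do rewrite (born_jordan_Re _ aB bB).
  by apply: measurable_funB; last exact: mbj;
    do 2 (apply: measurable_funD; last exact: mbj); exact: mbj.
have mIm : measurable_fun [set: RT * RT] (fun z => Im (born_jordan f z)).
  under eq_fun do rewrite (born_jordan_Im _ aB bB).
  by do 3 (apply: measurable_funB; last exact: mbj); exact: mbj.
rewrite (_ : (fun z => _) = fun z => Num.sqrt (Re (born_jordan f z) ^+ 2 + Im (born_jordan f z) ^+ 2)).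
  have ms : measurable_fun [set: R] (@Num.sqrt R).
    by apply: continuous_measurable_fun; exact: sqrt_continuous.
  refine (measurableT_comp (g := fun z : RT * RT => Re (born_jordan f z) ^+ 2 + Im (born_jordan f z) ^+ 2) ms _).
  exact: measurable_funD (measurable_funX 2 mRe) (measurable_funX 2 mIm).
by apply/funext => z; rewrite -cabs_sqr sqrtr_sqr ger0_norm// cabs_ge0.
Qed.

Lemma born_jordan_le f z B :
  L2le B (fun y => Re (f y)) -> L2le B (fun y => Im (f y)) ->
  `|cabs (born_jordan f z)| <= 8 * (form_bound * B).
Proof.
move=> aB bB; rewrite ger0_norm ?cabs_ge0//; apply: le_trans (cabs_le _) _.
rewrite (born_jordan_Re _ aB bB) (born_jordan_Im _ aB bB).
have h b (u v : R -> R) := @bj_form_le R b c (cst 1) u v B z weight1.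
apply: (@le_trans _ _ (form_bound * B + form_bound * B + form_bound * B + form_bound * B +
  (form_bound * B + form_bound * B + form_bound * B + form_bound * B))); last by lra.
apply: lerD.
  apply: le_trans (ler_normB _ _) _; apply: lerD; last exact: h.
  apply: le_trans (ler_normD _ _) _; apply: lerD; last exact: h.
  by apply: le_trans (ler_normD _ _) _; apply: lerD; exact: h.
apply: le_trans (ler_normB _ _) _; apply: lerD; last exact: h.
apply: le_trans (ler_normB _ _) _; apply: lerD; last exact: h.
by apply: le_trans (ler_normB _ _) _; apply: lerD; exact: h.
Qed.

(** Nonnegative functions whose mean over each square tends to 0; closed under
    sums, which assembles the eight real forms of the distribution. *)
Definition box_null (Dn : nat -> RT * RT -> R) :=
  [/\ forall n, measurable_fun setT (Dn n), forall n z, 0 <= Dn n z &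
  forall N e, 0 < N -> 0 < e -> \forall n \near \oo,
     (\int[mu2]_z (box N z * Dn n z)%:E <= e%:E)%E].

Lemma box_nullD Dn Dn' : box_null Dn -> box_null Dn' ->
  box_null (fun n z => Dn n z + Dn' n z).
Proof.
move=> [m1 p1 s1] [m2 p2 s2]; split.
- by move=> n; have := m1 n; have := m2 n => ? ?; mfun.
- by move=> n z; rewrite addr_ge0.
move=> N e N0 e0; have e2 : 0 < e / 2 by rewrite divr_gt0.
near=> n.
have mb := @measurable_box R N; have m1n := m1 n; have m2n := m2 n.
under eq_integral do rewrite mulrDr.
rewrite integralD_EFin_ge0; [|by mfun|by mfun|by move=> z; rewrite mulr_ge0 ?box_ge0
  |by move=> z; rewrite mulr_ge0 ?box_ge0].
rewrite (splitr e) EFinD; apply: leeD; near: n; [exact: s1|exact: s2].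
Unshelve. all: by end_near. Qed.

Section convergence.
Variables (fn : nat -> R -> R[i]) (f : R -> R[i]) (B : R).
Hypotheses (fnR : forall n, L2le B (fun y => Re (fn n y)))
  (fnI : forall n, L2le B (fun y => Im (fn n y)))
  (fR : L2le B (fun y => Re (f y))) (fI : L2le B (fun y => Im (f y)))
  (fnf : weak_cvg fn f).

Let part (b : bool) (x : R[i]) : R := if b then Re x else Im x.

Let diff b p q n (z : RT * RT) : R :=
  `|bj b (fun y => part p (fn n y)) (fun y => part q (fn n y)) z -
    bj b (fun y => part p (f y)) (fun y => part q (f y)) z|.

Let c_neq0 : c != 0.
Proof. by apply: lt0r_neq0; apply: mulr_gt0 => //; exact: pi_gt0. Qed.

Let diff_null b p q : box_null (diff b p q).
Proof.
have [wR wI] := weak_cvg_parts fnf.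
have hn r n : L2le B (fun y => part r (fn n y)).
  by case: r; [exact: fnR|exact: fnI].
have h r : L2le B (fun y => part r (f y)).
  by case: r; [exact: fR|exact: fI].
have w r : weak_cvgR (fun n y => part r (fn n y)) (fun y => part r (f y)).
  by case: r; [exact: wR|exact: wI].
have mbj (u v : R -> R) : L2le B u -> L2le B v ->
    measurable_fun [set: RT * RT] (bj_form b c (cst 1) u v).
  by move=> [mu_ _] [mv _]; apply: measurable_bj_form => //; exact: measurable_cst.
split => //.
- move=> n; have m1 := mbj _ _ (hn p n) (hn q n); have m2 := mbj _ _ (h p) (h q).
  by rewrite /diff; mfun.
- by move=> n z; exact: normr_ge0.
move=> N e N0 e0.
exact: (bj_box_cvg b c_neq0 N0 e0 (hn p) (hn q) (h p) (h q) (w p) (w q)).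
Qed.

(** The difference of the moduli is at most the sum of the differences of the eight
    real forms, each of which tends to 0 in mean on squares. *)
Lemma born_jordan_box_cvg N e : 0 < N -> 0 < e -> \forall n \near \oo,
  (\int[mu2]_z (box N z * `|cabs (born_jordan (fn n) z) - cabs (born_jordan f z)|)%:E <= e%:E)%E.
Proof.
move=> N0 e0.
have [mS S0 Sn] := box_nullD
  (box_nullD (box_nullD (diff_null true true true) (diff_null true false false))
             (box_nullD (diff_null false false true) (diff_null false true false)))
  (box_nullD (box_nullD (diff_null true false true) (diff_null true true false))
             (box_nullD (diff_null false true true) (diff_null false false false))).
apply: filterS (Sn N e N0 e0) => n; apply: le_trans.
have mb := @measurable_box R N.
have mn := measurable_born_jordan (fnR n) (fnI n).
have m := measurable_born_jordan fR fI.
have mSn := mS n.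
have mdist := measurable_funM mb (measurableT_comp (@normr_measurable R setT) (measurable_funB mn m)).
apply: (le_integral_EFin mu2 mdist (measurable_funM mb mSn)) => z.
  by apply: mulr_ge0; [exact: box_ge0|exact: normr_ge0].
apply: ler_wpM2l; first exact: box_ge0.
apply: le_trans (cabs_dist_le _ _) _.
rewrite (born_jordan_Re _ (fnR n) (fnI n)) (born_jordan_Im _ (fnR n) (fnI n)).
rewrite (born_jordan_Re _ fR fI) (born_jordan_Im _ fR fI).
have tri (a1 a2 a3 a4 b1 b2 b3 b4 : R) :
    `|a1 + a2 + a3 + a4 - (b1 + b2 + b3 + b4)| <=
    `|a1 - b1| + `|a2 - b2| + (`|a3 - b3| + `|a4 - b4|).
  rewrite (_ : _ - _ = (a1 - b1) + (a2 - b2) + ((a3 - b3) + (a4 - b4))); last by ring.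
  by apply: le_trans (ler_normD _ _) _; apply: lerD; exact: ler_normD.
have neg (a b : R) : `|- a - - b| = `|a - b| by rewrite -opprD normrN.
rewrite /diff /part; apply: lerD.
  apply: le_trans (tri _ _ _ _ _ _ _ _) _.
  by rewrite neg.
by apply: le_trans (tri _ _ _ _ _ _ _ _) _; rewrite !neg.
Qed.

End convergence.

End complex_reduction.

Unset Implicit Arguments.
Local Open Scope complex_scope.

Theorem proposition6p4 (R : realType) (p : R) (hp : 1 <= p)
    (Omega : set (plane R)) (mOmega : measurable Omega)
    (Omega_gt0 : (0 < lebesgue_measure2 R Omega)%E)
    (Omega_fin : (lebesgue_measure2 R Omega < +oo)%E) :
  forall (fn : nat -> R -> R[i]) (f : R -> R[i]),
    (forall n, L2 (fn n)) -> L2 f -> weak_cvg fn f ->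
    J_BJ p Omega (fn n) @[n --> \oo] --> J_BJ p Omega f.
Proof.
move=> fn f fnL fL fnf.
have [wR wI] := weak_cvg_parts fnf.
have bounded (un : nat -> R -> R) (u : R -> R) : (forall n, exists B, L2le B (un n)) ->
    weak_cvgR un u -> exists B, forall n, L2le B (un n).
  move=> unB unu; apply: weak_bounded => // g C gC.
  have /cvg_seq_bounded[M [_ hM]] : cvgn (fun n => \int[lebesgue_measure]_t (un n t * g t)).
    by apply/cvg_ex; eexists; exact: unu gC.
  by exists (M + 1) => n; apply: hM => //; rewrite ltrDl.
have [BR fnR] : exists B, forall n, L2le B (fun y => complex.Re (fn n y)).
  by apply: bounded wR => n; have [B [? _]] := L2_parts (fnL n); exists B.
have [BI fnI] : exists B, forall n, L2le B (fun y => complex.Im (fn n y)).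
  by apply: bounded wI => n; have [B [_ ?]] := L2_parts (fnL n); exists B.
have [B0 [fR fI]] := L2_parts fL.
pose B := Num.max B0 (Num.max BR BI).
have L2le_mono (C D : R) (u : R -> R) : C <= D -> L2le C u -> L2le D u.
  by move=> CD [mu_ uC]; split => //; apply: le_trans uC _; rewrite lee_fin.
have {}fnR n : L2le B (fun y => complex.Re (fn n y)).
  by apply: L2le_mono (fnR n); rewrite !le_max lexx orbT.
have {}fnI n : L2le B (fun y => complex.Im (fn n y)).
  by apply: L2le_mono (fnI n); rewrite !le_max lexx !orbT.
have {}fR : L2le B (fun y => complex.Re (f y)).
  by apply: L2le_mono fR; rewrite !le_max lexx.
have {}fI : L2le B (fun y => complex.Im (f y)).
  by apply: L2le_mono fI; rewrite !le_max lexx.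
apply: (Lnorm_restrict_cvg (K := 8 * (form_bound * B)) hp mOmega Omega_fin
  (Wn := fun n z => cabs (born_jordan (fn n) z)) (W := fun z => cabs (born_jordan f z))).
- by move=> n; exact: measurable_born_jordan (fnR n) (fnI n).
- exact: measurable_born_jordan fR fI.
- by move=> n z; exact: born_jordan_le (fnR n) (fnI n).
- by move=> z; exact: born_jordan_le fR fI.
- by move=> N e; exact: born_jordan_box_cvg.
Qed.
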